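(* Let $K$ and $K'$ be regular Cantor sets, with Hausdorff dimensions $d$ and $d'$ respectively, such that $K$ satisfies property $(H\alpha)$ for some $\alpha>0$. Suppose that (i) $K$ has two periodic orbits whose ratio of logarithms of the norms of their eigenvalues is irrational, or (ii) $K$ has a sequence of periodic points $(x_n)$ with corresponding eigenvalues $(\mu_n)$ such that $(\log|\mu_n|/\log|\mu_1|)$ is a sequence of rational numbers whose denominators tend to $+\infty$. Then, given a $C^1$ map $h$ from a neighbourhood of $K\times K'$ to $\mathbb{R}$ such that, at some point of $K\times K'$, its gradient is not parallel to either of the two coordinate axes (i.e. both partial derivatives are nonzero there), we have $$HD(h(K\times K'))=\min\{1,\,d+d'\},$$ where $HD$ denotes Hausdorff dimension.
   Context: Regular Cantor sets. Let $\mathbf{A}$ be a finite alphabet and $\Sigma\subset\mathbf{A}^{\mathbb{Z}}$ a subshift of finite type defined by a transition set $\mathcal{B}\subset\mathbf{A}^2$; $\Sigma$ is always assumed to be mixing and to use all letters of $\mathbf{A}$. A word of $\Sigma$ is a finite sequence of letters respecting the transitions. For $a\in\mathbf{A}$ put $I(a)=[0,1]\times\{a\}$ (the $I(a)$ may be identified affinely with disjoint compact intervals of the line). Let $r\in(1,+\infty]$. A $C^r$ map $g$ is expanding of type $\Sigma$ if its domain is a finite disjoint union $\bigsqcup_{(a_0,a_1)\in\mathcal{B}}I(a_0,a_1)$, each $I(a_0,a_1)$ being a compact subinterval of $I(a_0)$, and if each restriction $g|_{I(a_0,a_1)}$ is a $C^r$-diffeomorphism onto $I(a_1)$ with $|Dg|>1$.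 It defines the regular Cantor set $K=\bigcap_{n\ge0}g^{-n}(\bigsqcup_{\mathcal{B}}I(a_0,a_1))$. A regular Cantor set is one obtained this way for some $r>1$; $K'$ is obtained from an expanding map $g'$ with its own alphabet and subshift. A periodic orbit (point) of $K$ means one of $g|_K$; the eigenvalue of a periodic point $x$ of period $n$ is $Dg^n(x)$. Denominators of rational numbers are taken in lowest terms. Limit geometries. For $(a_0,a_1)\in\mathcal{B}$ let $f_{a_0a_1}=(g|_{I(a_0,a_1)})^{-1}$; for a word $\underline a=(a_0,\dots,a_n)$ let $f_{\underline a}=f_{a_0a_1}\circ\cdots\circ f_{a_{n-1}a_n}$, a diffeomorphism from $I(a_n)$ onto a subinterval $I(\underline a)$ of $I(a_0)$. Let $\Sigma^-$ be the set of one-sided admissible sequences $\underline\theta=(\theta_m)_{m\le0}$. For $n\ge1$ put $\underline\theta^n=(\theta_{-n},\dots,\theta_0)$ and $k_n^{\underline\theta}=B\circ f_{\underline\theta^n}$, where $B$ is the affine map from $I(\underline\theta^n)$ onto $I(\theta_0)$ making $k_n^{\underline\theta}$ orientation preserving. As $n\to\infty$, $k_n^{\underline\theta}$ converges (in $C^{r'}$ for all $r'<r$) to a diffeomorphism $k^{\underline\theta}$ of $I(\theta_0)$. For a word $\underline b$ beginning with $\theta_0$, put $I^{\underline\theta}(\underline b)=k^{\underline\theta}(I(\underline b))$. $|J|$ denotes the length of an interval $J$. Property $(H\alpha)$. A constant $c_0>1$, large enough, is fixed once and for all. For $0<\rho<1$ let $\Sigma(\rho)$ be the set of words $\underline a$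 of $\Sigma$ with $c_0^{-1}\rho\le|I(\underline a)|\le c_0\rho$. Let $d=HD(K)$ and $\alpha\in(0,1]$. $K$ satisfies $(H\alpha)$ if there exist $\eta>0$ and $\rho_1\in(0,1)$ such that, for every $0<\rho<\rho_1$, every $1\le\xi\le\rho^{-\alpha}$ and every subset $X\subset\Sigma(\rho)$ with $\#(\Sigma(\rho)\setminus X)<\eta\rho^{-d}$, one can find $\underline a^0,\underline a^1\in X$ (with the same last letter) such that for every $\Phi\in\mathbb{R}$ and every $\underline\theta^0,\underline\theta^1\in\Sigma^-$ ending respectively by $\underline a^0,\underline a^1$, $$\#\Big\{\underline b\in\Sigma(\rho):\ \Big|\sin\Big[\tfrac12\,\xi\,\log\frac{|I^{\underline\theta^0}(\underline b)|}{|I^{\underline\theta^1}(\underline b)|}+\Phi\Big]\Big|\ge\eta\Big\}\ \ge\ \eta\,\rho^{-d},$$ where only words $\underline b$ beginning with the common last letter of $\underline\theta^0,\underline\theta^1$ are considered. *)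

(* Defs.v *)
From HB Require Import structures.
From mathcomp Require Import all_boot all_order all_algebra.
From mathcomp Require Import finmap all_classical all_reals all_analysis.

Set Implicit Arguments.
Unset Strict Implicit.
Unset Printing Implicit Defensive.

Import Order.TTheory GRing.Theory Num.Theory numFieldNormedType.Exports.

Local Open Scope classical_set_scope.
Local Open Scope ring_scope.

(** * Hausdorff dimension *)

Section HausdorffDimension.
Context {R : realType} {T : pseudoMetricType R}.
Local Open Scope ereal_scope.

Definition diam (U : set T) : \bar R :=
  ereal_inf [set e%:E | e in
    [set e : R | (0 < e)%R /\ forall x y, U x -> U y -> ball x e y]].

(* The empty set contributes 0 for every [s], including [s = 0]. *)
Definition hausdorff_gauge (s : R) (U : set T) : \bar R :=
  if `[< U = set0 >] then 0 else diam U `^ s.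

Definition hausdorff_premeasure (s delta : R) (E : set T) : \bar R :=
  ereal_inf [set \sum_(0 <= i <oo) hausdorff_gauge s (U i) | U in
    [set U : nat -> set T |
      E `<=` \bigcup_i U i /\ forall i, diam (U i) <= delta%:E]].

Definition hausdorff_measure (s : R) (E : set T) : \bar R :=
  ereal_sup [set hausdorff_premeasure s delta E | delta in
    [set delta : R | (0 < delta)%R]].

Definition HD (E : set T) : \bar R :=
  ereal_inf [set s%:E | s in
    [set s : R | (0 <= s)%R /\ hausdorff_measure s E = 0]].

End HausdorffDimension.

(** * Differentiability relative to a set, C^r maps and diffeomorphisms *)

Section RelativeSmoothness.
Context {R : realType}.
Implicit Types (D E : set R) (f : R -> R).

(* Only the values of [f] on [D] matter; at an endpoint of an interval [D]
   these derivatives are one-sided. *)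
Definition difference_quotient f (x y : R) : R := (f y - f x) / (y - x).

Definition derivable_in D f (x : R) : Prop :=
  cvg (difference_quotient f x y @[y --> within D x^']).

Definition derive_in D f (x : R) : R :=
  lim (difference_quotient f x y @[y --> within D x^']).

Definition Cn_on D (m : nat) f : Prop :=
  (forall k x, (k < m)%N -> D x -> derivable_in D (iter k (derive_in D) f) x) /\
  {within D, continuous (iter m (derive_in D) f)}.

(* For a finite [r], with [m] the integer part of [r], the [m]-th derivative is
   (r - m)-Hoelder.  When [r] is an integer the exponent is 0, and on the
   compact sets [D] used below the Hoelder bound is then automatic, so that
   this is the usual class C^m. *)
Definition Cr_on D (r : \bar R) f : Prop :=
  match r with
  | s%:E => let m := Num.truncn s in
      Cn_on D m f /\
      exists C : R, forall x y, D x -> D y ->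
        `| iter m (derive_in D) f x - iter m (derive_in D) f y |
          <= C * `|x - y| `^ (s - m%:R)
  | +oo%E => forall m, Cn_on D m f
  | -oo%E => False
  end.

Definition inverse_on D f : R -> R := 'pinv_(fun=> 0) D f.

Definition Cr_diffeo (r : \bar R) D E f : Prop :=
  [/\ set_bij D E f, Cr_on D r f & Cr_on E r (inverse_on D f)].

Definition interval_length (J : set R) : R := sup J - inf J.

End RelativeSmoothness.

(** * Subshifts of finite type *)

Section Subshift.
Context {A : finType} (B : rel A).

Definition subshift : set {ptws int -> discrete_topology A} :=
  [set x | forall n : int, B (x n) (x (n + 1))].

Definition left_shift (x : {ptws int -> discrete_topology A}) :
  {ptws int -> discrete_topology A} := fun n => x (n + 1).

Definition mixing : Prop :=
  forall U V : set {ptws int -> discrete_topology A}, open U -> open V ->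
    subshift `&` U !=set0 -> subshift `&` V !=set0 ->
    exists N : nat, forall n : nat, (N <= n)%N ->
      exists x, [/\ subshift x, U x & V (iter n left_shift x)].

Definition uses_all_letters : Prop :=
  forall a, exists2 x, subshift x & x 0 = a.

Definition word : set (seq A) := [set w | w != [::] /\ sorted B w].

(* [theta m] is the letter of index [-m]. *)
Definition past : set (nat -> A) :=
  [set theta | forall m, B (theta m.+1) (theta m)].

(* The word made of the [n] last letters of [theta], read from left to
   right. *)
Definition past_word (theta : nat -> A) (n : nat) : seq A :=
  rev (mkseq theta n).

Definition ends_by (theta : nat -> A) (w : seq A) : Prop :=
  past_word theta (size w) = w.

End Subshift.

(** * Expanding maps and regular Cantor sets *)

(* A disjoint union of copies of the line, one for each letter; I(a) is
   [0, 1] x {a}. *)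
Notation lines R A := (R * discrete_topology A)%type.

(* [gmap] is a total function; only its values on [domain] below matter. *)
Record expanding_data (R : realType) (A : finType) := ExpandingData {
  trans : rel A;
  left_end : A -> A -> R;
  right_end : A -> A -> R;
  gmap : lines R A -> lines R A }.

Section RegularCantorSets.
Context {R : realType} {A : finType} (g : expanding_data R A).

Definition subint (a b : A) : set R := `[left_end g a b, right_end g a b].

Definition gcoord (a : A) (x : R) : R := (gmap g (x, a)).1.

Definition domain : set (lines R A) :=
  [set z | exists2 b, trans g z.2 b & subint z.2 b z.1].

Definition domain_iter (n : nat) : set (lines R A) :=
  [set z | forall i, (i < n)%N -> domain (iter i (gmap g) z)].

(* The derivative at [z] of the [n]-th iterate of the map, on its domain. *)
Definition Diter (n : nat) (z : lines R A) : R :=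
  derive_in [set y | domain_iter n (y, z.2)]
    (fun y => (iter n (gmap g) (y, z.2)).1) z.1.

Definition expanding (r : \bar R) : Prop :=
  (mixing (trans g) /\ uses_all_letters (trans g)) /\
  [/\ forall a b, trans g a b ->
        [/\ 0 <= left_end g a b, left_end g a b < right_end g a b
          & right_end g a b <= 1],
      forall a b b', trans g a b -> trans g a b' -> b != b' ->
        subint a b `&` subint a b' = set0,
      forall a b x, trans g a b -> subint a b x -> (gmap g (x, a)).2 = b,
      forall a b, trans g a b -> Cr_diffeo r (subint a b) `[0, 1] (gcoord a)
    & forall z, domain z -> 1 < `|Diter 1 z| ].

Definition regular_map : Prop := exists2 r : \bar R, (1 < r)%E & expanding r.

Definition cantor_set : set (lines R A) :=
  [set z | forall n, domain (iter n (gmap g) z)].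

(* [n] is the least period, so that the eigenvalue [Diter n z] is well
   defined. *)
Definition periodic_point (n : nat) (z : lines R A) : Prop :=
  [/\ cantor_set z, (0 < n)%N, iter n (gmap g) z = z
    & forall m, (0 < m < n)%N -> iter m (gmap g) z <> z].

(** ** Limit geometries *)

(* The maps f_w and intervals I(w) are given by their coordinate in the copy of
   the line indexed by the first letter of [w]. *)
Definition inverse_branch (a b : A) : R -> R :=
  inverse_on (subint a b) (gcoord a).

Fixpoint inverse_path (a : A) (s : seq A) : R -> R :=
  if s is b :: s' then inverse_branch a b \o inverse_path b s' else id.

Definition inverse_word (w : seq A) : R -> R :=
  if w is a :: s then inverse_path a s else id.

Definition word_interval (w : seq A) : set R := inverse_word w @` `[0, 1].

(* The affine map from I(theta^n) onto [0, 1] whose composition with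
   f_(theta^n) preserves orientation sends f_(theta^n)(0) to 0 and
   f_(theta^n)(1) to 1. *)
Definition k_approx (theta : nat -> A) (n : nat) (x : R) : R :=
  let f := inverse_word (past_word theta n.+1) in (f x - f 0) / (f 1 - f 0).

Definition k_limit (theta : nat -> A) (x : R) : R :=
  lim (k_approx theta n x @[n --> \oo]).

Definition limit_interval (theta : nat -> A) (w : seq A) : set R :=
  k_limit theta @` word_interval w.

(** ** Property (H alpha) *)

Definition words_of_size (c0 rho : R) : set (seq A) :=
  [set w | word (trans g) w /\
    c0^-1 * rho <= interval_length (word_interval w) <= c0 * rho].

Definition property_H (c0 alpha : R) : Prop :=
  let d := fine (HD cantor_set) in
  exists eta rho1 : R, [/\ 0 < eta, 0 < rho1 < 1 &
    forall rho : R, 0 < rho < rho1 ->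
    forall xi : R, 1 <= xi <= rho `^ (- alpha) ->
    forall X : set (seq A), X `<=` words_of_size c0 rho ->
      (counting (words_of_size c0 rho `\` X) < (eta * rho `^ (- d))%:E)%E ->
    exists (s0 s1 : seq A) (c : A), [/\ X (rcons s0 c), X (rcons s1 c) &
      forall (Phi : R) (theta0 theta1 : nat -> A),
        past (trans g) theta0 -> past (trans g) theta1 ->
        ends_by theta0 (rcons s0 c) -> ends_by theta1 (rcons s1 c) ->
        ((eta * rho `^ (- d))%:E <=
         counting [set b | [/\ words_of_size c0 rho b, ohead b = Some c &
           (eta <= `|sin (2^-1 * xi *
              ln (interval_length (limit_interval theta0 b) /
                  interval_length (limit_interval theta1 b)) + Phi)|)%R]])%E]].

(* Enlarging the constant c0 preserves the property: a statement about all
   c0 > 1 is the same as one about all large enough c0. *)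
Lemma property_H_mono (c0 c1 alpha : R) :
  0 < c0 -> c0 <= c1 -> property_H c0 alpha -> property_H c1 alpha.
Proof.
move=> c0_gt0 le_c [eta [rho1 [eta0 rho1P H]]].
have sub rho : 0 < rho -> words_of_size c0 rho `<=` words_of_size c1 rho.
  move=> rho0 w [ww /andP[lo hi]]; split=> //; apply/andP; split.
    apply: le_trans lo; rewrite ler_wpM2r ?(ltW rho0)// lef_pV2 ?posrE//.
    exact: lt_le_trans le_c.
  by apply: (le_trans hi); rewrite ler_wpM2r ?(ltW rho0).
have le_counting (P Q : set (seq A)) : P `<=` Q ->
    (counting P <= counting Q :> \bar R)%E.
  move=> PQ; rewrite /counting; case: asboolP => [finP|nfinP].
    case: asboolP => [finQ|_]; last exact: leey.
    rewrite lee_fin ler_nat; apply: fsubset_leq_card.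
    by apply/fsubsetP => x; rewrite !in_fset_set// !inE => /PQ.
  case: asboolP => [finQ|_ //]; exfalso; apply: nfinP.
  exact: sub_finite_set finQ.
exists eta, rho1; split=> // rho rhoP xi xiP X Xsub Xlt.
have rho0 : 0 < rho by case/andP: rhoP.
have Xlt' : (counting (words_of_size c0 rho `\` (X `&` words_of_size c0 rho)) <
    (eta * rho `^ (- fine (HD cantor_set)))%:E)%E.
  apply: le_lt_trans Xlt; apply: le_counting => w [w0 nX].
  by split; [exact: sub|move=> Xw; apply: nX].
have [s0 [s1 [c [[X0 _] [X1 _] Hb]]]] :=
  H rho rhoP xi xiP (X `&` words_of_size c0 rho) (@subIsetr _ _ _) Xlt'.
exists s0, s1, c; split=> // Phi t0 t1 p0 p1 e0 e1.
apply: le_trans (Hb Phi t0 t1 p0 p1 e0 e1) _.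
by apply: le_counting => b [bw bc bs]; split=> //; exact: sub.
Qed.

End RegularCantorSets.

(** * C^1 functions of two variables *)

Section PartialDerivatives.
Context {R : realType} {A A' : finType} (h : lines R A * lines R A' -> R).
Implicit Types p : lines R A * lines R A'.

Definition slice1 p (t : R) : R := h ((t, p.1.2), p.2).
Definition slice2 p (t : R) : R := h (p.1, (t, p.2.2)).

Definition partial1 p : R := derive1 (slice1 p) p.1.1.
Definition partial2 p : R := derive1 (slice2 p) p.2.1.

Definition C1_on (U : set (lines R A * lines R A')) : Prop :=
  forall p, U p ->
    [/\ derivable (slice1 p) p.1.1 1, derivable (slice2 p) p.2.1 1,
        {for p, continuous partial1} & {for p, continuous partial2}].

End PartialDerivatives.

(* Main.v *)
(** The upper bound is box counting: the slices of K and K' are covered by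
    [eps ^ (- s)] intervals of length [eps] for every [s] above the dimension, and
    [h] is Lipschitz near the compact set K x K'.

    For the lower bound fix [t < min (1, d + d')].  Either of (i), (ii) yields
    periodic points with eigenvalues [mu], [mu'] and integers [p], [q] such that
    [tau = q ln |mu'| - p ln |mu|] is positive and arbitrarily small.  Trading
    turns around one orbit for turns around the other gives, inside any cylinder
    of K, subcylinders whose lengths are in ratio [expR (j * tau)] for [j = 0, ..., J],
    with uniformly bounded distortion.  In a product of cylinders of K and K' on which
    [h] is almost affine this changes the slope of the projection [h] at will.
    Averaged over these slopes, Marstrand's argument shows that few pairs among the
    subproducts of relative size [eps] have close images; summing logarithms over
    [Q] generations, one single slope is good in all of them, and a greedy choice
    then gives about [eps ^ (- Q * t)] descendants of relative size [eps ^ Q] with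
    disjoint images.  Iterating builds a tree in h(K x K') of dimension at least
    [t].  The slope is adjusted once every [Q] generations, so that the size of
    the correcting cylinders is negligible. *)

Require Import Defs.
From mathcomp Require Import all_boot all_order all_algebra.
From mathcomp Require Import finmap all_classical all_reals all_analysis.
From mathcomp Require Import ring lra zify.

Set Implicit Arguments.
Unset Strict Implicit.
Unset Printing Implicit Defensive.

Import Order.TTheory GRing.Theory Num.Theory numFieldNormedType.Exports.

Local Open Scope classical_set_scope.
Local Open Scope ring_scope.

(** * Separated descendants in a tree *)

(** The order in which the constants are fixed is what closes the scheme. The correcting cylinders
    [u j] exist for every small [tau], but their size is not bounded below in terms of [eps], while
    [tau] must not exceed [eps]. So [eps] comes first, from the gap between [t] and
    [min (1, d + d')], then [tau] and [u], and last [Q], large enough to pay for the size of [u]. As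
    the correction precedes the [Q] generations, one slope has to serve every node of the tree,
    whereas Marstrand's average concerns one family of siblings. Logarithms add along generations,
    and concavity turns an averaged crowding into an averaged logarithm. Cylinders are loops at one
    fixed letter, so that any two compose and the same families serve at every node. Estimates bear
    on increments between two points, with multiplicative distortion: this form is stable under
    composition and asks only for a Hoelder derivative. The gradient of [h] enters once, on a
    starting box whose tolerance all sub-boxes inherit. Box counting is available because
    self-similarity makes covering numbers obey the Hausdorff dimension. *)

Section Game.
Context {R : realType}.

Lemma all_flatten_map (I T : Type) (p : pred T) (l : I -> seq T) (s : seq I) :
  all p (flatten [seq l i | i <- s]) = all (fun i => all p (l i)) s.
Proof. by elim: s => //= i s IH; rewrite all_cat IH. Qed.

Lemma greedy_separated (I : finType) (pos v : I -> R) (D : R) (A : {set I}) :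
  0 <= D -> (forall i, 0 <= v i) ->
  exists S : {set I}, [/\ S \subset A,
    {in S &, forall i j, i != j -> D < `|pos i - pos j|} &
    \sum_(i in A) v i / #|[set k in A | (`|pos i - pos k| <= 2 * D)%R]%SET|%:R
      <= \sum_(i in S) v i].
Proof.
(* Keep a point of maximal value, discard the points within [D] of it, repeat. *)
move=> D0 v0; move: {2}#|A| (leqnn #|A|) => n; elim: n A => [|n IH] A.
  rewrite leqn0 cards_eq0 => /eqP ->; exists finset.set0; split.
  - exact: finset.sub0set.
  - by move=> i j; rewrite inE.
  - by rewrite !big_set0.
move=> An; have [->|/set0Pn [i0 i0A]] := eqVneq A finset.set0.
  exists finset.set0; split; first exact: finset.sub0set.
  - by move=> i j; rewrite inE.
  - by rewrite !big_set0.
pose y := [arg max_(i > i0 in A) v i]%O.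
have [yA ymax] : y \in A /\ forall i, i \in A -> v i <= v y.
  by rewrite /y; case: arg_maxP => // i iA im; split.
pose far := [set i in A | D < `|pos i - pos y|]%SET.
have farA : far \subset A by apply/fintype.subsetP => i; rewrite inE => /andP[].
have yfar : y \notin far by rewrite inE subrr normr0 ltNge D0 andbF.
have cfar : (#|far| <= n)%N.
  rewrite -ltnS; apply: leq_trans An; apply: proper_card; rewrite properE farA.
  by apply/subsetPn; exists y.
have [S [Sfar Ssep Ssum]] := IH far cfar.
have yS : y \notin S by apply: contra yfar; apply: (fintype.subsetP Sfar).
exists (y |: S)%SET; split.
- by rewrite finset.subUset finset.sub1set yA (fintype.subset_trans Sfar).
- move=> i j; rewrite !in_setU1 => /orP[/eqP ->|iS] /orP[/eqP ->|jS].
  + by rewrite eqxx.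
  + move=> _; have := fintype.subsetP Sfar _ jS; rewrite inE => /andP[_].
    by rewrite distrC.
  + by move=> _; have := fintype.subsetP Sfar _ iS; rewrite inE => /andP[].
  + exact: Ssep.
rewrite big_setU1 //= (bigID (fun i => i \in far)) /= addrC lerD //.
  pose near := [set i in A | i \notin far]%SET.
  have nearc i : i \in near -> (#|near| <= #|[set k in A | (`|pos i - pos k| <= 2 * D)%R]%SET|)%N.
    move=> iN; apply: subset_leq_card; apply/fintype.subsetP => k kN.
    move: iN kN; rewrite !inE => /andP[iA]; rewrite iA/= -leNgt => hi.
    move=> /andP[kA]; rewrite kA/= -leNgt => hk.
    rewrite (_ : pos i - pos k = (pos i - pos y) - (pos k - pos y)); last by ring.
    by apply: le_trans (ler_normB _ _) _; lra.
  have near0 : (0 < #|near|)%N by apply/card_gt0P; exists y; rewrite inE yA yfar.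
  rewrite (eq_bigl (fun i => i \in near)); last by move=> i; rewrite [RHS]inE.
  apply: le_trans (_ : \sum_(i in near) v y / #|near|%:R <= _); last first.
    rewrite sumr_const -[_ *+ _]mulr_natr mulfVK//.
    by rewrite pnatr_eq0 -lt0n.
  apply: ler_sum => i iN; have iA : i \in A by move: iN; rewrite inE => /andP[].
  apply: ler_pM; rewrite ?invr_ge0 ?ler0n ?v0 ?ymax//.
  rewrite lef_pV2 ?posrE ?ltr0n ?ler_nat ?nearc //.
  exact: leq_trans near0 (nearc _ iN).
apply: le_trans Ssum.
rewrite (eq_bigl (fun i => i \in far)); last first.
  move=> i; case iA : (i \in A) => //=.
  by apply/esym/negbTE; apply: contraFN iA; apply: (fintype.subsetP farA).
apply: ler_sum => i iF; apply: ler_wpM2l => //.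
have i1 : i \in [set k in far | `|pos i - pos k| <= 2 * D]%SET.
  by rewrite inE iF subrr normr0 mulr_ge0.
have le : (#|[set k in far | (`|pos i - pos k| <= 2 * D)%R]%SET| <=
   #|[set k in A | (`|pos i - pos k| <= 2 * D)%R]%SET|)%N.
  apply: subset_leq_card; apply/fintype.subsetP => k; rewrite !inE.
  by move=> /andP[/andP[-> _] ->].
have c0 : (0 < #|[set k in far | (`|pos i - pos k| <= 2 * D)%R]%SET|)%N.
  by apply/card_gt0P; exists i.
by rewrite lef_pV2 ?posrE ?ltr0n ?ler_nat// (leq_trans c0).
Qed.

Definition avg (I : finType) (F : I -> R) : R := (\sum_i F i) / #|I|%:R.

Lemma avg_le (I : finType) (F G : I -> R) :
  (forall i, F i <= G i) -> avg F <= avg G.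
Proof.
by move=> FG; rewrite /avg ler_wpM2r ?invr_ge0 ?ler0n//; apply: ler_sum.
Qed.

Lemma avg_cst (I : finType) (c : R) : (0 < #|I|)%N -> avg (fun _ : I => c) = c.
Proof.
move=> I0; rewrite /avg big_const iter_addr addr0 -[_ *+ _]mulr_natr mulfK//.
by rewrite pnatr_eq0 -lt0n.
Qed.

Lemma avgD (I : finType) (F G : I -> R) :
  avg (fun i => F i + G i) = avg F + avg G.
Proof. by rewrite /avg big_split/= mulrDl. Qed.

Lemma avgZ (I : finType) (F : I -> R) (c : R) :
  avg (fun i => c * F i) = c * avg F.
Proof. by rewrite /avg -mulr_sumr mulrA. Qed.

Lemma exchange_avg (I J : finType) (F : I -> J -> R) :
  avg (fun i => avg (F i)) = avg (fun j => avg (F ^~ j)).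
Proof.
rewrite /avg -!mulr_suml exchange_big/= -!mulrA; congr (_ * _).
by rewrite mulrC.
Qed.

(** Jensen's inequality, from the tangent line of [expR] at the mean. *)
Lemma avg_expR (I : finType) (F : I -> R) :
  (0 < #|I|)%N -> expR (avg F) <= avg (fun i => expR (F i)).
Proof.
move=> I0; set m := avg F.
apply: le_trans (_ : avg (fun i => expR m * (1 + (F i - m))) <= _).
  rewrite avgZ avgD avg_cst// avgD -/m avg_cst// subrr addr0 mulr1 //.
apply: avg_le => i; rewrite -[in leRHS](subrKC m (F i)) expRD.
by rewrite ler_pM2l ?expR_gt0// expR_ge1Dx.
Qed.

(** Jensen's inequality again, from the tangent line of [ln] at [B]. *)
Lemma avg_ln_le (I : finType) (q : I -> R) (B : R) : (0 < #|I|)%N ->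
  0 < B -> (forall i, 0 < q i) -> avg q <= B -> avg (fun i => ln (q i)) <= ln B.
Proof.
move=> I0 B0 q0 qB.
apply: le_trans (_ : avg (fun i => (ln B - 1) + B^-1 * q i) <= _).
  apply: avg_le => i; have qB0 : 0 < q i / B by rewrite divr_gt0.
  have := le_ln1Dx (_ : -1 < q i / B - 1); rewrite ltrBrDl subrr => /(_ qB0).
  rewrite subrKC ln_div ?posrE// => h; rewrite [_^-1 * _]mulrC; lra.
rewrite avgD avgZ avg_cst//; have : B^-1 * avg q <= 1 by rewrite mulrC ler_pdivrMr// mul1r.
by move=> h; lra.
Qed.

Section Tree.
Variables (T : Type) (ix : T -> finType) (child : forall x, ix x -> T).
Variables (pos D : T -> R).

(** A proportion rather than a number, so that the number of children disappears from the estimates.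
    The radius is [2 * D x] because the greedy choice discards points within [D x] of the kept one,
    hence within [2 * D x] of each other. *)
Definition crowd (x : T) (i : ix x) : R :=
  avg (fun k : ix x => (`|pos (child i) - pos (child k)| <= 2 * D x)%R%:R).

(* A lower bound for the logarithm of the number of pairwise separated
   descendants that greedy choices produce; unlike this number itself, it can be
   averaged over [pos]. *)
Fixpoint game_value (n : nat) (x : T) : R :=
  if n is m.+1 then avg (fun i => game_value m (@child x i) - ln (crowd i)) else 0.

Fixpoint reach (n : nat) (x z : T) : Prop :=
  if n is m.+1 then exists i, reach m (@child x i) z else z = x.

Lemma crowdE x (i : ix x) : crowd i =
  #|[set k in [set: ix x]%SET | `|pos (child i) - pos (child k)| <= 2 * D x]%SET|%:R / #|ix x|%:R.
Proof.
rewrite /crowd /avg; congr (_ / _); rewrite -natr_sum; congr (_%:R).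
rewrite -sum1_card [RHS]big_mkcond/=; apply: eq_bigr => k _.
by rewrite !inE; case: (_ <= _).
Qed.

Lemma crowd_gt0 x (i : ix x) : 0 <= D x -> 0 < crowd i.
Proof.
move=> D0; rewrite crowdE divr_gt0// ltr0n.
  by apply/card_gt0P; exists i; rewrite !inE subrr normr0 mulr_ge0.
by apply/card_gt0P; exists i.
Qed.

(** By Jensen, [expR] of the average is at most the average of [expR]; there [expR (- ln (crowd i))]
    is the number of children divided by the number of crowding siblings, which is the weight that
    the greedy choice guarantees. The lists of the chosen children are concatenated. [P] carries the
    invariants of a node with [n] generations to come; a gap between two children must survive in
    all their descendants. *)
Lemma game_value_separated (P : nat -> T -> Prop) (Sep : T -> T -> Prop) :
  (forall n x i, P n.+1 x -> P n (@child x i)) ->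
  (forall n x, P n x -> (0 < #|ix x|)%N /\ 0 <= D x) ->
  (forall n x (i k : ix x) zi zk, P n.+1 x ->
     D x < `|pos (child i) - pos (child k)| ->
     reach n (child i) zi -> reach n (child k) zk -> Sep zi zk) ->
  forall n x, P n x -> exists l : seq T, [/\ expR (game_value n x) <= (size l)%:R,
    all (fun z => `[< reach n x z >]) l & pairwise (fun z z' => `[< Sep z z' >]) l].
Proof.
move=> Pchild Pix PSep; elim=> [|n IH] x Px.
  by exists [:: x]; split; rewrite /= ?expR0// andbT; apply/asboolP.
have [I0 D0] := Pix _ _ Px.
have /choice [l lP] (i : ix x) := IH _ (Pchild _ _ i Px).
have v0 (i : ix x) : 0 <= expR (game_value n (child i)) by exact: expR_ge0.
have [S [_ Ssep Ssum]] :=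
  greedy_separated (fun i => pos (child i)) [set: ix x]%SET D0 v0.
exists (flatten [seq l i | i <- enum S]); split.
- apply: le_trans (avg_expR _ I0) _; rewrite size_flatten /shape -map_comp.
  rewrite sumnE big_map big_enum/= natr_sum.
  apply: le_trans (_ : \sum_(i in S) expR (game_value n (child i)) <= _); last first.
    by apply: ler_sum => i _; have [] := lP i.
  apply: le_trans Ssum; rewrite /avg mulr_suml [leRHS]big_mkcond/=.
  apply: ler_sum => i _; rewrite finset.in_setT expRD expRN.
  rewrite lnK ?posrE ?crowd_gt0// crowdE invf_div.
  by rewrite mulrA mulrAC mulfK// pnatr_eq0 -lt0n.
- rewrite all_flatten_map; apply/allP => i iS /=.
  have [_ li _] := lP i; apply: sub_all li => z /asboolP rz /=.
  by apply/asboolP; exists i.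
- have : uniq (enum S) by exact: enum_uniq.
  have : {subset enum S <= S} by move=> i; rewrite mem_enum.
  elim: (enum S) => //= i s IHs sub /andP[iS us].
  rewrite pairwise_cat; apply/and3P; split.
  + have [_ li _] := lP i; apply: sub_all li => z /asboolP rz /=.
    rewrite all_flatten_map; apply/allP => k ks /=.
    have [_ lk _] := lP k; apply: sub_all lk => z' /asboolP rz'; apply/asboolP.
    apply: (PSep n x i k) => //; apply: Ssep.
    * by apply: sub; rewrite mem_head.
    * by apply: sub; rewrite inE ks orbT.
    * by apply: contraNneq iS => ->.
  + by have [] := lP i.
  + by apply: IHs => // k ks; apply: sub; rewrite inE ks orbT.
Qed.

End Tree.
End Game.

(** * Averages over slopes and pigeonhole counts *)

Section Counting.
Context {R : realType}.

(** Only [pos] depends on the slope [j], not the tree itself, so averages over slopes and over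
    children can be exchanged. Each generation then costs at most [ln B], by concavity of [ln]. *)
Lemma game_value_avg (J : finType) (T : Type) (ix : T -> finType)
    (child : forall x, ix x -> T) (pos : J -> T -> R) (D : T -> R)
    (P : nat -> T -> Prop) (B : R) :
  (0 < #|J|)%N -> 0 < B ->
  (forall n x i, P n.+1 x -> P n (@child x i)) ->
  (forall n x, P n x -> (0 < #|ix x|)%N /\ 0 <= D x) ->
  (forall n x i, P n.+1 x -> avg (fun j => crowd child (pos j) D (x := x) i) <= B) ->
  forall n x, P n x ->
    - (n%:R * ln B) <= avg (fun j => game_value child (pos j) D n x).
Proof.
move=> J0 B0 Pchild Pix PB; elim=> [|n IH] x Px.
  by rewrite mul0r oppr0 /= avg_cst.
have [I0 D0] := Pix _ _ Px.
rewrite /= exchange_avg -[leLHS](avg_cst _ I0); apply: avg_le => i.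
have -> : (fun j => game_value child (pos j) D n (child x i) - ln (crowd child (pos j) D i)) =
    (fun j => game_value child (pos j) D n (child x i) + (-1) * ln (crowd child (pos j) D i)).
  by apply/funext => j; rewrite mulN1r.
rewrite avgD avgZ mulN1r -natr1 mulrDl mul1r opprD lerD//.
  by apply: IH; apply: Pchild.
rewrite lerN2; apply: avg_ln_le => //; last exact: PB Px.
by move=> j; apply: crowd_gt0.
Qed.

(** Pigeonhole: two points in the same cell of length [sep] would be too close. *)
Lemma separated_count (T : eqType) (s : seq T) (pos : T -> R) (lo len sep : R) :
  0 < sep -> uniq s -> (forall x, x \in s -> lo <= pos x <= lo + len) ->
  {in s &, forall x y, x != y -> sep <= `|pos x - pos y|} ->
  0 <= len -> (size s)%:R <= len / sep + 1.
Proof.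
move=> sep0 us range sepP len0.
pose f x := Num.truncn ((pos x - lo) / sep).
have pos0 x : x \in s -> 0 <= (pos x - lo) / sep.
  by move=> /range/andP[h _]; rewrite divr_ge0 ?subr_ge0// ltW.
have finj : {in s &, injective f}.
  move=> x y xs ys fxy; apply/eqP; apply: contraT => /(sepP _ _ xs ys).
  have := truncn_itv (pos0 _ xs); have := truncn_itv (pos0 _ ys).
  rewrite -/(f x) -/(f y) fxy !ler_pdivlMr// !ltr_pdivrMr// -natr1.
  move=> /andP[h1 h2] /andP[h3 h4].
  rewrite leNgt => /negP; case; rewrite ltr_norml; apply/andP; split; lra.
have sub : {subset map f s <= iota 0 (Num.truncn (len / sep)).+1}.
  move=> _ /mapP [x xs ->]; rewrite mem_iota add0n ltnS /=.
  apply: le_truncn; rewrite ler_pM2r ?invr_gt0//.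
  by have /andP[_] := range _ xs; rewrite -lerBlDl.
have := uniq_leq_size _ sub; rewrite map_inj_in_uniq// us size_map size_iota.
move=> /(_ isT) h; apply: le_trans (_ : (Num.truncn (len / sep)).+1%:R <= _).
  by rewrite ler_nat.
by rewrite -natr1 lerD2r truncn_le// divr_ge0// ltW.
Qed.

Lemma avg_nat (I : finType) (p : pred I) :
  avg (fun i => (p i)%:R : R) = #|[set i | p i]%SET|%:R / #|I|%:R.
Proof.
rewrite /avg -natr_sum; congr (_%:R / _).
by rewrite -sum1_card [RHS]big_mkcond/=; apply: eq_bigr => k _; rewrite inE; case: (p k).
Qed.

Lemma expR_sep (tau : R) (i j : nat) : 0 < tau -> i != j ->
  tau <= `|expR (i%:R * tau) - expR (j%:R * tau)|.
Proof.
move=> t0; wlog ij : i j / (i < j)%N.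
  move=> H; rewrite neq_ltn => /orP[h|h]; first by apply: H => //; rewrite neq_ltn h.
  by rewrite distrC; apply: H => //; rewrite neq_ltn h.
move=> _; rewrite distrC ger0_norm ?subr_ge0 ?ler_expR; last first.
  by rewrite ler_pM2r// ler_nat ltnW.
have -> : j%:R * tau = i%:R * tau + (j - i)%:R * tau.
  by rewrite -mulrDl -natrD subnKC// ltnW.
rewrite expRD; have h1 : 1 <= expR (i%:R * tau).
  by rewrite -[leLHS]expR0 ler_expR mulr_ge0// ltW.
have h2 : tau <= (j - i)%:R * tau by rewrite ler_peMl ?(ltW t0)// ler1n subn_gt0.
have h3 := expR_ge1Dx ((j - i)%:R * tau); nra.
Qed.

(* The values [a * expR (j * tau)] are separated by [`|a| * tau], so few of
   them fall in a window of length [2 * D]. *)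
Lemma avg_window (J : nat) (tau a b D : R) : 0 < tau -> (0 < J)%N ->
  1 <= J%:R * tau -> a != 0 -> 0 <= D ->
  avg (fun j : 'I_J => (`|a * expR (j%:R * tau) + b| <= D)%R%:R)
    <= tau + 2 * D / `|a|.
Proof.
move=> t0 J0 Jt a0 D0; rewrite avg_nat card_ord cardE.
have na : 0 < `|a| by rewrite normr_gt0.
have h := separated_count (s := enum [set j : 'I_J | (`|a * expR (j%:R * tau) + b| <= D)%R]%SET)
   (pos := fun j : 'I_J => a * expR (j%:R * tau)) (lo := - b - D) (len := 2 * D)
   (sep := `|a| * tau).
have {}h := h (mulr_gt0 na t0) (enum_uniq _) _ _ (mulr_ge0 (ler0n _ 2) D0).
rewrite ler_pdivrMr ?ltr0n//; apply: le_trans (h _ _) _.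
- move=> j; rewrite mem_enum inE ler_norml => /andP[h1 h2]; apply/andP; split; lra.
- move=> i j _ _ ij; rewrite -mulrBr normrM ler_pM2l//.
  by apply: expR_sep.
rewrite [leRHS]mulrDl [leLHS]addrC lerD//; first by rewrite mulrC.
rewrite invfM mulrA ler_wpM2l ?divr_ge0 ?mulr_ge0//.
by rewrite -[leLHS]mul1r ler_pdivrMr.
Qed.

Lemma avg_ge0 (I : finType) (F : I -> R) : (forall i, 0 <= F i) -> 0 <= avg F.
Proof. by move=> F0; rewrite /avg divr_ge0//; apply: sumr_ge0. Qed.

Lemma avg_sum (I K : finType) (F : K -> I -> R) :
  avg (fun i => \sum_k F k i) = \sum_k avg (F k).
Proof. by rewrite /avg exchange_big/= mulr_suml. Qed.

(* Each value of [m] is located on the grid [eps `^ (1 - l / k)]; the grid has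
   a bounded number of points, at the price of a factor [eps `^ (- 1 / k)]. *)
Lemma avg_layers (I : finType) (phi m : I -> R) (C3 B eps sig mu : R) (k : nat) :
  (0 < k)%N -> 0 < eps < 1 -> 0 <= C3 -> 0 <= B -> mu <= 1 -> mu <= sig ->
  (forall i, 0 <= phi i <= C3) -> (forall i, phi i * m i <= C3 * eps) ->
  (forall i, m i <= 1) ->
  (forall t, eps <= t <= 1 -> avg (fun i => (m i <= t)%R%:R) <= B * t `^ sig) ->
  avg phi <= k.+1%:R * (C3 * B * eps `^ (mu - k%:R^-1)).
Proof.
move=> k0 /andP[e0 e1] C30 B0 mu1 musig phi1 phi2 m1 cnt.
have k0' : 0 < k%:R :> R by rewrite ltr0n.
pose t (l : 'I_k.+1) : R := eps `^ (1 - l%:R / k%:R).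
have lk (l : 'I_k.+1) : 0 <= (l%:R / k%:R : R) <= 1.
  by rewrite divr_ge0//= ler_pdivrMr// mul1r ler_nat -ltnS.
have e01 : 0 < eps <= 1 by rewrite e0 ltW.
have tb l : eps <= t l <= 1.
  have /andP[l0 l1] := lk l; apply/andP; split.
    by rewrite -[leLHS]powRr1 ?(ltW e0)// ger_powR//; lra.
  by rewrite -[leRHS](powRr0 eps) ger_powR//; lra.
apply: le_trans (_ : avg (fun i => \sum_(l < k.+1)
   (C3 * eps `^ ((l%:R - 1) / k%:R)) * (m i <= t l)%R%:R) <= _).
  apply: avg_le => i.
  have term0 (l : 'I_k.+1) : 0 <= (C3 * eps `^ ((l%:R - 1) / k%:R)) * (m i <= t l)%R%:R.
    by rewrite !mulr_ge0 ?powR_ge0.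
  suff [l hl] : exists l : 'I_k.+1, phi i <= (C3 * eps `^ ((l%:R - 1) / k%:R)) * (m i <= t l)%R%:R.
    by rewrite (bigD1 l)//=; apply: le_trans hl _; rewrite lerDl sumr_ge0.
  have ex : exists l : nat, (l < k.+1)%N && (m i <= eps `^ (1 - l%:R / k%:R)).
    by exists k; rewrite ltnSn divff ?lt0r_neq0// subrr powRr0 m1.
  case: (ex_minnP ex) => l /andP[lk1 ml] lmin; exists (Ordinal lk1) => /=.
  (* In layer [0] the bound [phi i <= C3] suffices, the coefficient being at least [C3]. In a later
     layer, minimality puts [m i] above the preceding grid value, and [phi i * m i <= C3 * eps]
     bounds [phi i]. *)
  rewrite /t /= ml mulr1; case: l lk1 ml lmin => [|l] lk1 ml lmin.
    have /andP[_ h] := phi1 i; apply: le_trans h _.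
    rewrite ler_peMr// -[leLHS](powRr0 eps).
    by rewrite ger_powR// sub0r mulNr mul1r oppr_le0 invr_ge0.
  have lt : eps `^ (1 - l%:R / k%:R) < m i.
    rewrite ltNge; apply/negP => h.
    have := lmin l; rewrite h (ltn_trans (ltnSn l) lk1)/= => /(_ isT).
    by rewrite ltnn.
  have -> : (l.+1%:R - 1) / k%:R = 1 - (1 - l%:R / k%:R) :> R.
    by rewrite -natr1; ring.
  rewrite powRB; last by apply/implyP => _; rewrite gt_eqF.
  rewrite powRr1 ?(ltW e0)//.
  have p0 : 0 < eps `^ (1 - l%:R / k%:R) by rewrite powR_gt0.
  rewrite mulrA ler_pdivlMr//; apply: le_trans (phi2 i).
  by apply: ler_wpM2l (ltW lt); have /andP[] := phi1 i.
rewrite avg_sum.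
apply: le_trans (_ : \sum_(l < k.+1) C3 * B * eps `^ (mu - k%:R^-1) <= _); last first.
  by rewrite sumr_const card_ord mulr_natl.
apply: ler_sum => l _; rewrite avgZ.
have /andP[l0 l1] := lk l.
apply: le_trans (_ : C3 * eps `^ ((l%:R - 1) / k%:R) * (B * t l `^ sig) <= _).
  by apply: ler_wpM2l (cnt _ (tb l)); rewrite mulr_ge0 ?powR_ge0.
rewrite -powRrM mulrACA -powRD; last by apply/implyP => _; rewrite gt_eqF.
rewrite ler_wpM2l ?mulr_ge0// ger_powR//.
have -> : (l%:R - 1) / k%:R = l%:R / k%:R - k%:R^-1 :> R by rewrite mulrBl mul1r.
(* Up to the common term [- 1 / k], the exponent is a convex combination of [sig] and [1], both at
   least [mu]. *)
set u := l%:R / k%:R in l0 l1 *; nra.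
Qed.
End Counting.

(** * Projections of products of quasi-affine systems *)

Section Systems.
Context {R : realType}.
Implicit Types (f g w : R -> R) (F : (R -> R) -> Prop).

Definition sz f : R := `|f 1 - f 0|.

(** [K] bounds the distortion. The last bound, free of [K], reflects monotonicity: the oscillation
    on a cylinder is its length. *)
Definition quasi_affine (K : R) f : Prop :=
  [/\ 0 < sz f, forall x, 0 <= x <= 1 -> 0 <= f x <= 1 &
    forall x y, 0 <= x <= 1 -> 0 <= y <= 1 ->
      [/\ K^-1 * sz f * `|x - y| <= `|f x - f y|,
          `|f x - f y| <= K * sz f * `|x - y| & `|f x - f y| <= sz f]].

Definition quasi_affine_monoid (K : R) F : Prop :=
  [/\ F id, forall f g, F f -> F g -> F (f \o g) &
      forall f, F f -> quasi_affine K f].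

(* A Frostman condition of exponent [d], at scales at least [eps], for finitely
   many maps of comparable sizes. *)
Definition has_families F (o d c1 : R) : Prop :=
  forall eta, 0 < eta -> exists2 eps0, 0 < eps0 & forall eps, 0 < eps < eps0 ->
    exists (N : nat) (e : 'I_N -> R -> R), [/\ (0 < N)%N,
      forall i, F (e i) /\ c1 * eps <= sz (e i) <= eps &
      forall i t, eps <= t <= 1 ->
        avg (fun k => (`|e k o - e i o| <= t)%R%:R) <= eps `^ (- eta) * t `^ d].

(* The composites with [u j] are magnified by [expR (j * tau)], up to an error
   that does not accumulate with [j]: varying [j] rotates the slope at which [H]
   projects a product of two cylinders. *)
Definition has_shifts F : Prop :=
  forall delta, 0 < delta -> exists2 tau, 0 < tau < delta &
    forall J : nat, exists u : nat -> R -> R,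
      [/\ forall j, F (u j), sz (u 0%N) <= delta &
        forall w j, F w -> (j <= J)%N -> forall x y, 0 <= x <= 1 -> 0 <= y <= 1 ->
          exists2 theta, `|theta| <= delta &
            w (u j x) - w (u j y) =
              expR (j%:R * tau + theta) * (w (u 0%N x) - w (u 0%N y))].

(** Strict differentiability with a relative error; being about increments, it passes to sub-boxes
    with the same [eta]. *)
Definition linear_box (H : R -> R -> R) (g1 g2 eta : R) w w' : Prop :=
  forall x1 x2 y1 y2, 0 <= x1 <= 1 -> 0 <= x2 <= 1 -> 0 <= y1 <= 1 -> 0 <= y2 <= 1 ->
    `|H (w x1) (w' y1) - H (w x2) (w' y2)
      - (g1 * (w x1 - w x2) + g2 * (w' y1 - w' y2))|
    <= eta * (`|w x1 - w x2| + `|w' y1 - w' y2|).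

Lemma unit0 : 0 <= (0 : R) <= 1. Proof. by rewrite ?lexx ?ler01. Qed.
Lemma unit1 : 0 <= (1 : R) <= 1. Proof. by rewrite ?lexx ?ler01. Qed.

Section Monoid.
Variables (K : R) (F : (R -> R) -> Prop).
Hypotheses (K1 : 1 <= K) (FM : quasi_affine_monoid K F).

Let K0 : 0 < K. Proof. exact: lt_le_trans K1. Qed.

Lemma sz_gt0 f : F f -> 0 < sz f.
Proof. by case: FM => _ _ h /h[]. Qed.

Lemma in_unit f x : F f -> 0 <= x <= 1 -> 0 <= f x <= 1.
Proof. by case: FM => _ _ h /h[_ + _]; apply. Qed.

Lemma monoid_comp f g : F f -> F g -> F (f \o g).
Proof. by case: FM => _ h _; apply: h. Qed.

Lemma dist_ge f x y : F f -> 0 <= x <= 1 -> 0 <= y <= 1 ->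
  K^-1 * sz f * `|x - y| <= `|f x - f y|.
Proof. by case: FM => _ _ h /h[_ _ +] x1 y1 => /(_ _ _ x1 y1)[]. Qed.

Lemma dist_le f x y : F f -> 0 <= x <= 1 -> 0 <= y <= 1 ->
  `|f x - f y| <= K * sz f * `|x - y|.
Proof. by case: FM => _ _ h /h[_ _ +] x1 y1 => /(_ _ _ x1 y1)[]. Qed.

Lemma dist_sz f x y : F f -> 0 <= x <= 1 -> 0 <= y <= 1 ->
  `|f x - f y| <= sz f.
Proof. by case: FM => _ _ h /h[_ _ +] x1 y1 => /(_ _ _ x1 y1)[]. Qed.

Lemma sz_comp_le f g : F f -> F g -> sz (f \o g) <= K * sz f * sz g.
Proof.
by move=> Ff Fg; apply: (@dist_le f (g 1) (g 0)) => //; apply: in_unit; rewrite ?unit0 ?unit1.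
Qed.

Lemma sz_comp_ge f g : F f -> F g -> K^-1 * sz f * sz g <= sz (f \o g).
Proof.
by move=> Ff Fg; apply: (@dist_ge f (g 1) (g 0)) => //; apply: in_unit; rewrite ?unit0 ?unit1.
Qed.

Lemma shrink_into w v (X R1 : R) : F w -> F v -> K * sz v <= 2^-1 ->
  0 < X -> 1 <= R1 -> K <= R1 * sz v -> X <= R1 * sz w ->
  exists p, [/\ F p, X <= R1 * sz (w \o p) & sz (w \o p) <= R1 * X].
Proof.
move=> Fw Fv v2 X0 R11 R1v Xw.
pose vn n : R -> R := iter n (fun p => p \o v) id.
have Fvn n : F (vn n).
  by elim: n => [|n IH] /=; [case: FM | apply: monoid_comp].
have vnS n : w \o vn n.+1 = (w \o vn n) \o v by [].
have szS n : sz (w \o vn n.+1) <= 2^-1 * sz (w \o vn n).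
  rewrite vnS; apply: le_trans (sz_comp_le (monoid_comp Fw (Fvn n)) Fv) _.
  rewrite mulrAC; apply: ler_wpM2r => //; exact: ltW (sz_gt0 (monoid_comp Fw (Fvn n))).
have szn n : sz (w \o vn n) <= 2^-1 ^+ n * sz w.
  elim: n => [|n IH]; first by rewrite expr0 mul1r.
  apply: le_trans (szS n) _; rewrite exprS -mulrA ler_pM2l//.
have ex : exists n, (sz (w \o vn n) <= R1 * X).
  have w0 := sz_gt0 Fw.
  pose n := Num.bound (sz w / X); exists n; apply: le_trans (szn n) _.
  apply: le_trans (_ : 1 * X <= _); last by rewrite ler_pM2r.
  rewrite exprVn -ler_pdivlMl ?invr_gt0 ?exprn_gt0// invrK mul1r -ler_pdivrMr//.
  apply: le_trans (_ : n%:R <= _).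
    by apply: ltW; apply: le_lt_trans (archi_boundP _); rewrite ?ler_norm// divr_ge0 ?ltW.
  by rewrite -natrX ler_nat ltnW// ltn_expl.
case: (ex_minnP ex) => n hn nmin; exists (vn n); split=> //.
case: n hn nmin => [|n] hn nmin; first exact: Xw.
have : R1 * X < sz (w \o vn n).
  by rewrite ltNge; apply/negP => /nmin; rewrite ltnn.
move=> h; have := sz_comp_ge (monoid_comp Fw (Fvn n)) Fv; rewrite -vnS => h2.
have h3 : K^-1 * (R1 * X) * sz v <= sz (w \o vn n.+1).
  apply: le_trans h2; apply: ler_wpM2r; first exact: ltW (sz_gt0 Fv).
  by apply: ler_wpM2l (ltW h); rewrite invr_ge0 ltW.
have h4 : X <= K^-1 * (R1 * X) * sz v.
  have -> : K^-1 * (R1 * X) * sz v = (K^-1 * (R1 * sz v)) * X by ring.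
  by rewrite ler_peMl ?(ltW X0)// -ler_pdivrMl ?invr_gt0// invrK mulr1.
apply: le_trans h4 (le_trans h3 _).
by rewrite ler_peMl// /sz normr_ge0.
Qed.

End Monoid.

Lemma avg_prod (I J : finType) (G : I -> R) (L : J -> R) :
  avg (fun p : I * J => G p.1 * L p.2) = avg G * avg L.
Proof.
rewrite /avg card_prod natrM invfM mulrACA; congr (_ * _).
rewrite mulr_suml -(pair_bigA _ (fun i j => G i * L j))/=.
by apply: eq_bigr => i _; rewrite mulr_sumr.
Qed.

Lemma avg_ge_ex (I : finType) (G : I -> R) (c : R) : (0 < #|I|)%N ->
  c <= avg G -> exists i, c <= G i.
Proof.
move=> I0 h; apply: contrapT => /forallNP nG.
suff : avg G < avg (fun _ : I => c) by rewrite (avg_cst c I0) ltNge h.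
rewrite /avg ltr_pM2r ?invr_gt0 ?ltr0n//; apply: ltr_sum.
  by apply/hasP; have /card_gt0P[i _] := I0; exists i => //; rewrite mem_index_enum.
by move=> i _; rewrite ltNge; apply/negP/nG.
Qed.

Lemma expR_near1 (x e : R) : `|x| <= e -> e <= 2^-1 -> `|expR x - 1| <= 2 * e.
Proof.
move=> xe e2; have [h1 h2] : - e <= x /\ x <= e by apply/andP; rewrite -ler_norml.
have a := expR_ge1Dx x; have b := expR_ge1Dx (- x).
have c := expR_gt0 x; have := expRxMexpNx_1 x; rewrite ler_norml => d.
apply/andP; split; nra.
Qed.

End Systems.

Lemma le_of_eq (R : realType) (x y : R) : x = y -> x <= y.
Proof. by move=> ->. Qed.

(** * Marstrand's estimate for siblings in a product of two families *)

Section MarstrandStep.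
Context {R : realType}.
Variables (K R1 g1 g2 d d' o o' eps tau : R) (F F' : (R -> R) -> Prop).
Variables (H : R -> R -> R) (J : nat) (u : nat -> R -> R) (w w2 : R -> R).
Hypotheses (K1 : 1 <= K) (R11 : 1 <= R1)
  (FM : quasi_affine_monoid K F) (FM' : quasi_affine_monoid K F')
  (g10 : g1 != 0) (g20 : g2 != 0) (ho : 0 <= o <= 1) (ho' : 0 <= o' <= 1)
  (eps0 : 0 < eps) (eps2 : eps <= 2^-1).
Hypotheses (tau0 : 0 < tau) (taueps : tau <= eps) (J0 : (0 < J)%N)
  (Jtau1 : 1 <= J%:R * tau) (Jtau2 : J%:R * tau <= 2)
  (Fu : forall j, F (u j)) (Fw : F w) (Fw2 : F' w2)
  (ushift : forall j, (j < J)%N -> forall x y, 0 <= x <= 1 -> 0 <= y <= 1 ->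
    exists2 theta, `|theta| <= eps &
      w (u j x) - w (u j y) =
        expR (j%:R * tau + theta) * (w (u 0%N x) - w (u 0%N y)))
  (Hlin : linear_box H g1 g2 eps w w2).

(** Bounds the magnifications [expR (j * tau + theta)] and their inverses, since [j * tau <= 2] and
    [|theta| <= eps <= 1 / 2]. *)
Definition drift_const : R := expR 3.

(** In order: the assumed closeness, the error of [linear_box] on each of the two factors, and the
    effect of the unknown [theta], estimated by [expR_near1]. *)
Definition window_const (Dc : R) : R :=
  Dc + drift_const + R1 + 2 * drift_const * `|g1|.

Definition ratio_const (Dc : R) : R :=
  K + K * R1 * ((window_const Dc + `|g1| * drift_const) / `|g2|).

Definition marstrand_const (Dc : R) : R :=
  (1 + 2 * window_const Dc / `|g1|) * ratio_const Dc + 1.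

Let E1 : 1 <= drift_const.
Proof. by rewrite /drift_const -[leLHS]expR0 ler_expR. Qed.

Lemma shift_le j theta : (j < J)%N -> `|theta| <= eps ->
  [/\ expR (j%:R * tau + theta) <= drift_const,
      expR (j%:R * tau) <= drift_const & drift_const^-1 <= expR (j%:R * tau + theta)].
Proof.
move=> jJ; rewrite ler_norml => /andP[h1 h2].
have h3 : j%:R * tau <= J%:R * tau by rewrite ler_pM2r// ler_nat ltnW.
have h4 : 0 <= j%:R * tau by rewrite mulr_ge0// ltW.
have h5 := le_trans h3 Jtau2; have h6 := eps2.
rewrite /drift_const -expRN !ler_expR; set a := j%:R * tau in h4 h5 *.
by split; lra.
Qed.

Section Siblings.
Variables (b b' : R -> R) (Fb : F b) (Fb' : F' b') (N N' : nat)
  (e : 'I_N -> R -> R) (e' : 'I_N' -> R -> R).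
Hypotheses (Fe : forall i, F (e i)) (Fe' : forall i, F' (e' i)).

Let X := sz (w \o u 0%N \o b).
Let Y := sz (w2 \o b').

Hypotheses (XY : X <= R1 * Y) (YX : Y <= R1 * X).

Definition sibling_pos (j : 'I_J) (i : 'I_N * 'I_N') : R :=
  H (w (u j (b (e i.1 o)))) (w2 (b' (e' i.2 o'))).

Let X0 : 0 < X.
Proof. exact: (sz_gt0 FM (monoid_comp FM (monoid_comp FM Fw (Fu 0%N)) Fb)). Qed.

Let A (i k : 'I_N * 'I_N') := w (u 0%N (b (e i.1 o))) - w (u 0%N (b (e k.1 o))).
Let B (i k : 'I_N * 'I_N') := w2 (b' (e' i.2 o')) - w2 (b' (e' k.2 o')).

Let Fwub : F (w \o u 0%N \o b).
Proof. exact: (monoid_comp FM (monoid_comp FM Fw (Fu 0%N)) Fb). Qed.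
Let Fwb' : F' (w2 \o b').
Proof. exact: (monoid_comp FM' Fw2 Fb'). Qed.

Let AX i k : `|A i k| <= X.
Proof. by apply: (dist_sz FM Fwub); apply: (in_unit FM (Fe _)). Qed.

Let BX i k : `|B i k| <= R1 * X.
Proof.
by apply: le_trans YX; apply: (dist_sz FM' Fwb'); apply: (in_unit FM' (Fe' _)).
Qed.

Let Ae i k : `|e k.1 o - e i.1 o| <= K * `|A i k| / X.
Proof.
rewrite ler_pdivlMr// distrC -ler_pdivrMl ?(lt_le_trans _ K1)//.
rewrite mulrA mulrAC.
by apply: (dist_ge FM Fwub); apply: (in_unit FM (Fe _)).
Qed.

Let Be i k : `|e' k.2 o' - e' i.2 o'| <= K * R1 * `|B i k| / X.
Proof.
have Kp : 0 < K by exact: lt_le_trans K1.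
have h := dist_ge FM' Fwb' (in_unit FM' (Fe' i.2) ho') (in_unit FM' (Fe' k.2) ho').
rewrite ler_pdivlMr// distrC; set z := `|_ - _| in h *.
have z0 : 0 <= z by exact: normr_ge0.
have {}h : Y * z <= K * `|B i k|.
  by rewrite -ler_pdivrMl// mulrA.
apply: le_trans (_ : z * (R1 * Y) <= _); first by rewrite ler_wpM2l.
have -> : z * (R1 * Y) = R1 * (Y * z) by ring.
have -> : K * R1 * `|B i k| = R1 * (K * `|B i k|) by ring.
by rewrite ler_pM2l// (lt_le_trans _ R11).
Qed.

Lemma close_siblings (Dc : R) j i k : 0 <= Dc ->
  `|sibling_pos j i - sibling_pos j k| <= Dc * eps * X ->
  `|(g1 * A i k) * expR (j%:R * tau) + g2 * B i k| <= window_const Dc * (eps * X).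
Proof.
move=> Dc0; have jJ := ltn_ord j.
have i1 (l : 'I_N * 'I_N') : 0 <= e l.1 o <= 1 by apply: (in_unit FM (Fe _)).
have i2 (l : 'I_N * 'I_N') : 0 <= e' l.2 o' <= 1 by apply: (in_unit FM' (Fe' _)).
have b1 (l : 'I_N * 'I_N') : 0 <= b (e l.1 o) <= 1 by apply: (in_unit FM Fb (i1 l)).
have b2 (l : 'I_N * 'I_N') : 0 <= b' (e' l.2 o') <= 1 by apply: (in_unit FM' Fb' (i2 l)).
have u1 (l : 'I_N * 'I_N') : 0 <= u j (b (e l.1 o)) <= 1 by apply: (in_unit FM (Fu j) (b1 l)).
have [theta th eqs] := ushift jJ (b1 i) (b1 k).
have [s1 s2 s3] := shift_le jJ th.
have lin := Hlin (u1 i) (u1 k) (b2 i) (b2 k).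
rewrite -/(B i k) eqs -/(A i k) in lin.
rewrite -/(sibling_pos j i) -/(sibling_pos j k) in lin.
have t1 := expR_near1 th eps2; have eA := AX i k; have eB := BX i k.
set T := expR (j%:R * tau) in s2 *.
set S := sibling_pos j i - sibling_pos j k in lin *.
rewrite expRD -/T in lin s1 s3.
set t := expR theta in t1 lin s1 s3.
have T0 : 0 < T by exact: expR_gt0. have t0 : 0 < t by exact: expR_gt0.
have tA : `|T * t * A i k| <= drift_const * X.
  by rewrite normrM (gtr0_norm (mulr_gt0 T0 t0)) ler_pM// mulr_ge0// ltW.
have tA' : `|g1 * (T * (t - 1) * A i k)| <= `|g1| * (drift_const * (2 * eps) * X).
  rewrite normrM ler_wpM2l// normrM ler_pM// normrM (gtr0_norm T0).
  by rewrite ler_pM// ltW.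
move=> hS.
have -> : g1 * A i k * T + g2 * B i k =
   S - (S - (g1 * (T * t * A i k) + g2 * B i k)) - g1 * (T * (t - 1) * A i k) by ring.
apply: le_trans (ler_normB _ _) _; apply: le_trans (lerD (ler_normB _ _) tA') _.
apply: le_trans (lerD (lerD hS lin) (lexx _)) _.
have h : eps * (`|T * t * A i k| + `|B i k|) <= eps * (drift_const * X + R1 * X).
  by rewrite ler_pM2l// lerD.
apply: le_trans (lerD (lerD (lexx _) h) (lexx _)) _.
by rewrite /window_const; apply: le_of_eq; ring.
Qed.

(** Transversality. The increment of positions is [g1 * A * expR (j * tau) + g2 * B] up to a window
    of order [eps * X], and it moves with [j] at a speed of order [|A|]; so the proportion [phi] of
    slopes at which two siblings are close is at most of order [eps * X / |A|]. Closeness at one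
    slope already bounds [B] in terms of [A], which replaces [|A| / X] by the distance [m] between
    parameters. *)
Lemma sibling_window (Dc : R) i k : 0 <= Dc ->
  let phi := avg (fun j => (`|sibling_pos j i - sibling_pos j k| <= Dc * eps * X)%R%:R) in
  let m := Num.max `|e k.1 o - e i.1 o| `|e' k.2 o' - e' i.2 o'| in
  0 <= phi <= marstrand_const Dc /\ phi * m <= marstrand_const Dc * eps.
Proof.
move=> Dc0 phi m.
have Kp : 0 < K by exact: lt_le_trans K1.
have R1p : 0 < R1 by exact: lt_le_trans R11.
have W0 : 0 <= window_const Dc.
  by rewrite /window_const !addr_ge0 ?mulr_ge0 ?(ltW R1p)// (le_trans ler01).
have C40 : 0 <= ratio_const Dc.
  by rewrite /ratio_const addr_ge0 ?(ltW Kp)// mulr_ge0 ?mulr_ge0 ?divr_ge0 ?addr_ge0 ?mulr_ge0 ?(ltW Kp) ?(ltW R1p) ?expR_ge0.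
have V0 : 0 <= 2 * window_const Dc / `|g1| by rewrite divr_ge0 ?mulr_ge0.
have C3 : 1 <= marstrand_const Dc.
  by rewrite /marstrand_const lerDr mulr_ge0// addr_ge0.
have phi01 : 0 <= phi <= 1.
  apply/andP; split; first by apply: avg_ge0 => j; rewrite ler0n.
  apply: le_trans (_ : avg (fun _ : 'I_J => 1) <= 1); last by rewrite avg_cst ?card_ord.
  by apply: avg_le => j; rewrite -[leRHS]/(1%:R) ler_nat leq_b1.
have /andP[p0 p1] := phi01; split; first by rewrite p0 (le_trans p1).
have m0 : 0 <= m by rewrite le_max normr_ge0.
have C3e : ((1 + 2 * window_const Dc / `|g1|) * ratio_const Dc) * eps <= marstrand_const Dc * eps.
  by rewrite ler_wpM2r ?(ltW eps0)// /marstrand_const lerDl.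
apply: le_trans C3e.
(* With no close slope [phi] vanishes; otherwise one close slope is what bounds [B] below. *)
have [[j hj]|nj] := pselect (exists j, `|sibling_pos j i - sibling_pos j k| <= Dc * eps * X); last first.
  have -> : phi = 0.
    rewrite /phi -[RHS](avg_cst (I := 'I_J) 0) ?card_ord//; congr (avg _).
    apply/funext => j; case: leP => // h; exfalso; apply: nj; exists j; exact: h.
  by rewrite mul0r mulr_ge0 ?(ltW eps0)// mulr_ge0// addr_ge0.
have close := close_siblings Dc0 hj.
(* The maximum covers both cases: when [A] is below [eps * X], the trivial bound [phi <= 1] is
   enough. *)
pose A' := Num.max `|A i k| (eps * X).
have A'0 : 0 < A' by rewrite lt_max mulr_gt0 ?orbT.
have mA : m * X <= ratio_const Dc * A'.
  have AA' : `|A i k| <= A' by rewrite le_max lexx.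
  have eA' : eps * X <= A' by rewrite le_max lexx orbT.
  have hB : `|B i k| <= (window_const Dc + `|g1| * drift_const) / `|g2| * A'.
    rewrite mulrAC ler_pdivlMr ?normr_gt0// mulrC -normrM.
    have th0 : `|0 : R| <= eps by rewrite normr0 ltW.
    have [_ s2 _] := shift_le (ltn_ord j) th0.
    rewrite (_ : g2 * B i k = (g1 * A i k * expR (j%:R * tau) + g2 * B i k)
       - g1 * A i k * expR (j%:R * tau)); last by ring.
    apply: le_trans (ler_normB _ _) _; rewrite mulrDl lerD//.
      by apply: le_trans close _; rewrite ler_wpM2l.
    rewrite !normrM (ger0_norm (expR_ge0 _)).
    have -> : `|g1| * drift_const * A' = `|g1| * (A' * drift_const) by ring.
    by rewrite -mulrA ler_wpM2l// ler_pM ?expR_ge0.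
  have x1 := Ae i k; have x2 := Be i k; rewrite !ler_pdivlMr// in x1 x2.
  have RE : ratio_const Dc = K + K * R1 * ((window_const Dc + `|g1| * drift_const) / `|g2|) by [].
  have q0 : 0 <= (window_const Dc + `|g1| * drift_const) / `|g2|.
    by rewrite divr_ge0// addr_ge0// mulr_ge0 ?expR_ge0.
  move: q0 hB RE; set q := (_ + _) / `|g2| => q0 hB ->.
  have KA : 0 <= K * A' by exact: mulr_ge0 (ltW Kp) (ltW A'0).
  have KqA : 0 <= K * R1 * q * A' by exact: mulr_ge0 (mulr_ge0 (mulr_ge0 (ltW Kp) (ltW R1p)) q0) (ltW A'0).
  rewrite /m maxEle mulrDl; case: ifP => _.
    apply: le_trans x2 _; apply: le_trans (_ : K * R1 * (q * A') <= _).
      by rewrite ler_pM2l// mulr_gt0.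
    by rewrite mulrA lerDr.
  apply: le_trans x1 _; apply: le_trans (_ : K * A' <= _); last by rewrite lerDl.
  by rewrite ler_pM2l.
have phiA : phi * A' <= (1 + 2 * window_const Dc / `|g1|) * (eps * X).
  rewrite /A' maxEle; case: ifP => hA.
    apply: ler_wpM2r; first exact: mulr_ge0 (ltW eps0) (ltW X0).
    by apply: le_trans p1 _; rewrite lerDl.
  have {}hA : eps * X < `|A i k| by rewrite ltNge hA.
  have A0 : A i k != 0.
    by rewrite -normr_gt0; apply: lt_trans hA; rewrite mulr_gt0.
  have nA : 0 < `|A i k| by rewrite normr_gt0.
  have h : phi <= tau + 2 * (window_const Dc * (eps * X)) / `|g1 * A i k|.
    apply: le_trans (avg_window (g2 * B i k) tau0 J0 Jtau1 _ _); last 2 first.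
    - by rewrite mulf_neq0.
    - by rewrite !mulr_ge0 ?(ltW eps0) ?(ltW X0).
    apply: avg_le => l; rewrite ler_nat.
    by case: (leP `|sibling_pos l i - _|) => // h; rewrite close_siblings.
  apply: le_trans (_ : (tau + 2 * (window_const Dc * (eps * X)) / `|g1 * A i k|) * `|A i k| <= _).
    by rewrite ler_wpM2r.
  rewrite mulrDl [leRHS]mulrDl mul1r lerD//.
    by apply: ler_pM; rewrite ?(ltW tau0).
  rewrite normrM invfM; apply: le_of_eq; field.
  by rewrite normr_eq0 g10 normr_eq0 A0.
have Xne : X != 0 by rewrite gt_eqF.
rewrite -(ler_pM2r X0).
apply: le_trans (_ : phi * (ratio_const Dc * A') <= _).
  by rewrite -mulrA ler_wpM2l.
have -> : (1 + 2 * window_const Dc / `|g1|) * ratio_const Dc * eps * X =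
  ratio_const Dc * ((1 + 2 * window_const Dc / `|g1|) * (eps * X)) by ring.
by rewrite mulrCA ler_wpM2l.
Qed.

(** After exchanging the averages, [sibling_window] bounds the proportion of bad slopes by a
    constant and by a multiple of [eps / m]. The Frostman conditions of the two families multiply,
    giving exponent [d + d'] for the maximum [m] of the two distances, and [avg_layers] sums over
    the sizes of [m]. *)
Lemma marstrand_step (Dc Bf mu : R) (k : nat) i :
  0 <= Dc -> (0 < k)%N -> 0 <= Bf -> mu <= 1 -> mu <= d + d' ->
  (forall i t, eps <= t <= 1 ->
     avg (fun k => (`|e k o - e i o| <= t)%R%:R) <= Bf * t `^ d) ->
  (forall i t, eps <= t <= 1 ->
     avg (fun k => (`|e' k o' - e' i o'| <= t)%R%:R) <= Bf * t `^ d') ->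
  avg (fun j => avg (fun l =>
    (`|sibling_pos j i - sibling_pos j l| <= Dc * eps * X)%R%:R))
  <= k.+1%:R * (marstrand_const Dc * (Bf * Bf) * eps `^ (mu - k%:R^-1)).
Proof.
move=> Dc0 k0 B0 mu1 mud cnt cnt'; rewrite exchange_avg.
apply: (avg_layers (m := fun l => Num.max `|e l.1 o - e i.1 o| `|e' l.2 o' - e' i.2 o'|)
  (sig := d + d')) => //.
- by rewrite eps0 (le_lt_trans eps2)// invf_lt1// ltr1n.
- have [/andP[h1 h2] _] := sibling_window i i Dc0; exact: le_trans h1 h2.
- by rewrite mulr_ge0.
- by move=> l; have [] := sibling_window i l Dc0.
- by move=> l; have [] := sibling_window i l Dc0.
- move=> l; have := in_unit FM (Fe l.1) ho; have := in_unit FM (Fe i.1) ho.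
  have := in_unit FM' (Fe' l.2) ho'; have := in_unit FM' (Fe' i.2) ho'.
  move=> /andP[x1 x2] /andP[x3 x4] /andP[x5 x6] /andP[x7 x8].
  by rewrite ge_max !ler_norml; apply/andP; split; apply/andP; split; lra.
- move=> t te.
  have -> : (fun l : 'I_N * 'I_N' => (Num.max `|e l.1 o - e i.1 o| `|e' l.2 o' - e' i.2 o'| <= t)%R%:R : R) =
    (fun l => (`|e l.1 o - e i.1 o| <= t)%R%:R * (`|e' l.2 o' - e' i.2 o'| <= t)%R%:R).
    by apply/funext => l; rewrite ge_max; case: (_ <= t); case: (_ <= t); rewrite /= ?mulr1 ?mulr0.
  rewrite (avg_prod (fun l => (`|e l o - e i.1 o| <= t)%R%:R) (fun l => (`|e' l o' - e' i.2 o'| <= t)%R%:R)).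
  have t0 : 0 < t by have /andP[h _] := te; exact: lt_le_trans h.
  rewrite powRD; last by apply/implyP => _; rewrite gt_eqF.
  rewrite [leRHS]mulrACA; apply: ler_pM.
  + by apply: avg_ge0 => l; rewrite ler0n.
  + by apply: avg_ge0 => l; rewrite ler0n.
  + exact: cnt.
  + exact: cnt'.
Qed.

End Siblings.
End MarstrandStep.

(** * A tree of balanced products over several generations *)

Section MacroTree.
Context {R : realType}.
Variables (K R1 g1 g2 d d' o o' eps tau : R) (F F' : (R -> R) -> Prop).
Variables (H : R -> R -> R) (J : nat) (u : nat -> R -> R) (w w2 : R -> R).
Hypotheses (K1 : 1 <= K) (R11 : 1 <= R1)
  (FM : quasi_affine_monoid K F) (FM' : quasi_affine_monoid K F')
  (g10 : g1 != 0) (g20 : g2 != 0) (ho : 0 <= o <= 1) (ho' : 0 <= o' <= 1)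
  (eps0 : 0 < eps) (eps2 : eps <= 2^-1).
Hypotheses (tau0 : 0 < tau) (taueps : tau <= eps) (J0 : (0 < J)%N)
  (Jtau1 : 1 <= J%:R * tau) (Jtau2 : J%:R * tau <= 2)
  (Fu : forall j, F (u j)) (Fw : F w) (Fw2 : F' w2)
  (ushift : forall j, (j < J)%N -> forall x y, 0 <= x <= 1 -> 0 <= y <= 1 ->
    exists2 theta, `|theta| <= eps &
      w (u j x) - w (u j y) =
        expR (j%:R * tau + theta) * (w (u 0%N x) - w (u 0%N y)))
  (Hlin : linear_box H g1 g2 eps w w2).
Variables (c1 kap Bf mu Bd : R) (k Q : nat).
Variables (N N' : bool -> nat) (e : forall b : bool, 'I_(N b) -> R -> R)
  (e' : forall b : bool, 'I_(N' b) -> R -> R).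
Hypotheses (c10 : 0 < c1 <= 1) (kapE : kap = c1 / (K * K))
  (R1K : K ^+ 4 <= c1 ^+ 2 * R1)
  (N0 : forall b, (0 < N b)%N) (N0' : forall b, (0 < N' b)%N)
  (Fe : forall b i, F (@e b i)) (Fe' : forall b i, F' (@e' b i))
  (sze : forall b i, c1 * (if b then kap * eps else eps) <= sz (@e b i)
    <= (if b then kap * eps else eps))
  (sze' : forall b i, c1 * (if b then eps else kap * eps) <= sz (@e' b i)
    <= (if b then eps else kap * eps))
  (cnt : forall b i t, eps <= t <= 1 ->
     avg (fun k => (`|@e b k o - @e b i o| <= t)%R%:R) <= Bf * t `^ d)
  (cnt' : forall b i t, eps <= t <= 1 ->
     avg (fun k => (`|@e' b k o' - @e' b i o'| <= t)%R%:R) <= Bf * t `^ d')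
  (k0 : (0 < k)%N) (Bf0 : 0 <= Bf) (mu1 : mu <= 1) (mud : mu <= d + d').

Definition spread_const : R := (`|g1| + `|g2| + 1) * (drift_const + R1).

(** The image of a child extends to at most [spread_const * (K * eps * X)] from its position. Two
    children at distance [sep_const * eps * X] therefore keep a gap [eps * X] between all their
    descendants. *)
Definition sep_const : R := 2 * (K * spread_const) + 1.

Hypotheses (Bd0 : 0 < Bd) (HBd : k.+1%:R *
  (marstrand_const K R1 g1 g2 (2 * sep_const) * (Bf * Bf) * eps `^ (mu - k%:R^-1)) <= Bd).

Let K0 : 0 < K. Proof. exact: lt_le_trans K1. Qed.
Let R10 : 0 < R1. Proof. exact: lt_le_trans R11. Qed.

Let T := ((R -> R) * (R -> R))%type.
Let X (x : T) := sz (w \o u 0%N \o x.1).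
Let Y (x : T) := sz (w2 \o x.2).
(** The longer factor receives the family of scale [kap * eps], the other one that of scale [eps];
    this prevents the ratio of the two lengths from drifting over the generations. *)
Let beta (x : T) : bool := Y x <= X x.
Let ix (x : T) : finType := ('I_(N (beta x)) * 'I_(N' (beta x)))%type.
Let child (x : T) (i : ix x) : T := (x.1 \o e i.1, x.2 \o e' i.2).
Let pos (j : 'I_J) (x : T) := H (w (u j (x.1 o))) (w2 (x.2 o')).
Let D (x : T) := sep_const * eps * X x.

Definition shrink_rate : R := K^-1 * c1 * kap * eps.
Let X0 := sz (w \o u 0%N).

(** [n] is the number of generations to come, hence the exponent [Q - n]. Lengths are measured with
    [u 0]; another slope changes them by at most the factor [drift_const]. *)
Definition balanced_node (n : nat) (x : T) : Prop :=
  [/\ F x.1, F' x.2, X x <= R1 * Y x /\ Y x <= R1 * X x,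
     shrink_rate ^+ (Q - n) * X0 <= X x & (n <= Q)%N].

Let kap01 : 0 < kap <= 1.
Proof.
have /andP[c c'] := c10; rewrite kapE divr_gt0 ?mulr_gt0//= ler_pdivrMr ?mulr_gt0//.
by rewrite mul1r (le_trans c')// -[leLHS]mulr1 ler_pM.
Qed.

Let rho0 : 0 < shrink_rate.
Proof.
have /andP[c c'] := c10; have /andP[p p'] := kap01.
by rewrite /shrink_rate !mulr_gt0 ?invr_gt0.
Qed.

Let spread0 : 0 <= spread_const.
Proof. by rewrite /spread_const mulr_ge0 ?addr_ge0 ?expR_ge0 ?(ltW R10). Qed.

Let FX (x : T) : F x.1 -> F (w \o u 0%N \o x.1).
Proof. exact: (monoid_comp FM (monoid_comp FM Fw (Fu 0%N))). Qed.
Let FY (x : T) : F' x.2 -> F' (w2 \o x.2).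
Proof. exact: (monoid_comp FM' Fw2). Qed.

(** The choice [kap = c1 / (K * K)] compensates the distortion, so the ratio of the longer length to
    the shorter does not grow; if the order of the two is reversed, the new ratio is at most
    [K ^ 4 / c1 ^ 2], hence at most [R1]. *)
Lemma child_sizes (x : T) (i : ix x) : F x.1 -> F' x.2 ->
  [/\ X (child i) <= K * eps * X x, shrink_rate * X x <= X (child i) &
   (X x <= R1 * Y x /\ Y x <= R1 * X x) ->
   X (child i) <= R1 * Y (child i) /\ Y (child i) <= R1 * X (child i)].
Proof.
move=> F1 F2; have /andP[c c'] := c10; have /andP[p p'] := kap01.
have gX := sz_gt0 FM (FX F1); have gY := sz_gt0 FM' (FY F2).
rewrite -/(X x) -/(Y x) in gX gY.
have l1 : X (child i) <= K * X x * sz (e i.1) := sz_comp_le FM (FX F1) (Fe _).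
have l2 : K^-1 * X x * sz (e i.1) <= X (child i) := sz_comp_ge FM (FX F1) (Fe _).
have l3 : Y (child i) <= K * Y x * sz (e' i.2) := sz_comp_le FM' (FY F2) (Fe' _).
have l4 : K^-1 * Y x * sz (e' i.2) <= Y (child i) := sz_comp_ge FM' (FY F2) (Fe' _).
have /andP[s1 s2] := sze i.1; have /andP[s3 s4] := sze' i.2.
have ke : kap * eps <= eps by rewrite ler_piMl// ltW.
have ki : 0 < K^-1 by rewrite invr_gt0.
have Ki : K * K^-1 = 1 by rewrite divff ?gt_eqF.
split.
- apply: le_trans l1 _; rewrite mulrAC ler_pM2r// ler_pM2l//.
  by apply: le_trans s2 _; case: (beta x).
- apply: le_trans l2; rewrite /shrink_rate [leRHS]mulrAC ler_pM2r// -!mulrA ler_pM2l//.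
  apply: le_trans s1; rewrite ler_pM2l//.
  by case: (beta x).
move=> [xy yx].
have kapK : kap * (K * K) = c1 by rewrite kapE mulfVK// gt_eqF ?mulr_gt0.
move: (X (child i)) (Y (child i)) (sz (e i.1)) (sz (e' i.2)) l1 l2 l3 l4 s1 s2 s3 s4.
move=> Xc Yc se se' l1 l2 l3 l4; have : beta x = (Y x <= X x) by [].
case: (beta x) => bE s1 s2 s3 s4.
- have yx1 : Y x <= X x by rewrite -bE.
  have a1 : Xc <= K * X x * (kap * eps).
    by apply: le_trans l1 _; rewrite ler_pM2l// mulr_gt0.
  have a2 : K^-1 * X x * (c1 * (kap * eps)) <= Xc.
    by apply: le_trans l2; rewrite ler_pM2l// mulr_gt0.
  have a3 : Yc <= K * Y x * eps.
    by apply: le_trans l3 _; rewrite ler_pM2l// mulr_gt0.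
  have a4 : K^-1 * Y x * (c1 * eps) <= Yc.
    by apply: le_trans l4; rewrite ler_pM2l// mulr_gt0.
  split.
    apply: le_trans a1 _; apply: le_trans (_ : R1 * (K^-1 * Y x * (c1 * eps)) <= _); last first.
      by rewrite ler_pM2l.
    rewrite -kapK (_ : R1 * _ = (K * K^-1) * K * kap * eps * (R1 * Y x)); last by ring.
    rewrite Ki mul1r (_ : K * X x * _ = K * kap * eps * X x); last by ring.
    by rewrite ler_pM2l// !mulr_gt0.
  apply: le_trans a3 _; apply: le_trans (_ : R1 * (K^-1 * X x * (c1 * (kap * eps))) <= _); last first.
    by rewrite ler_pM2l.
  rewrite -(ler_pM2l (mulr_gt0 (mulr_gt0 K0 K0) K0)).
  have -> : K * K * K * (R1 * (K^-1 * X x * (c1 * (kap * eps)))) =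
     (K * K^-1) * (kap * (K * K)) * c1 * R1 * (eps * X x) by ring.
  rewrite Ki kapK mul1r (_ : c1 * c1 * R1 = c1 ^+ 2 * R1); last by ring.
  rewrite (_ : K * K * K * _ = K ^+ 4 * (eps * Y x)); last by ring.
  by rewrite ler_pM ?exprn_ge0 ?mulr_ge0 ?(ltW K0) ?(ltW eps0) ?(ltW gY)// ler_pM2l.
- have yx1 : X x <= Y x by rewrite ltW// ltNge -bE.
  have a1 : Xc <= K * X x * eps.
    by apply: le_trans l1 _; rewrite ler_pM2l// mulr_gt0.
  have a2 : K^-1 * X x * (c1 * eps) <= Xc.
    by apply: le_trans l2; rewrite ler_pM2l// mulr_gt0.
  have a3 : Yc <= K * Y x * (kap * eps).
    by apply: le_trans l3 _; rewrite ler_pM2l// mulr_gt0.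
  have a4 : K^-1 * Y x * (c1 * (kap * eps)) <= Yc.
    by apply: le_trans l4; rewrite ler_pM2l// mulr_gt0.
  split; last first.
    apply: le_trans a3 _; apply: le_trans (_ : R1 * (K^-1 * X x * (c1 * eps)) <= _); last first.
      by rewrite ler_pM2l.
    rewrite -kapK (_ : R1 * _ = (K * K^-1) * K * kap * eps * (R1 * X x)); last by ring.
    rewrite Ki mul1r (_ : K * Y x * _ = K * kap * eps * Y x); last by ring.
    by rewrite ler_pM2l// !mulr_gt0.
  apply: le_trans a1 _; apply: le_trans (_ : R1 * (K^-1 * Y x * (c1 * (kap * eps))) <= _); last first.
    by rewrite ler_pM2l.
  rewrite -(ler_pM2l (mulr_gt0 (mulr_gt0 K0 K0) K0)).
  have -> : K * K * K * (R1 * (K^-1 * Y x * (c1 * (kap * eps)))) =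
     (K * K^-1) * (kap * (K * K)) * c1 * R1 * (eps * Y x) by ring.
  rewrite Ki kapK mul1r (_ : c1 * c1 * R1 = c1 ^+ 2 * R1); last by ring.
  rewrite (_ : K * K * K * _ = K ^+ 4 * (eps * X x)); last by ring.
  by rewrite ler_pM ?exprn_ge0 ?mulr_ge0 ?(ltW K0) ?(ltW eps0) ?(ltW gX)// ler_pM2l.
Qed.

Lemma balanced_child n x (i : ix x) :
  balanced_node n.+1 x -> balanced_node n (child i).
Proof.
move=> [F1 F2 bal size nQ]; have [s1 s2 s3] := child_sizes i F1 F2.
split.
- exact: (monoid_comp FM F1 (Fe _)).
- exact: (monoid_comp FM' F2 (Fe' _)).
- exact: s3.
- by apply: le_trans s2; rewrite -subnSK// exprS -mulrA ler_pM2l.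
- exact: ltnW.
Qed.

Lemma node_spread (j : 'I_J) (x : T) a c : F x.1 -> F' x.2 ->
  Y x <= R1 * X x -> 0 <= a <= 1 -> 0 <= c <= 1 ->
  `|H (w (u j (x.1 a))) (w2 (x.2 c)) - pos j x| <= spread_const * X x.
Proof.
move=> F1 F2 yx a1 c1'.
have xa := in_unit FM F1 a1; have xo := in_unit FM F1 ho.
have ya := in_unit FM' F2 c1'; have yo := in_unit FM' F2 ho'.
have lin := Hlin (in_unit FM (Fu j) xa) (in_unit FM (Fu j) xo) ya yo.
rewrite -/(pos j x) in lin.
have [theta th eqs] := ushift (ltn_ord j) xa xo.
have [s1 _ _] := shift_le eps2 tau0 Jtau2 (ltn_ord j) th.
have dx : `|w (u j (x.1 a)) - w (u j (x.1 o))| <= drift_const * X x.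
  rewrite eqs normrM gtr0_norm ?expR_gt0// ler_pM ?expR_ge0//.
  exact: (dist_sz FM (FX F1) a1 ho).
have dy : `|w2 (x.2 c) - w2 (x.2 o')| <= R1 * X x.
  by apply: le_trans yx; exact: (dist_sz FM' (FY F2) c1' ho').
set S := _ - pos j x in lin *.
set A := w (u j (x.1 a)) - _ in lin dx *; set C := w2 _ - w2 _ in lin dy *.
have -> : S = (S - (g1 * A + g2 * C)) + (g1 * A + g2 * C) by ring.
apply: le_trans (ler_normD _ _) _; apply: le_trans (lerD lin (ler_normD _ _)) _.
rewrite !normrM.
have e1 : eps <= 1 by apply: le_trans eps2 _; rewrite invf_le1// ler1n.
have nA := normr_ge0 A; have nC := normr_ge0 C.
have n1 := normr_ge0 g1; have n2 := normr_ge0 g2.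
apply: le_trans (_ : (`|g1| + `|g2| + 1) * (`|A| + `|C|) <= _).
  rewrite [leRHS](_ : _ = 1 * (`|A| + `|C|) + (`|g1| * `|A| + `|g2| * `|C|) + (`|g1| * `|C| + `|g2| * `|A|)); last by ring.
  rewrite -[leLHS]addr0; apply: lerD; last by rewrite addr_ge0// mulr_ge0.
  by rewrite lerD// ler_wpM2r// addr_ge0.
rewrite /spread_const -mulrA ler_wpM2l ?addr_ge0//.
by rewrite mulrDl lerD.
Qed.

Lemma reach_comp n (x z : T) : reach child n x z -> balanced_node n x ->
  [/\ balanced_node 0 z &
    exists B B', [/\ F B, F' B', z.1 = x.1 \o B & z.2 = x.2 \o B']].
Proof.
elim: n x => [|n IH] x /=.
  move=> -> Px; split=> //; exists id, id; split=> //; first by case: FM.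
  by case: FM'.
move=> [i /IH h Px]; have [Pz [B [B' [FB FB' z1 z2]]]] := h (balanced_child i Px).
split=> //; exists (e i.1 \o B), (e' i.2 \o B'); split=> //.
- exact: (monoid_comp FM (Fe _) FB).
- exact: (monoid_comp FM' (Fe' _) FB').
Qed.

Definition separated_nodes (j : 'I_J) (z z' : T) : Prop :=
  forall x y x' y', 0 <= x <= 1 -> 0 <= y <= 1 -> 0 <= x' <= 1 -> 0 <= y' <= 1 ->
    eps * (shrink_rate ^+ Q * X0) <=
      `|H (w (u j (z.1 x))) (w2 (z.2 y)) - H (w (u j (z'.1 x'))) (w2 (z'.2 y'))|.

Lemma children_separated (j : 'I_J) n x (i l : ix x) zi zl :
  balanced_node n.+1 x -> D x < `|pos j (child i) - pos j (child l)| ->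
  reach child n (child i) zi -> reach child n (child l) zl ->
  separated_nodes j zi zl.
Proof.
move=> Px Dx ri rl a c a' c' ha hc ha' hc'.
have Pi := balanced_child i Px; have Pl := balanced_child l Px.
have [_ [B [B' [FB FB' z1 z2]]]] := reach_comp ri Pi.
have [_ [C [C' [FC FC' z3 z4]]]] := reach_comp rl Pl.
have [F1 F2 _ sx nQ] := Px.
have [iF1 iF2 [_ ib] _ _] := Pi; have [lF1 lF2 [_ lb] _ _] := Pl.
have [ci _ _] := child_sizes i F1 F2; have [cl _ _] := child_sizes l F1 F2.
have si := node_spread j iF1 iF2 ib (in_unit FM FB ha) (in_unit FM' FB' hc).
have sl := node_spread j lF1 lF2 lb (in_unit FM FC ha') (in_unit FM' FC' hc').
rewrite z1 z2 z3 z4 /=.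
set P := H _ _ in si *; set P' := H _ _ in sl *.
have si' := le_trans si (ler_wpM2l spread0 ci).
have sl' := le_trans sl (ler_wpM2l spread0 cl).
have t : `|pos j (child i) - pos j (child l)| <=
   `|P - pos j (child i)| + `|P - P'| + `|P' - pos j (child l)|.
  rewrite (_ : pos j (child i) - _ = - (P - pos j (child i)) + (P - P') + (P' - pos j (child l))); last by ring.
  apply: le_trans (ler_normD _ _) _; rewrite lerD2r.
  by apply: le_trans (ler_normD _ _) _; rewrite normrN.
apply: le_trans (_ : eps * X x <= _).
  rewrite ler_pM2l//; apply: le_trans sx.
  rewrite ler_pM2r; last exact: (sz_gt0 FM (monoid_comp FM Fw (Fu 0%N))).
  have /andP[c1p c1'] := c10; have /andP[p p'] := kap01.
  apply: ler_wiXn2l; rewrite ?(ltW rho0)//; last exact: leq_subr.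
  rewrite /shrink_rate.
  have e1 : eps <= 1 by apply: le_trans eps2 _; rewrite invf_le1// ler1n.
  have k1 : K^-1 <= 1 by rewrite invf_le1.
  have ki : 0 <= K^-1 by rewrite invr_ge0 ltW.
  by rewrite !mulr_ile1 ?mulr_ge0 ?(ltW c1p) ?(ltW p) ?(ltW eps0).
have : D x = 2 * (spread_const * (K * eps * X x)) + eps * X x.
  by rewrite /D /sep_const; ring.
by move=> DE; rewrite DE in Dx; lra.
Qed.

(** The root is a pair of identities. The average of [game_value] over the slopes is at least
    [- Q * ln Bd], so some slope [j] reaches this value, and [game_value_separated] is applied with
    that [j] alone. *)
Lemma macro_tree : X0 <= R1 * sz w2 -> sz w2 <= R1 * X0 ->
  exists (j : 'I_J) (l : seq T), [/\ expR (- (Q%:R * ln Bd)) <= (size l)%:R,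
    all (fun z => `[< balanced_node 0 z >]) l &
    pairwise (fun z z' => `[< separated_nodes j z z' >]) l].
Proof.
move=> b1 b2; pose root : T := (id, id).
have Proot : balanced_node Q root.
  split=> //; first by case: FM.
  - by case: FM'.
  - by rewrite subnn expr0 mul1r.
have sep0 : 0 <= sep_const.
  by rewrite /sep_const addr_ge0// mulr_ge0// mulr_ge0// ltW.
have Pix n x : balanced_node n x -> (0 < #|ix x|)%N /\ 0 <= D x.
  move=> _; split; first by rewrite /ix card_prod !card_ord muln_gt0 N0 N0'.
  exact: mulr_ge0 (mulr_ge0 sep0 (ltW eps0)) (normr_ge0 _).
have cJ : (0 < #|'I_J|)%N by rewrite card_ord.
have Pcrowd n x (i : ix x) : balanced_node n.+1 x ->
    avg (fun j => crowd child (pos j) D (x := x) i) <= Bd.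
  move=> [F1 F2 [xy yx] _ _]; apply: le_trans HBd.
  (* [crowd] looks within [2 * D x], hence the closeness constant [2 * sep_const]. *)
  have Dc0 : 0 <= 2 * sep_const.
    exact: mulr_ge0.
  have := @marstrand_step _ K R1 g1 g2 d d' o o' eps tau F F' H J u w w2 K1 R11
    FM FM' g10 g20 ho ho' eps0 eps2 tau0 taueps J0 Jtau1 Jtau2 Fu Fw Fw2 ushift Hlin
    x.1 x.2 F1 F2 _ _ (@e (beta x)) (@e' (beta x)) (@Fe _) (@Fe' _) xy yx
    (2 * sep_const) Bf mu k i Dc0 k0 Bf0 mu1 mud (@cnt _) (@cnt' _).
  apply: le_trans; rewrite le_eqVlt; apply/orP; left; apply/eqP.
  congr (avg _); apply/funext => j; congr (avg _); apply/funext => l.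
  by rewrite /D !mulrA.
have /(avg_ge_ex cJ) [j hj] := game_value_avg (pos := pos) cJ Bd0
  balanced_child Pix Pcrowd Proot.
have [l [l1 l2 l3]] := game_value_separated balanced_child Pix
  (@children_separated j) Proot.
exists j, l; split=> //; first by apply: le_trans l1; rewrite ler_expR.
apply: sub_all l2 => z /asboolP rz; apply/asboolP.
by have [] := reach_comp rz Proot.
Qed.

End MacroTree.

(** * The step of the construction and the choice of its constants *)

Section MacroStep.
Context {R : realType}.

Lemma powR_small (A a : R) : 0 < a -> exists2 e : R, 0 < e &
  forall x, 0 < x < e -> A * x `^ a <= 1.
Proof.
move=> a0; have A0 : 0 < `|A| + 1 by rewrite ltr_wpDl.
exists ((`|A| + 1) `^ (- a^-1)); first exact: powR_gt0.
move=> x /andP[x0 xe]; apply: le_trans (_ : (`|A| + 1) * x `^ a <= _).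
  by rewrite ler_wpM2r ?powR_ge0// (le_trans (ler_norm _))// lerDl.
rewrite -ler_pdivlMl// mulr1.
apply: le_trans (_ : ((`|A| + 1) `^ (- a^-1)) `^ a <= _).
  by apply: ge0_ler_powR; rewrite ?nnegrE ?(ltW x0) ?powR_ge0 ?(ltW a0) ?(ltW xe).
by rewrite -powRrM mulNr mulVf ?gt_eqF// powRN powRr1 ?(ltW A0).
Qed.

Lemma powR_expn (x a : R) (n : nat) : 0 <= x -> (x ^+ n) `^ a = (x `^ a) ^+ n.
Proof.
move=> x0; rewrite -powR_mulrn// -powRrM mulrC powRrM powR_mulrn//.
exact: powR_ge0.
Qed.

Lemma linear_box_comp (H : R -> R -> R) (g1 g2 eta : R) (w w' p p' : R -> R) :
  (forall x, 0 <= x <= 1 -> 0 <= p x <= 1) ->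
  (forall x, 0 <= x <= 1 -> 0 <= p' x <= 1) ->
  linear_box H g1 g2 eta w w' -> linear_box H g1 g2 eta (w \o p) (w' \o p').
Proof. by move=> hp hp' lin x1 x2 y1 y2 *; apply: lin; auto. Qed.

Lemma marstrand_const_ge0 (K R1 g1 g2 Dc : R) : 0 <= K -> 0 <= R1 -> 0 <= Dc ->
  0 <= marstrand_const K R1 g1 g2 Dc.
Proof.
move=> K0 R10 Dc0; have E0 : 0 <= drift_const :> R by exact: expR_ge0.
have W0 : 0 <= window_const R1 g1 Dc.
  apply: addr_ge0; first exact: (addr_ge0 (addr_ge0 Dc0 E0) R10).
  by apply: mulr_ge0 => //; apply: mulr_ge0.
apply: addr_ge0 => //; apply: mulr_ge0.
  by apply: addr_ge0 => //; apply: divr_ge0 => //; apply: mulr_ge0.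
apply: addr_ge0 => //; apply: mulr_ge0; first exact: mulr_ge0.
by apply: divr_ge0 => //; apply: addr_ge0 => //; apply: mulr_ge0.
Qed.

Lemma sep_const_ge0 (K R1 g1 g2 : R) : 0 <= K -> 0 <= R1 -> 0 <= sep_const K R1 g1 g2.
Proof.
move=> K0 R10; apply: addr_ge0 => //; apply: mulr_ge0 => //; apply: mulr_ge0 => //.
apply: mulr_ge0; first by apply: addr_ge0 => //; apply: addr_ge0.
by apply: addr_ge0 => //; exact: expR_ge0.
Qed.

Lemma small_map (K d o c1 : R) (F : (R -> R) -> Prop) : 0 < K ->
  has_families F o d c1 -> exists v, F v /\ K * sz v <= 2^-1.
Proof.
move=> K0 fam; have [e0 e00 he0] := fam 1 ltr01.
pose e1 := Num.min (e0 / 2) (2 * K)^-1.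
have e1P : 0 < e1 < e0.
  rewrite lt_min divr_gt0// invr_gt0 mulr_gt0//= gt_min ltr_pdivrMr//.
  by rewrite ltr_pMr// ltr1n.
have [N [e [N0 Fe _]]] := he0 _ e1P; pose i0 := Ordinal N0.
have [Fi /andP[_ si]] := Fe i0; exists (e i0); split=> //.
apply: le_trans (_ : K * (2 * K)^-1 <= _).
  by rewrite ler_pM2l// (le_trans si)// ge_min lexx orbT.
by rewrite invfM mulrCA divff ?gt_eqF// mulr1.
Qed.

(** All constants precede [w] and [w'], and the new pairs satisfy the hypotheses on the old one,
    with the same [Rb] and, on sub-boxes, the same [eta0]; so the step can be iterated. The
    inequality [1 <= M * r ^ t] is what gives dimension [t] to the resulting tree. [Rm] lets [Rb]
    absorb the ratio of the starting pair. *)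
Lemma macro_step (K c1 d d' o o' g1 g2 t Rm : R) (F F' : (R -> R) -> Prop)
    (H : R -> R -> R) :
  1 <= K -> 0 < c1 <= 1 -> 0 <= Rm ->
  quasi_affine_monoid K F -> quasi_affine_monoid K F' ->
  0 <= o <= 1 -> 0 <= o' <= 1 ->
  has_families F o d c1 -> has_families F' o' d' c1 -> has_shifts F ->
  g1 != 0 -> g2 != 0 -> 0 <= t -> t < 1 -> t < d + d' ->
  exists (M : nat) (r Rb eta0 : R), [/\ 0 < r < 1, Rm <= Rb, 0 < eta0,
    1 <= M%:R * r `^ t &
    forall w w', F w -> F' w' -> sz w <= Rb * sz w' -> sz w' <= Rb * sz w ->
      linear_box H g1 g2 eta0 w w' ->
      exists v v' : 'I_M -> R -> R,
        (forall i, [/\ F (v i), F' (v' i), r * sz w <= sz (w \o v i),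
            sz (w \o v i) <= Rb * sz (w' \o v' i) &
            sz (w' \o v' i) <= Rb * sz (w \o v i)]) /\
        forall i k, i != k -> forall x y x' y', 0 <= x <= 1 -> 0 <= y <= 1 ->
          0 <= x' <= 1 -> 0 <= y' <= 1 ->
          r * sz w <=
            `|H (w (v i x)) (w' (v' i y)) - H (w (v k x')) (w' (v' k y'))|].
Proof.
move=> K1 c101 Rm0 FM FM' ho ho' fam fam' shift g10 g20 t0 t1 td.
have K0 : 0 < K by exact: lt_le_trans K1.
have /andP[c10 c11] := c101.
pose mm := Num.min 1 (d + d'); pose gap := mm - t.
have gap0 : 0 < gap by rewrite subr_gt0 lt_min t1.
(* Half of [gap] is given up: [2 * eta] and [1 / k] cost at most [gap / 8] each, and the remaining
   [gap / 4] absorbs the constants once [eps] is small. *)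
pose k := (Num.truncn (8 / gap)).+1; pose eta := gap / 16.
have eta0 : 0 < eta by rewrite divr_gt0.
have kgap : k%:R^-1 <= gap / 8.
  rewrite -[leRHS]invrK lef_pV2 ?posrE ?ltr0n ?invr_gt0 ?divr_gt0// invf_div.
  by apply: ltW; rewrite /k; apply: truncnS_gt.
pose t' := mm - gap / 2.
have half (z w : R) : w < z + 1 -> 1 <= z -> 2^-1 * w <= z by lra.
have expo1 : gap / 4 + t' <= - (2 * eta) + (mm - k%:R^-1) by rewrite /eta /t'; lra.
have expo2 : - t' + t = - (gap / 2) by rewrite /t' /gap; lra.
have expo3 : gap / 4 <= gap / 2 by lra.
pose kap := c1 / (K * K).
have kap0 : 0 < kap by rewrite divr_gt0 ?mulr_gt0.
have kap1 : kap <= 1.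
  by rewrite ler_pdivrMr ?mulr_gt0// mul1r (le_trans c11)// -[leLHS]mulr1 ler_pM.
have [v0 [Fv0 v0K]] := small_map K0 fam'.
have v0p := sz_gt0 FM' Fv0.
(* The first term preserves the balance from parent to child, the second lets [v0] shrink without
   overshooting, the third dominates [Rm]. *)
pose R1 := K ^+ 4 / c1 ^+ 2 + (K / sz v0 + Rm).
have K41 : 1 <= K ^+ 4 / c1 ^+ 2.
  by rewrite ler_pdivlMr ?exprn_gt0// mul1r (le_trans (_ : _ <= 1)) ?exprn_ege1// exprn_ile1// ltW.
have Kv0 : 0 <= K / sz v0 by rewrite divr_ge0// ltW.
have R11 : 1 <= R1 by rewrite (le_trans K41)// lerDl addr_ge0.
have R10 : 0 < R1 by exact: lt_le_trans R11.
have R1K : K ^+ 4 <= c1 ^+ 2 * R1.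
  rewrite mulrDr mulrCA divff ?gt_eqF ?exprn_gt0// mulr1 lerDl.
  by apply: mulr_ge0; [rewrite exprn_ge0// ltW | exact: addr_ge0].
have R1v : K <= R1 * sz v0.
  rewrite -ler_pdivrMr//; apply: le_trans (_ : K / sz v0 + Rm <= _).
    by rewrite lerDl.
  by rewrite lerDr (le_trans ler01).
have RmR1 : Rm <= R1.
  apply: le_trans (_ : K / sz v0 + Rm <= _); first by rewrite lerDr.
  by rewrite lerDr (le_trans ler01).
pose E : R := drift_const.
have E1 : 1 <= E by rewrite /E /drift_const -[leLHS]expR0 ler_expR.
have E0 : 0 < E by exact: lt_le_trans E1.
pose MC := marstrand_const K R1 g1 g2 (2 * sep_const K R1 g1 g2).
pose A := k.+1%:R * (MC * kap `^ (- (2 * eta))).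
pose rho0 := K^-1 * c1 * kap.
have Ki1 : K^-1 <= 1 by rewrite invf_le1.
have Ki0 : 0 < K^-1 by rewrite invr_gt0.
have rho00 : 0 < rho0 by exact: mulr_gt0 (mulr_gt0 Ki0 c10) kap0.
have rho01 : rho0 <= 1 by exact: (mulr_ile1 (ltW (mulr_gt0 Ki0 c10)) (ltW kap0) (mulr_ile1 (ltW Ki0) (ltW c10) Ki1 c11) kap1).
have g40 : 0 < gap / 4 by rewrite divr_gt0.
have [eA eA0 heA] := powR_small A g40.
have [eB eB0 heB] := powR_small (2 / rho0) g40.
have [eF eF0 heF] := fam eta eta0.
have [eG eG0 heG] := fam' eta eta0.
pose em := Num.min (Num.min eA eB) (Num.min eF eG).
have em0 : 0 < em by rewrite !lt_min eA0 eB0 eF0 eG0.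
pose eps := Num.min (em / 2) 2^-1.
have eps0 : 0 < eps by rewrite lt_min divr_gt0//= invr_gt0.
have eps2 : eps <= 2^-1 by rewrite ge_min lexx orbT.
have eps1 : eps <= 1 by apply: le_trans eps2 _; rewrite invf_le1// ler1n.
have epsm : eps < em.
  by rewrite gt_min ltr_pdivrMr// ltr_pMr// ltr1n.
have {epsm} [epsA epsB epsF epsG] : [/\ eps < eA, eps < eB, eps < eF & eps < eG].
  by move: epsm; rewrite !lt_min => /andP[/andP[-> ->] /andP[-> ->]].
have ke0 : 0 < kap * eps by exact: mulr_gt0.
have kee : kap * eps <= eps by rewrite ler_piMl// ltW.
pose Bf := (kap * eps) `^ (- eta).
have Bf0 : 0 <= Bf by exact: powR_ge0.
have famb (b : bool) : 0 < (if b then kap * eps else eps) < eF.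
  by case: b; rewrite ?ke0 ?eps0//= (le_lt_trans kee).
have famb' (b : bool) : 0 < (if b then eps else kap * eps) < eG.
  by case: b; rewrite ?ke0 ?eps0//= (le_lt_trans kee).
have /choice[N /(_ _)/cid hN] : forall b : bool, exists N, exists e : 'I_N -> R -> R, _
  := fun b => heF _ (famb b).
have /choice[N' /(_ _)/cid hN'] : forall b : bool, exists N, exists e : 'I_N -> R -> R, _
  := fun b => heG _ (famb' b).
pose e b := projT1 (hN b); pose e' b := projT1 (hN' b).
have he b := projT2 (hN b); have he' b := projT2 (hN' b).
have Bfle s : kap * eps <= s -> 0 < s -> s `^ (- eta) <= Bf.
  move=> ks s0; rewrite /Bf !powRN lef_pV2 ?posrE ?powR_gt0//.
  by apply: ge0_ler_powR; rewrite ?nnegrE ?(ltW eta0) ?(ltW ke0) ?(ltW s0).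
pose Bd := eps `^ t'.
have Bd0 : 0 < Bd by exact: powR_gt0.
have HBd : k.+1%:R * (MC * (Bf * Bf) * eps `^ (mm - k%:R^-1)) <= Bd.
  have -> : Bf * Bf = kap `^ (- (2 * eta)) * eps `^ (- (2 * eta)).
    rewrite /Bf -powRD; last by apply/implyP => _; rewrite gt_eqF.
    rewrite (_ : - eta + - eta = - (2 * eta)); last by ring.
    by rewrite powRM// ltW.
  rewrite (_ : _ * _ = A * (eps `^ (- (2 * eta)) * eps `^ (mm - k%:R^-1))); last by rewrite /A; ring.
  rewrite -powRD; last by apply/implyP => _; rewrite gt_eqF.
  have A0 : 0 <= A.
    apply: mulr_ge0 => //; apply: mulr_ge0; last exact: powR_ge0.
    apply: marstrand_const_ge0; rewrite ?(ltW K0) ?(ltW R10)//.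
    by apply: mulr_ge0 => //; apply: sep_const_ge0; rewrite ltW.
  apply: le_trans (_ : A * (eps `^ (gap / 4) * eps `^ t') <= _).
    rewrite ler_wpM2l// -powRD; last by apply/implyP => _; rewrite gt_eqF.
    by rewrite ger_powR ?eps0.
  rewrite mulrA -[leRHS]mul1r ler_wpM2r ?powR_ge0//.
  by apply: heA; rewrite eps0.
(* The bound [eps] controls [tau] and [theta]. The bound [1 / (K * E)] on the size of [u 0] brings
   the ratio [E * R1], left by the preceding step, back to [R1]. *)
have d0 : 0 < Num.min eps (K * E)^-1 by rewrite lt_min eps0 invr_gt0 mulr_gt0.
have [tau /andP[tau0 taud] hu] := shift _ d0.
have taueps : tau <= eps by apply: le_trans (ltW taud) _; rewrite ge_min lexx.
pose J := (Num.truncn tau^-1).+1; have [u [Fu szu ushift]] := hu J.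
have Jtau1 : 1 <= J%:R * tau.
  by rewrite -ler_pdivrMr// mul1r ltW// truncnS_gt.
have Jtau2 : J%:R * tau <= 2.
  have -> : J%:R = (Num.truncn tau^-1)%:R + 1 :> R by rewrite natr1.
  rewrite mulrDl mul1r -[leRHS]/(1 + 1); apply: lerD; last by rewrite (le_trans taueps).
  by rewrite -ler_pdivlMr// mul1r truncn_le// invr_ge0 ltW.
have u0p := sz_gt0 FM (Fu 0%N).
have szu1 : sz (u 0%N) <= eps by apply: le_trans szu _; rewrite ge_min lexx.
have szu2 : sz (u 0%N) * (K * E) <= 1.
  rewrite -ler_pdivlMr ?mulr_gt0// mul1r; apply: le_trans szu _.
  by rewrite ge_min lexx orbT.
(* The loss of length due to [u], to its distortion and to the gap [eps]. It does not involve [Q],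
   which is then taken with [2 ^ Q >= 2 / cu]. *)
pose cu := eps * (K^-1 * E^-1 * sz (u 0%N)).
have Ei0 : 0 < E^-1 by rewrite invr_gt0.
have Ei1 : E^-1 <= 1 by rewrite invf_le1.
have cu0 : 0 < cu by exact: (mulr_gt0 eps0 (mulr_gt0 (mulr_gt0 Ki0 Ei0) u0p)).
have cu1 : cu < 1.
  apply: le_lt_trans (_ : 2^-1 < 1); last by rewrite invf_lt1// ltr1n.
  apply: le_trans eps2; rewrite /cu ger_pMr//.
  have KE : K^-1 * E^-1 <= 1 by exact: (mulr_ile1 (ltW Ki0) (ltW Ei0) Ki1 Ei1).
  exact: (mulr_ile1 (ltW (mulr_gt0 Ki0 Ei0)) (ltW u0p) KE (le_trans szu1 eps1)).
pose Q := Num.bound (2 / cu).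
have HQ : 2 / cu <= 2 ^+ Q.
  apply: le_trans (_ : Q%:R <= _); last by rewrite -natrX ler_nat ltnW// ltn_expl.
  by apply: ltW; apply: le_lt_trans (archi_boundP _); rewrite ?lexx// divr_ge0// ltW.
pose s := shrink_rate K eps c1 kap.
have sE : s = rho0 * eps by rewrite /s /shrink_rate.
have s0 : 0 < s by rewrite sE mulr_gt0.
have s1 : s <= 1 by rewrite sE; exact: (mulr_ile1 (ltW rho00) (ltW eps0) rho01 eps1).
have sQ0 : 0 < s ^+ Q by exact: exprn_gt0.
have sQ1 : s ^+ Q <= 1 by rewrite exprn_ile1// ltW.
pose y := expR (- (Q%:R * ln Bd)).
have yE : y = (eps `^ (- t')) ^+ Q.
  rewrite /y ln_powR -mulrN expRM_natl; congr (_ ^+ _).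
  by rewrite /powR gt_eqF// mulNr.
have key : 1 <= 2^-1 * y * (s ^+ Q * cu) `^ t.
  rewrite powRM ?(ltW sQ0) ?(ltW cu0)// powR_expn ?(ltW s0)// yE.
  rewrite [leRHS](_ : _ = (eps `^ (- t') * s `^ t) ^+ Q * (2^-1 * cu `^ t)); last first.
    by rewrite exprMn; move: (_ ^+ Q) (_ ^+ Q) (cu `^ t) => x1 x2 x3; ring.
  (* Each generation wins a factor [2]: the exponents differ by [gap / 2], of which half absorbs
     [2 / rho0]. *)
  have base : 2 <= eps `^ (- t') * s `^ t.
    rewrite sE powRM ?(ltW rho00) ?(ltW eps0)//.
    rewrite mulrCA -powRD; last by apply/implyP => _; rewrite gt_eqF.
    rewrite expo2.
    rewrite powRN ler_pdivlMr ?powR_gt0//.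
    apply: le_trans (_ : rho0 <= _); last first.
      by rewrite -[leLHS]powRr1 ?(ltW rho00)// ger_powR ?rho00// ltW.
    apply: le_trans (_ : 2 * eps `^ (gap / 4) <= _).
      by rewrite ler_pM2l// ger_powR ?eps0.
    rewrite -[leRHS]mul1r -ler_pdivrMr// mulrAC.
    by apply: heB; rewrite eps0.
  have cut : cu <= cu `^ t.
    by rewrite -[leLHS]powRr1 ?(ltW cu0)// ger_powR ?cu0 ?(ltW cu1)// ltW.
  apply: le_trans (_ : (2 / cu) * (2^-1 * cu) <= _).
    by rewrite mulrACA divff// mulVf ?gt_eqF// mulr1.
  apply: ler_pM.
  - by apply: divr_ge0 => //; rewrite ltW.
  - by apply: mulr_ge0; rewrite ?invr_ge0// ltW.
  - by apply: le_trans HQ _; apply: lerXn2r; rewrite ?nnegrE//; apply: le_trans base.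
  - by rewrite ler_pM2l.
have y1 : 1 <= y.
  have r1 : (s ^+ Q * cu) `^ t <= 1.
    apply: le_trans (_ : 1 `^ t <= _); last by rewrite powR1.
    apply: ge0_ler_powR; rewrite ?nnegrE ?ler01//; first exact: (mulr_ge0 (ltW sQ0) (ltW cu0)).
    exact: (mulr_ile1 (ltW sQ0) (ltW cu0) sQ1 (ltW cu1)).
  have y0 : 0 <= y by exact: expR_ge0.
  apply: le_trans key _; apply: le_trans (_ : 2^-1 * y * 1 <= _).
    by apply: ler_wpM2l => //; apply: mulr_ge0.
  by rewrite mulr1 ler_piMl// invf_le1// ler1n.
(* As [y >= 1], truncation loses at most one half, which is the factor [2^-1] in [key]. *)
pose M := Num.truncn y.
have My : M%:R <= y by rewrite truncn_le// (le_trans ler01).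
have yM : 2^-1 * y <= M%:R.
  have M1 : (0 < M)%N by rewrite truncn_gt0.
  have := truncnS_gt y; rewrite -/M => yM.
  by apply: half; rewrite ?natr1 ?ler1n.
exists M, (s ^+ Q * cu), (E * R1), eps; split.
- by rewrite mulr_gt0//= (le_lt_trans _ cu1)// ler_piMl// ltW.
- by rewrite (le_trans RmR1)// ler_peMl// ltW.
- by [].
- by apply: le_trans key _; rewrite ler_wpM2r ?powR_ge0.
move=> w w' Fw Fw' b1 b2 lin.
have Fwu : F (w \o u 0%N) by exact: (monoid_comp FM Fw (Fu 0%N)).
have X0p := sz_gt0 FM Fwu; have wp := sz_gt0 FM Fw; have w'p := sz_gt0 FM' Fw'.
have X0w : sz (w \o u 0%N) <= R1 * sz w'.
  apply: le_trans (sz_comp_le FM Fw (Fu 0%N)) _.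
  apply: le_trans (_ : K * (E * R1 * sz w') * sz (u 0%N) <= _).
    by rewrite ler_pM2r// ler_pM2l.
  rewrite (_ : _ * _ * _ = (sz (u 0%N) * (K * E)) * (R1 * sz w')); last by ring.
  by rewrite ler_piMl// mulr_ge0 ?ltW.
(* By [X0w] the first factor, shortened by [u 0], is at most [R1] times the second, so only the
   second has to be shrunk. *)
have [p [Fp px py]] := shrink_into K1 FM' Fw' Fv0 v0K X0p R11 R1v X0w.
have linp : linear_box H g1 g2 eps w (w' \o p).
  apply: (linear_box_comp (p := id)) lin => // x; exact: (in_unit FM' Fp).
have ush j : (j < J)%N -> forall x y, 0 <= x <= 1 -> 0 <= y <= 1 ->
    exists2 theta, `|theta| <= eps &
      w (u j x) - w (u j y) =
        expR (j%:R * tau + theta) * (w (u 0%N x) - w (u 0%N y)).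
  move=> jJ x x' hx hx'; have [theta th thE] := ushift w j Fw (ltnW jJ) x x' hx hx'.
  by exists theta => //; apply: le_trans th _; rewrite ge_min lexx.
have tpos x : eps <= x <= 1 -> 0 < x by move=> /andP[h _]; exact: lt_le_trans h.
have cnt b i x : eps <= x <= 1 ->
    avg (fun k => (`|@e b k o - @e b i o| <= x)%R%:R) <= Bf * x `^ d.
  move=> xe; have [_ _ h] := he b; have /andP[x1 x2] := xe.
  apply: le_trans (h i x _) _.
    by rewrite x2 andbT; apply: le_trans x1; case: (b).
  by rewrite ler_wpM2r ?powR_ge0//; case: (b); apply: Bfle => //; rewrite ltW.
have cnt' b i x : eps <= x <= 1 ->
    avg (fun k => (`|@e' b k o' - @e' b i o'| <= x)%R%:R) <= Bf * x `^ d'.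
  move=> xe; have [_ _ h] := he' b; have /andP[x1 x2] := xe.
  apply: le_trans (h i x _) _.
    by rewrite x2 andbT; apply: le_trans x1; case: (b).
  by rewrite ler_wpM2r ?powR_ge0//; case: (b); apply: Bfle => //; rewrite ltW.
have mm1 : mm <= 1 by rewrite ge_min lexx.
have mmd : mm <= d + d' by rewrite ge_min lexx orbT.
have [j [l [l1 l2 l3]]] :=
  @macro_tree _ K R1 g1 g2 d d' o o' eps tau F F' H J u w (w' \o p) K1 R11 FM FM'
    g10 g20 ho ho' eps0 eps2 tau0 taueps isT Jtau1 Jtau2 Fu Fw
    (monoid_comp FM' Fw' Fp) ush linp c1 kap Bf mm Bd k Q N N' e e' c101 erefl R1K
    (fun b => let: And3 a _ _ := he b in a) (fun b => let: And3 a _ _ := he' b in a)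
    (fun b i => let: And3 _ a _ := he b in proj1 (a i))
    (fun b i => let: And3 _ a _ := he' b in proj1 (a i))
    (fun b i => let: And3 _ a _ := he b in proj2 (a i))
    (fun b i => let: And3 _ a _ := he' b in proj2 (a i))
    cnt cnt' isT Bf0 mm1 mmd Bd0 HBd px py.
pose z0 : (R -> R) * (R -> R) := (id, id).
have Ml : (M <= size l)%N by rewrite -(ler_nat R); apply: le_trans My l1.
pose z (i : 'I_M) := nth z0 l i.
have zl (i : 'I_M) : (i < size l)%N by apply: leq_trans (ltn_ord i) Ml.
exists (fun i => u j \o (z i).1), (fun i => p \o (z i).2); split.
  move=> i; have := all_nthP z0 l2 i (zl i) => /asboolP [Fz Fz' [xy yx] xs _].
  rewrite subn0 -/s in xs; rewrite -/(z i) in Fz Fz' xy yx xs.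
  set Xz := sz (w \o u 0%N \o (z i).1) in xy yx xs.
  have [theta th thE] := ush j (ltn_ord j) _ _ (in_unit FM Fz unit1) (in_unit FM Fz unit0).
  have [q1 _ q2] := shift_le eps2 tau0 Jtau2 (ltn_ord j) th.
  have szE : sz (w \o (u j \o (z i).1)) = expR (j%:R * tau + theta) * Xz.
    by rewrite /sz /= thE normrM gtr0_norm ?expR_gt0.
  have Xz0 : 0 <= Xz by exact: normr_ge0.
  split; rewrite ?szE.
  - exact: (monoid_comp FM (Fu j) Fz).
  - exact: (monoid_comp FM' Fp Fz').
  - apply: le_trans (_ : E^-1 * Xz <= _); last by rewrite ler_wpM2r.
    have -> : s ^+ Q * cu * sz w = E^-1 * (eps * (s ^+ Q * (K^-1 * sz w * sz (u 0%N)))).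
      by rewrite /cu; ring.
    rewrite ler_pM2l//; apply: le_trans xs.
    apply: le_trans (_ : s ^+ Q * (K^-1 * sz w * sz (u 0%N)) <= _).
      by rewrite ler_piMl// mulr_ge0 ?(ltW sQ0)// mulr_ge0 ?(ltW u0p)// mulr_ge0 ?(ltW Ki0) ?(ltW wp).
    by rewrite ler_pM2l//; exact: (sz_comp_ge FM Fw (Fu 0%N)).
  - rewrite -mulrA; apply: ler_pM; rewrite ?expR_ge0//.
  - apply: le_trans yx _.
    have -> : E * R1 * (expR (j%:R * tau + theta) * Xz) =
      (E * expR (j%:R * tau + theta)) * (R1 * Xz) by ring.
    rewrite ler_peMl ?mulr_ge0 ?(ltW R10)//.
    by rewrite -ler_pdivrMl// mulr1.
have sepij (i k0 : 'I_M) : (i < k0)%N -> forall x y0 x' y', 0 <= x <= 1 ->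
    0 <= y0 <= 1 -> 0 <= x' <= 1 -> 0 <= y' <= 1 ->
    s ^+ Q * cu * sz w <= `|H (w ((u j \o (z i).1) x)) (w' ((p \o (z i).2) y0)) -
       H (w ((u j \o (z k0).1) x')) (w' ((p \o (z k0).2) y'))|.
  move=> ik x y0 x' y' hx hy hx' hy'.
  have /asboolP sep := pairwiseP z0 l3 i k0 (zl i) (zl k0) ik.
  apply: le_trans (sep x y0 x' y' hx hy hx' hy').
  rewrite -/s; have -> : s ^+ Q * cu * sz w = E^-1 * (eps * (s ^+ Q * (K^-1 * sz w * sz (u 0%N)))).
    by rewrite /cu; ring.
  apply: le_trans (_ : eps * (s ^+ Q * (K^-1 * sz w * sz (u 0%N))) <= _).
    rewrite ler_piMl// mulr_ge0 ?(ltW eps0)// mulr_ge0 ?(ltW sQ0)// mulr_ge0 ?(ltW u0p)//.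
    by rewrite mulr_ge0 ?(ltW Ki0) ?(ltW wp).
  by rewrite ler_pM2l// ler_pM2l//; exact: (sz_comp_ge FM Fw (Fu 0%N)).
move=> i k0; rewrite neq_ltn => /orP[ik|ki] x y0 x' y' hx hy hx' hy'.
  exact: sepij.
by rewrite distrC; apply: sepij.
Qed.
End MacroStep.

(** * Counting and Hausdorff dimension *)

Section Hausdorff.
Context {R : realType} {T : pseudoMetricType R}.
Implicit Types (E U : set T).

Definition small_in (r : R) U : Prop := forall x y, U x -> U y -> ball x r y.

Lemma diam_ge0 U : (0 <= diam U)%E.
Proof. by apply: le_ereal_inf_tmp => _ [e [e0 _] <-]; rewrite lee_fin ltW. Qed.

Lemma diam_le U r : 0 < r -> small_in r U -> (diam U <= r%:E)%E.
Proof. by move=> r0 Ur; apply: ereal_inf_lbound; exists r. Qed.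

Lemma gauge_ge0 s U : (0 <= hausdorff_gauge s U)%E.
Proof. by rewrite /hausdorff_gauge; case: ifP => // _; exact: poweR_ge0. Qed.

Lemma gauge_le s U r : 0 <= s -> 0 < r -> small_in r U ->
  (hausdorff_gauge s U <= (r `^ s)%:E)%E.
Proof.
move=> s0 r0 Ur; rewrite /hausdorff_gauge; case: ifP => _; first by rewrite lee_fin powR_ge0.
rewrite -poweR_EFin; apply: gt0_ler_poweR => //.
- by rewrite in_itv/= diam_ge0 leey.
- by rewrite in_itv/= lee_fin ltW//= leey.
- exact: diam_le.
Qed.

Lemma premeasure_ge0 s delta E : (0 <= hausdorff_premeasure s delta E)%E.
Proof.
apply: le_ereal_inf_tmp => _ [U _ <-]; apply: nneseries_ge0 => n _ _.
exact: gauge_ge0.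
Qed.

Lemma premeasure_le_count s delta E (n : nat) (U : nat -> set T) (r : R) :
  0 <= s -> 0 < r <= delta -> E `<=` \bigcup_(i in `I_n) U i ->
  (forall i, small_in r (U i)) ->
  (hausdorff_premeasure s delta E <= (n%:R * r `^ s)%:E)%E.
Proof.
move=> s0 /andP[r0 rd] EU Ur.
pose V i := if (i < n)%N then U i else set0.
apply: le_trans (_ : \sum_(0 <= i <oo) hausdorff_gauge s (V i) <= _)%E.
  apply: ereal_inf_lbound; exists V => //; split.
    move=> x /EU [i /= ilt Ux]; exists i => //; rewrite /V ilt//.
  move=> i; apply: le_trans (_ : r%:E <= _)%E; last by rewrite lee_fin.
  by apply: diam_le => // x y; rewrite /V; case: ifP => // _; exact: Ur.
rewrite (nneseries_split 0 n); last by move=> k _; exact: gauge_ge0.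
rewrite add0n [X in (_ + X)%E]eseries0; last first.
  by move=> i ni _; rewrite /V ltnNge ni/= /hausdorff_gauge; case: asboolP.
rewrite adde0; apply: le_trans (_ : \sum_(0 <= i < n) (r `^ s)%:E <= _)%E.
  apply: lee_sum => i _; apply: gauge_le => // x y.
  by rewrite /V; case: ifP => // _; exact: Ur.
by rewrite sumEFin big_const_nat subn0 iter_addr addr0 mulr_natl.
Qed.

Lemma HD_ge0 E : (0 <= HD E)%E.
Proof. by apply: le_ereal_inf_tmp => _ [e [e0 _] <-]; rewrite lee_fin. Qed.

(** At the exponent [s + a] these covers have a sum of order [e ^ a], which tends to [0]. *)
Lemma HD_le_count E (s A C : R) : 0 <= s -> 0 <= A -> 0 < C ->
  (forall e, 0 < e <= 1 -> exists (n : nat) (U : nat -> set T),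
    [/\ n%:R <= A * e `^ (- s), E `<=` \bigcup_(i in `I_n) U i &
        forall i, small_in (C * e) (U i)]) ->
  (HD E <= s%:E)%E.
Proof.
move=> s0 A0 C0 cov; apply/lee_addgt0Pr => a a0.
apply: ereal_inf_lbound; exists (s + a); last by rewrite EFinD.
have sa0 : 0 <= s + a by rewrite addr_ge0// ltW.
split=> //; apply/eqP; rewrite eq_le; apply/andP; split; last first.
  apply: le_trans (premeasure_ge0 (s + a) 1 E) _.
  by apply: ereal_sup_ubound; exists 1 => //=.
apply: ge_ereal_sup => _ [delta /= delta0 <-].
apply/lee_addgt0Pr => z z0; rewrite add0e.
have [e1 e10 he1] := powR_small (A * C `^ (s + a) / z) a0.
pose e := Num.min (Num.min (e1 / 2) (delta / C)) 1.
have e0 : 0 < e by rewrite !lt_min !divr_gt0//= ltr01.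
have ee1 : e < e1.
  by rewrite !gt_min (_ : e1 / 2 < e1) ?orTb// ltr_pdivrMr// ltr_pMr// ltr1n.
have eC : C * e <= delta.
  by rewrite mulrC -ler_pdivlMr// !ge_min lexx !orbT.
have [] := cov e; first by rewrite e0 ge_min lexx orbT.
move=> n [U [nA EU Ue]].
apply: le_trans (premeasure_le_count sa0 _ EU Ue) _; first by rewrite mulr_gt0.
rewrite lee_fin powRM ?(ltW C0) ?(ltW e0)//.
apply: le_trans (_ : A * e `^ (- s) * (C `^ (s + a) * e `^ (s + a)) <= _).
  by rewrite ler_wpM2r// mulr_ge0 ?powR_ge0.
rewrite mulrACA -powRD; last by apply/implyP => _; rewrite gt_eqF.
rewrite addrA addNr add0r -[leRHS]mul1r -ler_pdivrMr//.
rewrite [leLHS]mulrAC; by apply: he1; rewrite e0.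
Qed.

Lemma HD_gt_count E (s : R) : 0 <= s -> (s%:E < HD E)%E ->
  exists c delta : R, [/\ 0 < c, 0 < delta & forall (n : nat) (U : nat -> set T) r,
    0 < r <= delta -> E `<=` \bigcup_(i in `I_n) U i ->
    (forall i, small_in r (U i)) -> c <= n%:R * r `^ s].
Proof.
move=> s0 sE.
have [delta delta0 pd] : exists2 delta, 0 < delta & (0 < hausdorff_premeasure s delta E)%E.
  apply: contrapT => /forall2NP h.
  suff : (HD E <= s%:E)%E by rewrite leNgt sE.
  apply: ereal_inf_lbound; exists s => //; split=> //; apply/eqP.
  rewrite eq_le; apply/andP; split.
    apply: ge_ereal_sup => _ [delta /= delta0 <-].
    by case: (h delta) => [/(_ delta0)//|/negP]; rewrite -leNgt.
  apply: le_trans (premeasure_ge0 s 1 E) _.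
  by apply: ereal_sup_ubound; exists 1 => //=.
have [c c0 cp] : exists2 c : R, 0 < c & (c%:E <= hausdorff_premeasure s delta E)%E.
  case: (hausdorff_premeasure s delta E) pd => [c||] //=.
    by rewrite lte_fin => c0; exists c.
  by move=> _; exists 1 => //; exact: leey.
exists c, delta; split=> // n U r rd EU Ur.
by rewrite -lee_fin; apply: le_trans cp _; apply: (premeasure_le_count (U := U)) => //.
Qed.

Lemma sum_half (N : nat) : \sum_(i < N) 2^-1 ^+ i.+1 = 1 - 2^-1 ^+ N :> R.
Proof.
elim: N => [|N IH]; first by rewrite big_ord0 expr0 subrr.
by rewrite big_ord_recr/= IH exprS; field.
Qed.

(** Positive radii replace diameters. Other sets receive twice their diameter, an infimum that need
    not be attained; empty sets and sets of diameter [0] receive [sm i], whose powers have a small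
    sum. *)
Lemma HD_lt_cover E (s delta eta : R) : (HD E < s%:E)%E -> 0 < delta -> 0 < eta ->
  exists (U : nat -> set T) (rad : nat -> R), [/\ E `<=` \bigcup_i U i,
    forall i, 0 < rad i <= delta, forall i, small_in (rad i) (U i) &
    forall N, \sum_(i < N) rad i `^ s <= eta].
Proof.
move=> Es delta0 eta0.
have [_ [s0 [s00 Hs0] <-]] := ereal_inf_lt Es; rewrite lte_fin => s0s.
have sp : 0 < s by exact: le_lt_trans s0s.
pose dl := Num.min 1 (delta / 2).
have dl0 : 0 < dl by rewrite lt_min ltr01 divr_gt0.
pose eta' := eta / 2 / 2 `^ s.
have eta'0 : 0 < eta' by rewrite !divr_gt0// powR_gt0.
have : (hausdorff_premeasure s0 dl E < eta'%:E)%E.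
  apply: le_lt_trans (_ : 0 < _)%E; last by rewrite lte_fin.
  by rewrite -Hs0; apply: ereal_sup_ubound; exists dl.
move=> /ereal_inf_lt[_ [U [EU Ud] <-]] sumU.
pose D i := fine (diam (U i)).
have DE i : diam (U i) = (D i)%:E.
  rewrite /D fineK// ge0_fin_numE ?diam_ge0//.
  exact: le_lt_trans (Ud i) (ltey _).
have D0 i : 0 <= D i by rewrite -lee_fin -DE diam_ge0.
have Dd i : D i <= dl by rewrite -lee_fin -DE Ud.
pose sm i := Num.min delta ((eta / 2 * 2^-1 ^+ i.+1) `^ s^-1).
have smp i : 0 < eta / 2 * 2^-1 ^+ i.+1 by rewrite mulr_gt0 ?divr_gt0 ?exprn_gt0 ?invr_gt0.
have sm0 i : 0 < sm i by rewrite lt_min delta0 powR_gt0.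
have sms i : sm i `^ s <= eta / 2 * 2^-1 ^+ i.+1.
  apply: le_trans (_ : ((eta / 2 * 2^-1 ^+ i.+1) `^ s^-1) `^ s <= _).
    apply: ge0_ler_powR; rewrite ?nnegrE ?powR_ge0 ?(ltW sp) ?(ltW (sm0 i))//.
    by rewrite ge_min lexx orbT.
  by rewrite -powRrM mulVf ?gt_eqF// powRr1// ltW.
pose rad i := if `[< U i = set0 >] then sm i else Num.max (2 * D i) (sm i).
exists U, rad; split=> //.
- move=> i; have sd : 0 < sm i <= delta by rewrite sm0 ge_min lexx.
  rewrite /rad; case: ifP => // _; have /andP[_ sd'] := sd.
  rewrite lt_max sm0 orbT ge_max sd' andbT/=.
  rewrite mulrC -ler_pdivlMr//; apply: le_trans (Dd i) _.
  by rewrite ge_min lexx orbT.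
- move=> i x y Ux Uy; rewrite /rad; case: asboolP => [U0|_].
    by rewrite U0 in Ux.
  have : (diam (U i) < (Num.max (2 * D i) (sm i))%:E)%E.
    rewrite DE lte_fin lt_max; have [->|Dn0] := eqVneq (D i) 0.
      by rewrite sm0 orbT.
    have Dp : 0 < D i by rewrite lt_neqAle eq_sym Dn0 D0.
    by rewrite ltr_pMl// ltr1n.
  move=> /ereal_inf_lt[_ [e [e0 he] <-]]; rewrite lte_fin => er.
  by apply: le_ball (ltW er) _ _; exact: he.
- move=> N; apply: le_trans (_ : \sum_(i < N) (2 `^ s * fine (hausdorff_gauge s0 (U i))
    + eta / 2 * 2^-1 ^+ i.+1) <= _).
    apply: ler_sum => i _; rewrite /rad /hausdorff_gauge; case: asboolP => U0 /=.
      by rewrite mulr0 add0r.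
    rewrite DE poweR_EFin/= maxEle; case: ifP => _.
      by rewrite (le_trans (sms i))// lerDr mulr_ge0 ?powR_ge0.
    rewrite powRM//; apply: le_trans (_ : 2 `^ s * D i `^ s0 <= _); last first.
      by rewrite lerDl ltW.
    rewrite ler_wpM2l ?powR_ge0//; have [D00|Dn0] := eqVneq (D i) 0.
      by rewrite D00 powR0 ?gt_eqF// powR_ge0.
    rewrite ger_powR ?(ltW s0s)// lt_neqAle eq_sym Dn0 D0/=.
    by apply: le_trans (Dd i) _; rewrite ge_min lexx.
  rewrite big_split/= -!mulr_sumr sum_half.
  have fs : \sum_(i < N) fine (hausdorff_gauge s0 (U i)) <= eta'.
    rewrite -lee_fin -sumEFin; apply: ltW; apply: le_lt_trans sumU.
    rewrite -(big_mkord xpredT (fun i => (fine (hausdorff_gauge s0 (U i)))%:E)).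
    apply: le_trans (nneseries_lim_ge N _); last by move=> n _ _; exact: gauge_ge0.
    apply: lee_sum => i _; rewrite fineK// /hausdorff_gauge; case: ifP => // _.
    by rewrite DE poweR_EFin.
  have h1 : 2 `^ s * \sum_(i < N) fine (hausdorff_gauge s0 (U i)) <= eta / 2.
    by rewrite mulrC -ler_pdivlMr ?powR_gt0.
  have h2 : eta / 2 * (1 - 2^-1 ^+ N) <= eta / 2.
    by rewrite ler_piMr ?divr_ge0 ?(ltW eta0)// lerBlDr lerDl exprn_ge0.
  by rewrite [leRHS]splitr lerD.
Qed.

End Hausdorff.

(** * Dimension of a set carrying a separated tree *)

Section CantorTree.
Context {R : realType}.

(* A family of cylinders of total mass less than 1 does not cover the sequence
   space: the digits are chosen one by one, keeping in the current cylinder a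
   proportion at most [q] of covered mass. *)
Lemma cylinder_escape (M : nat) (om : nat -> nat -> 'I_M) (n : nat -> nat) (q : R) :
  (0 < M)%N -> q < 1 ->
  (forall N, \sum_(i < N) (M%:R^-1) ^+ n i <= q) ->
  exists w : nat -> 'I_M, forall i, exists2 k, (k < n i)%N & w k != om i k.
Proof.
move=> M0 q1 sumq; pose d0 := Ordinal M0.
have Mp : 0 < M%:R :> R by rewrite ltr0n.
have Mn : (M%:R : R) != 0 by rewrite gt_eqF.
pose compat (v : seq 'I_M) i :=
  all (fun k => nth d0 v k == om i k) (iota 0 (minn (size v) (n i))).
(* The uniform measure of the intersection of the cylinder [v] with the [i]-th cylinder of the
   family: one contains the other or they are disjoint. *)
pose mass v i : R := if compat v i then (M%:R^-1) ^+ maxn (size v) (n i) else 0.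
have mass0 v i : 0 <= mass v i.
  by rewrite /mass; case: ifP => // _; rewrite exprn_ge0// invr_ge0.
have massS v i : \sum_a mass (rcons v a) i = mass v i.
  have nthv (m : nat) a : (m <= size v)%N ->
      all (fun k => nth d0 (rcons v a) k == om i k) (iota 0 m) =
      all (fun k => nth d0 v k == om i k) (iota 0 m).
    move=> mv; apply: eq_in_all => k; rewrite mem_iota add0n => /andP[_ km].
    by rewrite nth_rcons (leq_trans km mv).
  have [vn|nv] := ltnP (size v) (n i).
    have cS a : compat (rcons v a) i = compat v i && (a == om i (size v)).
      rewrite /compat size_rcons (minn_idPl vn) (minn_idPl (ltnW vn)).
      rewrite -addn1 iotaD all_cat nthv// add0n /= andbT.
      by rewrite nth_rcons ltnn eqxx.
    rewrite (bigD1 (om i (size v)))//= big1 ?addr0.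
      rewrite /mass cS eqxx andbT size_rcons.
      by rewrite (maxn_idPr vn) (maxn_idPr (ltnW vn)).
    by move=> a /negbTE ane; rewrite /mass cS ane andbF.
  rewrite (eq_bigr (fun=> mass v i / M%:R)); last first.
    move=> a _; rewrite /mass /compat size_rcons.
    rewrite (minn_idPr (leqW nv)) (minn_idPr nv) nthv//.
    rewrite (maxn_idPl (leqW nv)) (maxn_idPl nv).
    by case: ifP; rewrite ?mul0r// exprSr.
  by rewrite sumr_const card_ord -[LHS]mulr_natr mulfVK.
pose good v := forall N, \sum_(i < N) mass v i <= q * (M%:R^-1) ^+ size v.
have /choice[f fP] : forall v, exists a, good v -> good (rcons v a).
  move=> v; have [gv|ngv] := pselect (good v); last by exists d0.
  apply: contrapT => /forallNP h.
  have /choice[Na hNa] a : exists N, q * (M%:R^-1) ^+ (size v).+1 < \sum_(i < N) mass (rcons v a) i.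
    apply: contrapT => /forallNP hN; apply: (h a) => _ N.
    by rewrite size_rcons leNgt; apply/negP/hN.
  pose N := \max_a Na a.
  have : q * (M%:R^-1) ^+ size v < \sum_a \sum_(i < N) mass (rcons v a) i.
    apply: le_lt_trans (_ : \sum_(a : 'I_M) q * (M%:R^-1) ^+ (size v).+1 < _).
      by rewrite sumr_const card_ord exprSr -[leRHS]mulr_natr mulrA mulfVK.
    apply: ltr_sum; first by apply/hasP; exists d0 => //; rewrite mem_index_enum.
    move=> a _; apply: lt_le_trans (hNa a) _.
    have NaN : (Na a <= N)%N by exact: leq_bigmax.
    rewrite -(big_mkord xpredT (mass (rcons v a))) -(big_mkord xpredT (mass (rcons v a))).
    by rewrite (big_cat_nat (leq0n _) NaN)/= lerDl sumr_ge0.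
  rewrite exchange_big/= (eq_bigr (fun i : 'I_N => mass v i)) => [|i _]; last exact: massS.
  by rewrite ltNge gv.
pose vs := fix vs m := if m is m'.+1 then rcons (vs m') (f (vs m')) else [::].
have szvs m : size (vs m) = m by elim: m => //= m IH; rewrite size_rcons IH.
have gvs m : good (vs m).
  elim: m => [|m IH] /=; last exact: fP.
  move=> N; rewrite mulr1; apply: le_trans (sumq N); apply: ler_sum => i _.
  by rewrite /mass /compat /= min0n /= max0n.
have nthvs m k : (k < m)%N -> nth d0 (vs m) k = f (vs k).
  elim: m => // m IH; rewrite ltnS leq_eqVlt nth_rcons szvs => /orP[/eqP ->|km].
    by rewrite ltnn eqxx.
  by rewrite km IH.
exists (fun k => f (vs k)) => i; apply: contrapT => /forall2NP h.
(* After [n i] digits equal to those of [om i] the current cylinder would be wholly covered, against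
   the proportion [q < 1]. *)
have := gvs (n i) i.+1; rewrite big_ord_recr/= szvs.
have -> : mass (vs (n i)) i = (M%:R^-1) ^+ n i.
  rewrite /mass szvs maxnn; case: ifP => // /negbT/negP[].
  rewrite /compat szvs minnn; apply/allP => k; rewrite mem_iota add0n => /andP[_ kn].
  rewrite nthvs//; have [/negP|/negP] := h k; first by rewrite kn.
  by rewrite negbK.
have p0 : 0 < (M%:R^-1 : R) ^+ n i by rewrite exprn_gt0// invr_gt0.
rewrite leNgt => /negP; apply.
apply: lt_le_trans (_ : (M%:R^-1) ^+ n i <= _); first by rewrite gtr_pMl.
by rewrite lerDr sumr_ge0.
Qed.

Lemma expr_small (r e : R) : 0 <= r < 1 -> 0 < e -> exists n, r ^+ n < e.
Proof.
move=> /andP[r0 r1] e0.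
have := @cvg_expr R r; rewrite ger0_norm// => /(_ r1) /cvgrPdist_lt /(_ _ e0).
move=> [n _ h]; exists n; have := h n (leqnn n).
by rewrite /= sub0r normrN ger0_norm// exprn_ge0.
Qed.

(** Mass distribution. Sequences sent into a set of radius [rad i] agree on [n i] digits, where
    [n i] is the first exponent with [c * r ^ n i < rad i]; the uniform mass of such a cylinder is
    at most [(rad i / c) ^ t]. A cover with a small sum of [rad i ^ t] has total mass at most
    [1 / 2], so some sequence escapes it. *)
Lemma HD_ge_tree (E : set R) (M : nat) (psi : (nat -> 'I_M) -> R) (r c t : R) :
  0 < r < 1 -> 0 < c -> 1 <= M%:R * r `^ t -> (forall w, E (psi w)) ->
  (forall w w' n, (forall i, (i < n)%N -> w i = w' i) -> w n != w' n ->
     c * r ^+ n <= `|psi w - psi w'|) ->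
  (t%:E <= HD E)%E.
Proof.
move=> /andP[r0 r1] c0 Mr Epsi sep; rewrite leNgt; apply/negP => Et.
have t0 : 0 < t by rewrite -lte_fin; apply: le_lt_trans Et; exact: HD_ge0.
have M0 : (0 < M)%N.
  by rewrite lt0n; apply: contraTneq Mr => ->; rewrite mul0r -ltNge ltr01.
have eta0 : 0 < c `^ t / 2 by rewrite divr_gt0// powR_gt0.
have [U [rad [EU rad0 Urad sumr]]] := HD_lt_cover Et ltr01 eta0.
have radp i : 0 < rad i by have /andP[] := rad0 i.
have ex i : exists n, c * r ^+ n < rad i.
  have r01 : 0 <= r < 1 by rewrite (ltW r0).
  have [m hm] := expr_small r01 (divr_gt0 (radp i) c0).
  by exists m; rewrite mulrC -ltr_pdivlMr.
pose n i := ex_minn (ex i).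
have nlt i : c * r ^+ n i < rad i by rewrite /n; case: ex_minnP.
have nge i k : (k < n i)%N -> rad i <= c * r ^+ k.
  by rewrite /n; case: ex_minnP => m _ h km; rewrite leNgt; apply/negP => /h; rewrite leqNgt km.
(* [om i] is any sequence sent into [U i]; the constant sequence is a default when there is none. *)
have /choice[om omP] i : exists w, forall w', U i (psi w') -> U i (psi w).
  have [[w Uw]|h] := pselect (exists w, U i (psi w)); first by exists w.
  by exists (fun=> Ordinal M0) => w' Uw'; exfalso; apply: h; exists w'.
have mass i : (M%:R^-1 : R) ^+ n i <= rad i `^ t / c `^ t.
  apply: le_trans (_ : (r `^ t) ^+ n i <= _).
    apply: lerXn2r; rewrite ?nnegrE ?invr_ge0 ?powR_ge0//.
    by rewrite -[leLHS]mul1r ler_pdivrMr ?ltr0n// mulrC.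
  rewrite -powR_expn ?(ltW r0)// ler_pdivlMr ?powR_gt0//.
  rewrite -powRM ?exprn_ge0 ?(ltW c0) ?(ltW r0)//.
  apply: ge0_ler_powR; rewrite ?nnegrE ?mulr_ge0 ?exprn_ge0 ?(ltW t0) ?(ltW r0) ?(ltW c0) ?(ltW (radp i))//.
  by rewrite mulrC ltW.
have q1 : 2^-1 < 1 :> R by rewrite invf_lt1// ltr1n.
have [|w wP] := cylinder_escape om (n := n) (q := 2^-1) M0 q1.
  move=> N; apply: le_trans (_ : \sum_(i < N) (rad i `^ t / c `^ t) <= _).
    by apply: ler_sum => i _.
  rewrite -mulr_suml ler_pdivrMr ?powR_gt0//.
  by rewrite mulrC.
have [i _ Ui] := EU _ (Epsi w).
have Uo := omP i _ Ui.
have exk : exists k, w k != om i k by have [k _ h] := wP i; exists k.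
have [k kn kP] := wP i.
case: (ex_minnP exk) => m hm mmin.
have mn : (m < n i)%N by apply: leq_ltn_trans kn; exact: mmin.
have agree l : (l < m)%N -> w l = om i l.
  by move=> lm; apply/eqP; apply: contraTT lm => /mmin; rewrite -leqNgt.
have := sep _ _ _ agree hm; have := Urad i _ _ Ui Uo.
rewrite -ball_normE /= => h1 h2.
by have := lt_le_trans (le_lt_trans h2 h1) (nge _ _ mn); rewrite ltxx.
Qed.

End CantorTree.

(** * Iteration of the step *)

Section LowerBound.
Context {R : realType}.

(** Nothing is known of [f] outside [[0, 1]]; composing with the clamp [cl] gives a map continuous
    on the whole line with the same image of [S]. *)
Lemma lipschitz_compact_image (S : set R) (f : R -> R) (L : R) :
  (forall x, S x -> 0 <= x <= 1) -> compact S ->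
  (forall x y, 0 <= x <= 1 -> 0 <= y <= 1 -> `|f x - f y| <= L * `|x - y|) ->
  compact (f @` S).
Proof.
move=> S01 cS fL; pose cl (x : R) := Num.max 0 (Num.min 1 x).
have cl01 (x : R) : 0 <= cl x <= 1 by rewrite le_max lexx/= ge_max ler01 ge_min lexx.
have clE (x : R) : 0 <= x <= 1 -> cl x = x.
  by move=> /andP[h1 h2]; rewrite /cl (min_idPr h2) (max_idPr h1).
have clv (x : R) : [\/ x <= 0 /\ cl x = 0, 0 <= x <= 1 /\ cl x = x | 1 <= x /\ cl x = 1].
  have [x0|x0] := leP x 0.
    constructor 1; split=> //; rewrite /cl (min_idPr _); last by rewrite (le_trans x0).
    by rewrite (max_idPl x0).
  have [x1|x1] := leP x 1; last first.
    constructor 3; split; first exact: ltW.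
    by rewrite /cl (min_idPl (ltW x1)) (max_idPr ler01).
  have x01 : 0 <= x <= 1 by rewrite (ltW x0) x1.
  by constructor 2; split; [rewrite (ltW x0)|exact: clE].
have clL (x y : R) : `|cl x - cl y| <= `|x - y|.
  rewrite ler_norml; have := ler_norm (x - y); have := ler_norm (y - x).
  rewrite distrC => h1 h2; case: (clv x) => -[ax ->]; case: (clv y) => -[ay ->]; lra.
have -> : f @` S = (f \o cl) @` S.
  apply/seteqP; split=> _ [x Sx <-]; exists x => //=; rewrite clE//; exact: S01.
apply: continuous_compact => //; apply: continuous_subspaceT => x.
apply/cvgrPdist_lt => e e0; near=> y.
apply: le_lt_trans (fL _ _ (cl01 x) (cl01 y)) _.
apply: le_lt_trans (_ : (`|L| + 1) * `|x - y| < _).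
  apply: le_trans (_ : (`|L| + 1) * `|cl x - cl y| <= _).
    by rewrite ler_wpM2r// (le_trans (ler_norm _))// lerDl.
  by rewrite ler_wpM2l ?addr_ge0.
have L0 : 0 < `|L| + 1 by rewrite ltr_wpDl.
rewrite mulrC -ltr_pdivlMr//; near: y; exists (e / (`|L| + 1)) => /=.
  by rewrite divr_gt0.
by move=> y.
Unshelve. all: by end_near. Qed.

Lemma nested_compact_point (S : set R) (o : R) (W : nat -> R -> R) :
  S o -> (forall n, compact (W n @` S)) ->
  (forall n m, (n <= m)%N -> (W n @` S) (W m o)) ->
  exists p, forall n, (W n @` S) p.
Proof.
move=> So cW nest.
have [p [_ clp]] : (W 0%N @` S) `&` cluster ((fun m => W m o) @ \oo) !=set0.
  apply: cW; exists 0%N => // m _; exact: nest.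
exists p => n; have clo : closed (W n @` S).
  by apply: compact_closed (cW n); exact: Rhausdorff.
apply: clo => B Bp; apply: clp => //.
by exists n => // m nm; exact: nest.
Qed.

(** The longer of the two cylinders is shrunk to the size of the other. *)
Lemma balanced_start (K c1 d d' o o' : R) (F F' : (R -> R) -> Prop) :
  1 <= K -> quasi_affine_monoid K F -> quasi_affine_monoid K F' ->
  has_families F o d c1 -> has_families F' o' d' c1 ->
  exists2 Rm : R, 1 <= Rm & forall w w', F w -> F' w' ->
    exists p p', [/\ F p, F' p', sz (w \o p) <= Rm * sz (w' \o p') &
      sz (w' \o p') <= Rm * sz (w \o p)].
Proof.
move=> K1 FM FM' fam fam'; have K0 : 0 < K by exact: lt_le_trans K1.
have [v [Fv vK]] := small_map K0 fam; have [v' [Fv' vK']] := small_map K0 fam'.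
have v0 := sz_gt0 FM Fv; have v0' := sz_gt0 FM' Fv'.
have a0 : 0 <= K / sz v by rewrite divr_ge0 ?ltW.
have a0' : 0 <= K / sz v' by rewrite divr_ge0 ?ltW.
exists (1 + (K / sz v + K / sz v')); first by rewrite lerDl addr_ge0.
set Rm := _ + _ => w w' Fw Fw'.
have Rm1 : 1 <= Rm by rewrite lerDl addr_ge0.
have RK : K <= Rm * sz v by rewrite -ler_pdivrMr// /Rm; lra.
have RK' : K <= Rm * sz v' by rewrite -ler_pdivrMr// /Rm; lra.
have Fi : F id by case: FM. have Fi' : F' id by case: FM'.
have w0 := sz_gt0 FM Fw; have w0' := sz_gt0 FM' Fw'.
have [ww|/ltW ww] := leP (sz w) (sz w').
  have ww' : sz w <= Rm * sz w' by rewrite (le_trans ww)// ler_peMl// ltW.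
  have [p' [Fp' h1 h2]] := shrink_into K1 FM' Fw' Fv' vK' w0 Rm1 RK' ww'.
  by exists id, p'.
have ww' : sz w' <= Rm * sz w by rewrite (le_trans ww)// ler_peMl// ltW.
have [p [Fp h1 h2]] := shrink_into K1 FM Fw Fv vK w0' Rm1 RK ww'.
by exists p, id.
Qed.

(** A sequence of digits selects nested pairs of cylinders, and compactness gives a point of [S] and
    one of [S'] in all of them. A starting box is required for every tolerance, because [macro_step]
    dictates [eta]. *)
Lemma HD_ge_macro (K c1 d d' o o' g1 g2 t : R) (F F' : (R -> R) -> Prop)
    (H : R -> R -> R) (S S' E : set R) :
  1 <= K -> 0 < c1 <= 1 ->
  quasi_affine_monoid K F -> quasi_affine_monoid K F' ->
  has_families F o d c1 -> has_families F' o' d' c1 -> has_shifts F ->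
  compact S -> compact S' ->
  (forall x, S x -> 0 <= x <= 1) -> (forall x, S' x -> 0 <= x <= 1) ->
  S o -> S' o' ->
  (forall f x, F f -> S x -> S (f x)) -> (forall f x, F' f -> S' x -> S' (f x)) ->
  g1 != 0 -> g2 != 0 -> 0 <= t -> t < 1 -> t < d + d' ->
  (forall eta, 0 < eta -> exists w w', [/\ F w, F' w' & linear_box H g1 g2 eta w w']) ->
  (forall x y, S x -> S' y -> E (H x y)) ->
  (t%:E <= HD E)%E.
Proof.
move=> K1 c101 FM FM' fam fam' shift cS cS' S01 S01' So So' FS FS' g10 g20 t0 t1 td start HE.
have [Rm Rm1 bal] := balanced_start K1 FM FM' fam fam'.
have [M [r [Rb [eta [r01 RmRb eta0 Mr step]]]]] :=
  macro_step H K1 c101 (le_trans ler01 Rm1) FM FM' (S01 _ So) (S01' _ So')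
    fam fam' shift g10 g20 t0 t1 td.
have /andP[r0 r1] := r01.
have [w [w' [Fw Fw' lin]]] := start _ eta0.
have [p [p' [Fp Fp' bp bp']]] := bal _ _ Fw Fw'.
pose valid (x : (R -> R) * (R -> R)) := [/\ F x.1, F' x.2, sz x.1 <= Rb * sz x.2,
  sz x.2 <= Rb * sz x.1 & linear_box H g1 g2 eta x.1 x.2].
have valid0 : valid (w \o p, w' \o p').
  split=> /=.
  - exact: (monoid_comp FM).
  - exact: (monoid_comp FM').
  - by apply: le_trans bp _; rewrite ler_wpM2r ?normr_ge0.
  - by apply: le_trans bp' _; rewrite ler_wpM2r ?normr_ge0.
  - by apply: linear_box_comp lin => x; [exact: (in_unit FM)|exact: (in_unit FM')].
pose good (x : (R -> R) * (R -> R)) (v v' : 'I_M -> R -> R) : Prop :=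
  (forall i : 'I_M, [/\ F (v i), F' (v' i), r * sz x.1 <= sz (x.1 \o v i),
     sz (x.1 \o v i) <= Rb * sz (x.2 \o v' i) &
     sz (x.2 \o v' i) <= Rb * sz (x.1 \o v i)]) /\
  (forall i k : 'I_M, i != k -> forall a b a' b', 0 <= a <= 1 -> 0 <= b <= 1 ->
     0 <= a' <= 1 -> 0 <= b' <= 1 -> r * sz x.1 <=
       `|H (x.1 (v i a)) (x.2 (v' i b)) - H (x.1 (v k a')) (x.2 (v' k b'))|).
have /choice[ch chP] (x : (R -> R) * (R -> R)) :
    exists vv : (('I_M -> R -> R) * ('I_M -> R -> R))%type, valid x -> good x vv.1 vv.2.
  have [[h1 h2 h3 h4 h5]|nv] := pselect (valid x); last by exists (fun _ => id, fun _ => id).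
  by have [v [v' hv]] := step _ _ h1 h2 h3 h4 h5; exists (v, v').
pose node (om : nat -> 'I_M) := fix node (n : nat) : ((R -> R) * (R -> R))%type :=
  if n is m.+1 then ((node m).1 \o (ch (node m)).1 (om m), (node m).2 \o (ch (node m)).2 (om m))
  else (w \o p, w' \o p').
have nodeP om n : valid (node om n).
  elim: n => [|n IH] //=; have [hv _] := chP _ IH; have [h1 h2 h3 h4 h5] := hv (om n).
  have [F1 F2 _ _ l] := IH.
  split=> //=; [exact: (monoid_comp FM)|exact: (monoid_comp FM')|].
  by apply: linear_box_comp l => x; [exact: (in_unit FM)|exact: (in_unit FM')].
have node_ext om n m : (n <= m)%N -> exists q q', [/\ F q, F' q',
    (node om m).1 = (node om n).1 \o q & (node om m).2 = (node om n).2 \o q'].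
  elim: m => [|m IH].
    rewrite leqn0 => /eqP ->; exists id, id; split=> //; first by case: FM.
    by case: FM'.
  rewrite leq_eqVlt => /orP[/eqP ->|/IH[q [q' [Fq Fq' e1 e2]]]].
    by exists id, id; split=> //; [case: FM|case: FM'].
  have [hv _] := chP _ (nodeP om m); have [h1 h2 _ _ _] := hv (om m).
  exists (q \o (ch (node om m)).1 (om m)), (q' \o (ch (node om m)).2 (om m)); split=> /=.
  - exact: (monoid_comp FM).
  - exact: (monoid_comp FM').
  - by rewrite {1}e1.
  - by rewrite {1}e2.
have sizeP om n : r ^+ n * sz (w \o p) <= sz (node om n).1.
  elim: n => [|n IH]; first by rewrite expr0 mul1r.
  have [hv _] := chP _ (nodeP om n); have [_ _ h _ _] := hv (om n).
  by apply: le_trans h; rewrite exprS -mulrA ler_pM2l.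
have /choice[x xP] om : exists x, forall n, ((node om n).1 @` S) x.
  apply: (nested_compact_point So (W := fun n => (node om n).1)) => [n|n m nm].
    have [F1 _ _ _ _] := nodeP om n.
    by apply: (lipschitz_compact_image (L := K * sz (node om n).1)) => // a b; exact: (dist_le FM).
  by have [q [_ [Fq _ -> _]]] := node_ext om _ _ nm; exists (q o) => //; exact: FS.
have /choice[y yP] om : exists x, forall n, ((node om n).2 @` S') x.
  apply: (nested_compact_point So' (W := fun n => (node om n).2)) => [n|n m nm].
    have [_ F1 _ _ _] := nodeP om n.
    by apply: (lipschitz_compact_image (L := K * sz (node om n).2)) => // a b; exact: (dist_le FM').
  by have [_ [q [_ Fq _ ->]]] := node_ext om _ _ nm; exists (q o') => //; exact: FS'.
(* A first difference at digit [n] opens a gap [r] times the length of the node at level [n], itself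
   at least [r ^ n] times the length of the root. *)
apply: (HD_ge_tree (psi := fun om => H (x om) (y om)) (r := r) (c := r * sz (w \o p))) Mr _ _ => //.
- by rewrite mulr_gt0// (sz_gt0 FM)//; exact: (monoid_comp FM).
- move=> om; have [F1 F2 _ _ _] := valid0.
  have [a Sa <-] := xP om 0%N; have [b Sb <-] := yP om 0%N.
  by apply: HE; [exact: FS|exact: FS'].
move=> om om' n agree neq.
have eqn m : (m <= n)%N -> node om m = node om' m.
  by elim: m => //= m IH mn; rewrite IH ?(ltnW mn)// agree.
have [a Sa ax] := xP om n.+1; have [b Sb bx] := yP om n.+1.
have [a' Sa' ax'] := xP om' n.+1; have [b' Sb' bx'] := yP om' n.+1.
have [_ sep] := chP _ (nodeP om n).
have h := sep _ _ neq a b a' b' (S01 _ Sa) (S01' _ Sb) (S01 _ Sa') (S01' _ Sb').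
rewrite -ax -bx -ax' -bx' /= -(eqn n (leqnn n)).
apply: le_trans h; rewrite -mulrA ler_pM2l// mulrC; exact: sizeP.
Qed.

End LowerBound.

(** * Inverse branches *)

Section RelativeDerivative.
Context {R : realType}.
Implicit Types (D : set R) (f : R -> R).

Lemma derivable_in_dist D f x : derivable_in D f x ->
  forall e, 0 < e -> exists2 delta, 0 < delta & forall y, D y -> y != x ->
    `|y - x| < delta -> `|(f y - f x) / (y - x) - derive_in D f x| < e.
Proof.
move=> df e e0; have /cvgrPdist_lt /(_ _ e0) := df.
rewrite near_withinE => /nbhs_ballP[delta /= delta0 h].
exists delta => // y Dy yx ylt; rewrite distrC; apply: h => //.
by rewrite -ball_normE /= distrC.
Qed.

Lemma derive_in_eq D f x (L : R) :
  (forall e, 0 < e -> exists2 delta, 0 < delta & forall y, D y -> y != x ->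
    `|y - x| < delta -> `|(f y - f x) / (y - x) - L| < e) ->
  (forall delta, 0 < delta -> exists y, [/\ D y, y != x & `|y - x| < delta]) ->
  derive_in D f x = L.
Proof.
move=> h lp; have PF : ProperFilter (within D x^').
  apply: Build_ProperFilter_ex => P /nbhs_ballP[delta /= d0 hP].
  have [y [Dy yx ylt]] := lp _ d0; exists y; apply: hP => //.
  by rewrite -ball_normE /= distrC.
apply: cvg_lim; first exact: Rhausdorff.
apply/cvgrPdist_lt => e e0; rewrite near_withinE; apply/nbhs_ballP.
have [delta d0 hd] := h _ e0; exists delta => //= y.
by rewrite -ball_normE /= distrC => yd yx Dy; rewrite distrC; exact: hd.
Qed.

Lemma continuous_withinP D f :
  (forall x e, D x -> 0 < e -> exists2 delta, 0 < delta &
    forall y, D y -> `|y - x| < delta -> `|f y - f x| < e) ->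
  {within D, continuous f}.
Proof.
move=> h; apply/subspace_continuousP => x Dx; apply/cvgrPdist_lt => e e0.
rewrite near_withinE; apply/nbhs_ballP.
have [delta d0 hd] := h _ _ Dx e0; exists delta => //= y.
by rewrite -ball_normE /= distrC => yd Dy; rewrite distrC; exact: hd.
Qed.

Lemma derivable_in_continuous D f :
  (forall x, D x -> derivable_in D f x) -> {within D, continuous f}.
Proof.
move=> df; apply: continuous_withinP => x e Dx e0.
have [delta d0 hd] := derivable_in_dist (df _ Dx) ltr01.
pose L := `|derive_in D f x| + 1; have L0 : 0 < L by rewrite ltr_wpDl.
exists (Num.min delta (e / L)); first by rewrite lt_min d0 divr_gt0.
move=> y Dy; rewrite lt_min => /andP[yd ye].
have [->|yx] := eqVneq y x; first by rewrite subrr normr0.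
have hq := hd _ Dy yx yd; have yx0 : 0 < `|y - x| by rewrite normr_gt0 subr_eq0.
have -> : f y - f x = (f y - f x) / (y - x) * (y - x) by rewrite divfK// subr_eq0.
move: ((f y - f x) / (y - x)) hq => q hq; rewrite normrM.
have qL : `|q| <= L.
  have h := ler_normD (q - derive_in D f x) (derive_in D f x).
  rewrite subrK in h; apply: le_trans h _.
  by rewrite /L [leLHS]addrC lerD2l; exact: ltW.
apply: le_lt_trans (_ : L * `|y - x| < _); first by rewrite ler_wpM2r.
by rewrite mulrC -ltr_pdivlMr.
Qed.

Lemma derive_in_MVT (a b : R) f (x y : R) :
  (forall z, z \in `[a, b] -> derivable_in `[a, b] f z) ->
  a <= x -> x < y -> y <= b -> exists2 c, x <= c <= y &
    f y - f x = derive_in `[a, b] f c * (y - x).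
Proof.
move=> df ax xy yb; pose D : set R := `[a, b]%classic.
have sub z : z \in `[x, y] -> z \in `[a, b].
  rewrite !in_itv /= => /andP[h1 h2].
  by rewrite (le_trans ax h1) (le_trans h2 yb).
have [||c cxy ->] := @MVT R f (derive_in D f) x y xy.
- move=> z zxy; have zab : z \in `]a, b[.
    move: zxy; rewrite !in_itv /= => /andP[h1 h2].
    by rewrite (le_lt_trans ax h1) (lt_le_trans h2 yb).
  have zD : z \in `[a, b] by apply: subset_itv_oo_cc.
  have cv : (fun h => h^-1 *: ((f \o shift z) (h *: 1) - f z)) @ 0^' --> derive_in D f z.
    apply/cvgrPdist_lt => e e0; have [delta d0 hd] := derivable_in_dist (df _ zD) e0.
    have [d1 d10 hd1] : exists2 d1, 0 < d1 & forall h, `|h| < d1 -> D (z + h).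
      exists (Num.min (z - a) (b - z)).
        by move: zab; rewrite in_itv/= => /andP[h1 h2]; rewrite lt_min !subr_gt0 h1.
      move=> h; rewrite lt_min !ltr_norml => /andP[/andP[h1 _] /andP[_ h2]].
      by rewrite /D /= in_itv /=; apply/andP; split; lra.
    apply/nbhs_ballP; exists (Num.min delta d1); first by rewrite /= lt_min d0.
    move=> h; rewrite -ball_normE /= sub0r normrN lt_min => /andP[hlt1 hlt2] h0.
    rewrite distrC /= scaler1 /= -[_ *: _]/(_ * _) mulrC.
    have := hd (z + h) (hd1 _ hlt2); rewrite [z + h - z]addrC addKr [z + h]addrC.
    by apply => //; rewrite -subr_eq0 addrK.
  by apply: DeriveDef; [apply/cvg_ex; eexists; exact: cv|apply: cvg_lim => //; exact: cv].
- have cD := derivable_in_continuous (df : forall x, D x -> derivable_in D f x).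
  by apply: continuous_subspaceW cD => z /sub.
by exists c => //; move: cxy; rewrite in_itv /= => /andP[h1 h2]; rewrite !ltW.
Qed.

Lemma MVT_dist (a b : R) f (x y : R) :
  (forall z, z \in `[a, b] -> derivable_in `[a, b] f z) ->
  x \in `[a, b] -> y \in `[a, b] -> exists2 c, Num.min x y <= c <= Num.max x y &
    f y - f x = derive_in `[a, b] f c * (y - x).
Proof.
move=> df; rewrite !in_itv /= => /andP[ax xb] /andP[ay yb].
have [xy|yx|->] := ltgtP x y.
- by have [c hc e] := derive_in_MVT df ax xy yb; exists c.
- have [c hc e] := derive_in_MVT df ay yx xb; exists c => //.
  by rewrite -opprB e; ring.
- by exists y; rewrite ?lexx// !subrr mulr0.
Qed.

(** For [r < 2] the exponent is [r - 1], by definition of the class; from [2] on, the second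
    derivative is bounded on the compact interval and the exponent is [1]. It depends on [r] alone,
    hence is common to all branches. *)
Lemma Cr_on_holder (r : \bar R) : (1 < r)%E -> exists2 e0 : R, 0 < e0 <= 1 &
  forall (a b : R) f, a < b -> Cr_on `[a, b] r f ->
    (forall x, x \in `[a, b] -> derivable_in `[a, b] f x) /\
    exists2 C, 0 <= C & forall x y, x \in `[a, b] -> y \in `[a, b] ->
      `|derive_in `[a, b] f x - derive_in `[a, b] f y| <= C * `|x - y| `^ e0.
Proof.
have smooth (a b : R) f m : a < b -> (2 <= m)%N -> Cn_on `[a, b] m f ->
    exists2 C, 0 <= C & forall x y, x \in `[a, b] -> y \in `[a, b] ->
      `|derive_in `[a, b] f x - derive_in `[a, b] f y| <= C * `|x - y|.
  move=> ab m2 [dm cm]; pose D : set R := `[a, b]%classic.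
  (* For [m = 2] this continuity belongs to the class; for larger [m] it follows from
     differentiability. *)
  have cf : {within D, continuous (iter 2 (derive_in D) f)}.
    move: m2; rewrite leq_eqVlt => /orP[/eqP m2|m3]; first by rewrite {1}m2.
    by apply: derivable_in_continuous => x; exact: dm.
  have [cM cMab hM] := EVT_max (ltW ab) cf; have [cm' cmab hm] := EVT_min (ltW ab) cf.
  move: hM hm; set M := iter _ _ _ cM; set N := iter _ _ _ cm' => hM hm.
  exists (`|M| + `|N|); first exact: addr_ge0.
  move=> x y xD yD.
  have d1 z : z \in `[a, b] -> derivable_in `[a, b] (derive_in `[a, b] f) z.
    by move=> zD; apply: (dm 1%N) => //; exact: leq_trans m2.
  have [c hc ->] := MVT_dist d1 yD xD.
  have cD : c \in `[a, b].
    move: xD yD hc; rewrite !in_itv /= => /andP[x1 x2] /andP[y1 y2] /andP[c1 c2].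
    by rewrite (le_trans _ c1) ?(le_trans c2)// ?le_min ?ge_max ?x1 ?y1 ?x2 ?y2.
  rewrite normrM ler_wpM2r//; have h1 := hM _ cD; have h2 := hm _ cD.
  move: h1 h2; rewrite /= ler_norml => h1 h2.
  have := ler_norm M; have := ler_norm (- N); rewrite normrN.
  have := normr_ge0 M; have := normr_ge0 N => *; apply/andP; split; lra.
case: r => [s||//]; last first.
  move=> _; exists 1; first by rewrite ltr01 lexx.
  move=> a b f ab fs; split=> [x xD|]; first by have [h _] := fs 1%N; exact: (h 0%N).
  have [C C0 h] := smooth _ _ _ _ ab (leqnn 2) (fs 2%N); exists C => // x y xD yD.
  by rewrite powRr1//; exact: h.
rewrite lte_fin => s1; have s0 : 0 <= s by rewrite ltW// (lt_trans ltr01).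
have [s2|s2] := ltP s 2.
  exists (s - 1); first by rewrite subr_gt0 s1/= lerBlDr ltW.
  move=> a b f ab; have -> : Cr_on `[a, b] s%:E f = (Cn_on `[a, b] 1 f /\
      exists C : R, forall x y, `[a, b]%classic x -> `[a, b]%classic y ->
        `|iter 1 (derive_in `[a, b]) f x - iter 1 (derive_in `[a, b]) f y| <= C * `|x - y| `^ (s - 1)).
    rewrite /Cr_on; have -> : Num.truncn s = 1%N by apply/eqP; rewrite truncn_eq// ltW//=.
    by [].
  move=> [[d1 _] [C hC]]; split=> [x xD|]; first exact: (d1 0%N).
  exists `|C| => // x y xD yD; apply: le_trans (hC _ _ xD yD) _.
  by rewrite ler_wpM2r ?powR_ge0// ler_norm.
exists 1; first by rewrite ltr01 lexx.
move=> a b f ab [cn _].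
have m2 : (2 <= Num.truncn s)%N by rewrite truncn_ge_nat.
split=> [x xD|]; first by have [h _] := cn; apply: (h 0%N) => //; exact: leq_trans m2.
have [C C0 h] := smooth _ _ _ _ ab m2 cn; exists C => // x y xD yD.
by rewrite powRr1//; exact: h.
Qed.

End RelativeDerivative.

(** * Bounded distortion without derivatives *)

Section Distortion.
Context {R : realType}.
Implicit Types (f : R -> R).

Definition clustered (D : R) (s : seq R) : Prop :=
  forall u v, u \in s -> v \in s -> `|u - v| <= D.

Definition in_unit_seq (s : seq R) : Prop := forall u, u \in s -> 0 <= u <= 1.

(* The difference quotients of [f] over [x, y] and [x', y'] agree up to a factor
   [expR (C * D `^ e0)], where [D] bounds the mutual distances; the
   multiplicative form makes sense also when [x = y] or [x' = y']. *)
Definition distorted (C e0 : R) f : Prop := forall D x y x' y',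
  in_unit_seq [:: x; y; x'; y'] -> clustered D [:: x; y; x'; y'] ->
  `|f x - f y| * `|x' - y'| <= expR (C * D `^ e0) * (`|f x' - f y'| * `|x - y|).

(** The sign [s] is [true] for decreasing maps. *)
Definition one_signed f (s : bool) : Prop := forall x y,
  0 <= x <= 1 -> 0 <= y <= 1 -> 0 <= (-1) ^+ s * (f x - f y) * (x - y).

Record contracting_branch (m k C e0 : R) f : Prop := ContractingBranch {
  branch_unit : forall x, 0 <= x <= 1 -> 0 <= f x <= 1;
  branch_ge : forall x y, 0 <= x <= 1 -> 0 <= y <= 1 -> m * `|x - y| <= `|f x - f y|;
  branch_le : forall x y, 0 <= x <= 1 -> 0 <= y <= 1 -> `|f x - f y| <= k * `|x - y|;
  branch_sign : exists s, one_signed f s;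
  branch_distorted : distorted C e0 f }.

Lemma between_dist (D x y x' y' c c' : R) : clustered D [:: x; y; x'; y'] ->
  Num.min x y <= c <= Num.max x y -> Num.min x' y' <= c' <= Num.max x' y' ->
  `|c - c'| <= D.
Proof.
move=> cl; have mem u : u \in [:: x; y; x'; y'] -> True by [].
have h u v : u \in [:: x; y; x'; y'] -> v \in [:: x; y; x'; y'] -> u - v <= D.
  by move=> hu hv; apply: le_trans (ler_norm _) (cl _ _ hu hv).
have [i1 i2 i3 i4] : [/\ x \in [:: x; y; x'; y'], y \in [:: x; y; x'; y'],
   x' \in [:: x; y; x'; y'] & y' \in [:: x; y; x'; y']].
  by split; rewrite !inE eqxx ?orbT.
have := h _ _ i1 i3; have := h _ _ i1 i4; have := h _ _ i2 i3; have := h _ _ i2 i4.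
have := h _ _ i3 i1; have := h _ _ i4 i1; have := h _ _ i3 i2; have := h _ _ i4 i2.
rewrite ler_norml; case: (leP x y) => _; case: (leP x' y') => _.
all: move=> *; apply/andP; split; lra.
Qed.

(** Here [f] inverts a map with derivative [dg]. By the mean value property each quotient of [f] is
    some [1 / dg c], and [|dg c'| <= |dg c| * (1 + C * D ^ e0)] because [|dg c| >= 1]; the
    intermediate points stay within [D] since [f] does not expand. *)
Lemma distorted_of_quotient (C e0 : R) f (dg : R -> R) : 0 <= C -> 0 < e0 ->
  (forall x, 0 <= x <= 1 -> 0 <= f x <= 1) ->
  (forall x y, 0 <= x <= 1 -> 0 <= y <= 1 -> `|f x - f y| <= `|x - y|) ->
  (forall x y, 0 <= x <= 1 -> 0 <= y <= 1 -> exists c, [/\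
     Num.min (f x) (f y) <= c <= Num.max (f x) (f y), x - y = dg c * (f x - f y),
     1 <= `|dg c| &
     forall x' y', 0 <= x' <= 1 -> 0 <= y' <= 1 -> forall c',
       Num.min (f x') (f y') <= c' <= Num.max (f x') (f y') ->
       `|dg c - dg c'| <= C * `|c - c'| `^ e0]) ->
  distorted C e0 f.
Proof.
move=> C0 e00 f01 fle quo D x y x' y' us cl.
have [i1 i2 i3 i4] : [/\ x \in [:: x; y; x'; y'], y \in [:: x; y; x'; y'],
   x' \in [:: x; y; x'; y'] & y' \in [:: x; y; x'; y']].
  by split; rewrite !inE eqxx ?orbT.
have [c [hc cE c1 hol]] := quo _ _ (us _ i1) (us _ i2).
have [c' [hc' cE' c1' _]] := quo _ _ (us _ i3) (us _ i4).
have cc' := hol _ _ (us _ i3) (us _ i4) _ hc'.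
have clf : clustered D [:: f x; f y; f x'; f y'].
  move=> u v; rewrite (_ : [:: f x; f y; f x'; f y'] = map f [:: x; y; x'; y'])//.
  move=> /mapP[u' u's ->] /mapP[v' v's ->].
  by apply: le_trans (fle _ _ (us _ u's) (us _ v's)) (cl _ _ u's v's).
have ccD := between_dist clf hc hc'.
rewrite cE cE' !normrM.
move: (expR_ge1Dx (C * D `^ e0)) (expR_gt0 (C * D `^ e0)).
move: (expR _) => X E X0.
rewrite (_ : `|_| * _ = `|dg c'| * (`|f x - f y| * `|f x' - f y'|)); last by ring.
rewrite [leRHS](_ : _ = X * `|dg c| * (`|f x - f y| * `|f x' - f y'|)); last by ring.
apply: ler_wpM2r; first exact: mulr_ge0.
have D0 : 0 <= D by apply: le_trans (cl _ _ i1 i2).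
have cD : `|c - c'| `^ e0 <= D `^ e0.
  by apply: ge0_ler_powR; rewrite ?nnegrE ?(ltW e00).
have h1 : `|dg c'| <= `|dg c| + C * D `^ e0.
  rewrite -(subrK (dg c) (dg c')) (le_trans (ler_normD _ _))// addrC lerD2l.
  by rewrite distrC (le_trans cc')// ler_wpM2l.
apply: le_trans h1 _; apply: le_trans (_ : `|dg c| * (1 + C * D `^ e0) <= _).
  by rewrite mulrDr mulr1 lerD2l ler_peMl// mulr_ge0 ?powR_ge0.
by rewrite [leRHS]mulrC ler_wpM2l.
Qed.

End Distortion.

(** * Expansion on each subinterval *)

Section Branches.
Context {R : realType} {A : finType} (g : expanding_data R A) (r : \bar R).
Hypotheses (r1 : (1 < r)%E) (hg : expanding g r).

Lemma subint_wf a b : trans g a b ->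
  [/\ 0 <= left_end g a b, left_end g a b < right_end g a b & right_end g a b <= 1].
Proof. by case: hg => _ [h _ _ _ _]; exact: h. Qed.

Lemma gcoord_bij a b : trans g a b -> set_bij (subint g a b) `[0, 1] (gcoord g a).
Proof. by case: hg => _ [_ _ _ h _] /h[]. Qed.

Lemma gmapE a b x : trans g a b -> subint g a b x -> gmap g (x, a) = (gcoord g a x, b).
Proof.
case: hg => _ [_ _ h _ _] ab xab; rewrite /gcoord -(h _ _ _ ab xab).
exact: surjective_pairing.
Qed.

Lemma subint_unit a b x : trans g a b -> subint g a b x -> 0 <= x <= 1.
Proof.
move=> ab; have [h1 h2 h3] := subint_wf ab; rewrite /subint /= in_itv/=.
by move=> /andP[x1 x2]; rewrite (le_trans h1 x1) (le_trans x2 h3).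
Qed.

Lemma subint_disjoint a b b' x :
  trans g a b -> trans g a b' -> subint g a b x -> subint g a b' x -> b = b'.
Proof.
case: hg => _ [_ h _ _ _] ab ab' x1 x2; apply/eqP; apply: contraT => bb'.
by have := h _ _ _ ab ab' bb'; move=> /seteqP[/(_ x)]; case.
Qed.

Lemma inverse_branchK a b x : trans g a b -> 0 <= x <= 1 ->
  gcoord g a (inverse_branch g a b x) = x.
Proof.
move=> ab x01; have [_ _ surj] := gcoord_bij ab.
by apply: (surjpK _ surj); rewrite inE /= in_itv.
Qed.

Lemma inverse_branch_in a b x : trans g a b -> 0 <= x <= 1 ->
  subint g a b (inverse_branch g a b x).
Proof.
move=> ab x01; have [_ _ surj] := gcoord_bij ab.
apply: (surjpinv_image_sub (dflt := fun=> 0) surj); exists x => //.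
Qed.

Lemma gcoordK a b y : trans g a b -> subint g a b y ->
  inverse_branch g a b (gcoord g a y) = y.
Proof.
move=> ab yab; have [_ inj _] := gcoord_bij ab.
by apply: (pinvKV _ inj); rewrite inE.
Qed.

Lemma gcoord_unit a b y : trans g a b -> subint g a b y -> 0 <= gcoord g a y <= 1.
Proof.
move=> ab yab; have [fu _ _] := gcoord_bij ab.
by have := fu _ yab; rewrite /= in_itv.
Qed.

(** The other subintervals of [I(a)] are finitely many, closed, and avoid [x]. Thanks to this,
    [Diter 1], a derivative relative to the whole domain, is the derivative relative to
    [subint g a b]. *)
Lemma domain_near a b x : trans g a b -> subint g a b x ->
  exists2 delta, 0 < delta & forall y, domain g (y, a) -> `|y - x| < delta -> subint g a b y.
Proof.
move=> ab xab.
have /choice[dl dlP] (b' : A) : exists d, 0 < d /\ (trans g a b' -> b' != b ->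
    forall y, `|y - x| < d -> ~ subint g a b' y).
  have [[ab' bb']|n] := pselect (trans g a b' /\ b' != b); last first.
    by exists 1; split=> // h1 h2; exfalso; apply: n.
  have nx : ~ subint g a b' x.
    by move=> xb'; move/eqP: bb'; apply; exact: (subint_disjoint ab' ab xb' xab).
  move: nx; rewrite /subint /= in_itv/= => /negP; rewrite negb_and -!ltNge => /orP[h|h].
    exists (left_end g a b' - x); rewrite subr_gt0 h; split=> // _ _ y.
    by rewrite in_itv/= ltr_norml => /andP[y1 y2] /andP[y3 y4]; lra.
  exists (x - right_end g a b'); rewrite subr_gt0 h; split=> // _ _ y.
  by rewrite in_itv/= ltr_norml => /andP[y1 y2] /andP[y3 y4]; lra.
exists (\big[Num.min/1]_b' dl b').
  by apply/bigmin_gtP; split=> // b' _; have [] := dlP b'.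
move=> y [b' /= ab' yab'] yx; have [<-//|bb'] := eqVneq b' b.
have [_ /(_ ab' bb' y)] := dlP b'; case=> //.
by apply: lt_le_trans yx _; exact: bigmin_le.
Qed.

Lemma subint_limit a b x delta : trans g a b -> subint g a b x -> 0 < delta ->
  exists y, [/\ subint g a b y, y != x & `|y - x| < delta].
Proof.
move=> ab; have [_ lr _] := subint_wf ab; rewrite /subint /= in_itv/= => /andP[x1 x2] d0.
set l := left_end g a b in lr x1 *; set u := right_end g a b in lr x2 *.
have [xu|ux] := ltP x u.
  exists (x + Num.min (u - x) (delta / 2)).
  rewrite in_itv/= [x + _ - x]addrC addKr.
  have m0 : 0 < Num.min (u - x) (delta / 2) by rewrite lt_min subr_gt0 xu divr_gt0.
  have m1 : Num.min (u - x) (delta / 2) <= u - x by rewrite ge_min lexx.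
  have m2 : Num.min (u - x) (delta / 2) <= delta / 2 by rewrite ge_min lexx orbT.
  split; first by apply/andP; split; lra.
    by rewrite -subr_eq0 addrC addKr gt_eqF.
  by rewrite gtr0_norm//; lra.
have xE : x = u by apply/eqP; rewrite eq_le x2.
exists (x - Num.min (u - l) (delta / 2)).
rewrite in_itv/= [x - _ - x]addrC addKr.
have m0 : 0 < Num.min (u - l) (delta / 2) by rewrite lt_min subr_gt0 lr divr_gt0.
have m1 : Num.min (u - l) (delta / 2) <= u - l by rewrite ge_min lexx.
have m2 : Num.min (u - l) (delta / 2) <= delta / 2 by rewrite ge_min lexx orbT.
split; first by apply/andP; split; lra.
  by rewrite -subr_eq0 addrC addKr oppr_eq0 gt_eqF.
by rewrite normrN gtr0_norm//; lra.
Qed.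

Lemma derivative_gt1 a b x : trans g a b -> subint g a b x ->
  derivable_in (subint g a b) (gcoord g a) x ->
  1 < `|derive_in (subint g a b) (gcoord g a) x|.
Proof.
move=> ab xab dx; have dom : domain g (x, a) by exists b.
have : 1 < `|Diter g 1 (x, a)| by case: hg => _ [_ _ _ _ h]; exact: h.
rewrite /Diter (_ : derive_in _ _ _ = derive_in (subint g a b) (gcoord g a) x)//.
apply: derive_in_eq => [e e0|delta d0].
  have [d1 d10 h1] := derivable_in_dist dx e0.
  have [d2 d20 h2] := domain_near ab xab.
  exists (Num.min d1 d2); first by rewrite lt_min d10.
  move=> y dy yx; rewrite lt_min => /andP[yd1 yd2]; apply: h1 => //.
  by apply: h2 => //; exact: (dy 0%N).
have [y [yab yx yd]] := subint_limit ab xab d0; exists y; split=> //.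
by move=> i; rewrite ltnS leqn0 => /eqP -> /=; exists b.
Qed.

End Branches.

Section UniformBranches.
Context {R : realType} {A : finType} (g : expanding_data R A) (r : \bar R).
Hypotheses (r1 : (1 < r)%E) (hg : expanding g r).

Lemma contracting_branch_weaken (m k C m' k' C' e0 : R) (f : R -> R) :
  m' <= m -> k <= k' -> C <= C' ->
  contracting_branch m k C e0 f -> contracting_branch m' k' C' e0 f.
Proof.
move=> mm kk CC [h1 h2 h3 h4 h5]; split=> //.
- by move=> x y hx hy; apply: le_trans (h2 _ _ hx hy); rewrite ler_wpM2r.
- by move=> x y hx hy; apply: le_trans (h3 _ _ hx hy) _; rewrite ler_wpM2r.
- move=> D x y x' y' us cl; apply: le_trans (h5 _ _ _ _ _ us cl) _.
  by rewrite ler_wpM2r ?mulr_ge0// ler_expR ler_wpM2r ?powR_ge0.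
Qed.

Lemma holder_continuous (D : set R) (f : R -> R) (C e0 : R) : 0 <= C -> 0 < e0 ->
  (forall x y, D x -> D y -> `|f x - f y| <= C * `|x - y| `^ e0) ->
  {within D, continuous f}.
Proof.
move=> C0 e00 h; apply: continuous_withinP => x e Dx ep.
have [d d0 hd] := powR_small ((C + 1) / e * 2) e00.
exists d => // y Dy yx; have [->|yx0] := eqVneq y x; first by rewrite subrr normr0.
apply: le_lt_trans (h _ _ Dy Dx) _.
have np : 0 < `|y - x| by rewrite normr_gt0 subr_eq0.
have := hd `|y - x|; rewrite np => /(_ yx).
have p0 : 0 < `|y - x| `^ e0 by rewrite powR_gt0.
rewrite (_ : _ * _ = ((C + 1) * `|y - x| `^ e0) * 2 / e); last by field; rewrite gt_eqF.
rewrite ler_pdivrMr// mul1r => hh; nra.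
Qed.

(** On a compact interval the norm of the continuous derivative attains a minimum above [1] and a
    maximum; [k] and [m] are their inverses. *)
Lemma branch_contracting : exists2 e0 : R, 0 < e0 <= 1 &
  forall a b, trans g a b -> exists m k C,
    [/\ 0 < m, 0 <= k < 1, 0 <= C & contracting_branch m k C e0 (inverse_branch g a b)].
Proof.
have [e0 e01 hol] := Cr_on_holder r1; exists e0 => // a b ab.
have /andP[e00 _] := e01.
have [l0 lu u1] := subint_wf hg ab.
have cr : Cr_on (subint g a b) r (gcoord g a).
  by case: hg => _ [_ _ _ h _]; have [_ h1 _] := h _ _ ab.
have [dG [C C0 hC]] := hol _ _ _ lu cr.
set dg := derive_in _ _ in hC.
pose D := subint g a b.
have dg1 x : D x -> 1 < `|dg x| by move=> Dx; exact: (derivative_gt1 hg ab Dx (dG _ Dx)).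
have mvt x y : D x -> D y -> exists2 c, Num.min x y <= c <= Num.max x y &
    gcoord g a y - gcoord g a x = dg c * (y - x) by exact: MVT_dist.
clearbody dg.
have cdg : {within D, continuous dg} by exact: (holder_continuous C0 e00 hC).
have cn : {within D, continuous (fun x => `|dg x|)}.
  apply: (holder_continuous C0 e00) => x y Dx Dy; apply: le_trans (hC _ _ Dx Dy).
  exact: ler_dist_dist.
have [xm xmD hm] := EVT_min (ltW lu) cn; have [xM xMD hM] := EVT_max (ltW lu) cn.
have m1 := dg1 _ xmD; have M1 := dg1 _ xMD.
set mn := `|dg xm| in hm m1; set mx := `|dg xM| in hM M1.
have mn0 : 0 < mn by exact: lt_trans m1.
have mx0 : 0 < mx by exact: lt_trans M1.
pose F := inverse_branch g a b.
have FD x : 0 <= x <= 1 -> D (F x) by exact: (inverse_branch_in hg ab).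
have GF x : 0 <= x <= 1 -> gcoord g a (F x) = x by exact: (inverse_branchK hg ab).
have quo x y : 0 <= x <= 1 -> 0 <= y <= 1 -> exists c, [/\ D c,
    Num.min (F x) (F y) <= c <= Num.max (F x) (F y) & x - y = dg c * (F x - F y)].
  move=> hx hy; have [c hc] := mvt _ _ (FD _ hy) (FD _ hx).
  rewrite !GF// => e; exists c; split=> //; last by rewrite minC maxC.
  have := FD _ hx; have := FD _ hy; rewrite /D /subint /= !in_itv/=.
  move=> /andP[y1 y2] /andP[x1 x2]; have /andP[c1 c2] := hc.
  by rewrite (le_trans _ c1) ?(le_trans c2)// ?le_min ?ge_max ?x1 ?y1 ?x2 ?y2.
have F01 x : 0 <= x <= 1 -> 0 <= F x <= 1.
  by move=> hx; apply: (subint_unit hg ab); exact: FD.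
have Fge x y : 0 <= x <= 1 -> 0 <= y <= 1 -> mx^-1 * `|x - y| <= `|F x - F y|.
  move=> hx hy; have [c [Dc _ ->]] := quo _ _ hx hy.
  by rewrite normrM ler_pdivrMl// ler_wpM2r//; exact: hM.
have Fle x y : 0 <= x <= 1 -> 0 <= y <= 1 -> `|F x - F y| <= mn^-1 * `|x - y|.
  move=> hx hy; have [c [Dc _ ->]] := quo _ _ hx hy.
  by rewrite normrM ler_pdivlMl// ler_wpM2r//; exact: hm.
have k1 : mn^-1 < 1 by rewrite invf_lt1.
(* The derivative never vanishes, so by the intermediate value theorem it keeps the sign that it has
   at [xm]. *)
have [s sP] : exists s : bool, forall c, D c -> 0 < (-1) ^+ s * dg c.
  exists (dg xm < 0) => c Dc.
  have nz : forall z, D z -> dg z != 0.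
    by move=> z Dz; rewrite -normr_gt0 (lt_trans ltr01)// dg1.
  rewrite mulr_sign; case: ifPn => [neg|pos]; [rewrite oppr_gt0|rewrite -leNgt in pos].
    rewrite ltNge; apply/negP => cpos.
    have xc : Num.min xm c <= Num.max xm c by rewrite ge_min le_max lexx.
    have sub z : z \in `[Num.min xm c, Num.max xm c] -> D z.
      rewrite /D /subint /= !in_itv/=; move: xmD Dc; rewrite /D /subint/= !in_itv/=.
      move=> /andP[a1 a2] /andP[b1 b2] /andP[z1 z2].
      by rewrite (le_trans _ z1) ?(le_trans z2)// ?le_min ?ge_max ?a1 ?b1 ?a2 ?b2.
    have [|z zin z0] := IVT xc (continuous_subspaceW sub cdg) (v := 0).
      by case: (leP xm c) => _; rewrite ge_min le_max (ltW neg) cpos ?orbT.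
    by have := nz _ (sub _ zin); rewrite z0 eqxx.
  rewrite lt_neqAle eq_sym nz//= leNgt; apply/negP => cneg.
  have xc : Num.min xm c <= Num.max xm c by rewrite ge_min le_max lexx.
  have sub z : z \in `[Num.min xm c, Num.max xm c] -> D z.
    rewrite /D /subint /= !in_itv/=; move: xmD Dc; rewrite /D /subint/= !in_itv/=.
    move=> /andP[a1 a2] /andP[b1 b2] /andP[z1 z2].
    by rewrite (le_trans _ z1) ?(le_trans z2)// ?le_min ?ge_max ?a1 ?b1 ?a2 ?b2.
  have [|z zin z0] := IVT xc (continuous_subspaceW sub cdg) (v := 0).
    by case: (leP xm c) => _; rewrite ge_min le_max (ltW cneg) pos ?orbT.
  by have := nz _ (sub _ zin); rewrite z0 eqxx.
exists mx^-1, mn^-1, C; split=> //.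
- by rewrite invr_gt0.
- by rewrite invr_ge0 ltW.
split=> //.
- exists s => x y hx hy; have [c [Dc _ e]] := quo _ _ hx hy.
  rewrite [X in _ * X]e mulrACA -expr2 mulr_ge0 ?sqr_ge0// ltW//.
  exact: sP.
- apply: (distorted_of_quotient (dg := dg)) => //.
    move=> x y hx hy; apply: le_trans (Fle _ _ hx hy) _.
    by rewrite ler_piMl// ltW.
  move=> x y hx hy; have [c [Dc hc e]] := quo _ _ hx hy; exists c; split=> //.
    by rewrite ltW// dg1.
  move=> x' y' hx' hy' c' hc'; apply: hC => //.
  have := FD _ hx'; have := FD _ hy'; rewrite /D /subint /= !in_itv/=.
  move=> /andP[y1 y2] /andP[x1 x2]; have /andP[c1 c2] := hc'.
  by rewrite (le_trans _ c1) ?(le_trans c2)// ?le_min ?ge_max ?x1 ?y1 ?x2 ?y2.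
Qed.

(** Finitely many transitions allow extremal constants; pairs that are no transition get neutral
    ones. The initial value [2^-1] keeps [m] below [1] and [k] above [0]. *)
Lemma branches_contracting : exists e0 m k C : R,
  [/\ 0 < e0 <= 1, 0 < m < 1, 0 < k < 1, 0 <= C & forall a b, trans g a b ->
    contracting_branch m k C e0 (inverse_branch g a b)].
Proof.
have [e0 e01 h] := branch_contracting.
have /choice[q qP] (ab : A * A) : exists q : R * R * R, [/\ 0 < q.1.1, 0 <= q.1.2 < 1,
   0 <= q.2 & trans g ab.1 ab.2 ->
   contracting_branch q.1.1 q.1.2 q.2 e0 (inverse_branch g ab.1 ab.2)].
  have [ab'|n] := pselect (trans g ab.1 ab.2).
    by have [m [k [C [h1 h2 h3 h4]]]] := h _ _ ab'; exists (m, k, C).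
  by exists (1, 0, 0); rewrite /= ltr01 !lexx.
exists e0, (\big[Num.min/2^-1]_i (q i).1.1), (\big[Num.max/2^-1]_i (q i).1.2),
  (\sum_i (q i).2); split=> //.
- apply/andP; split.
    by apply/bigmin_gtP; split=> [|i _]; [rewrite invr_gt0|have [] := qP i].
  apply: le_lt_trans (_ : 2^-1 < 1); last by rewrite invf_lt1// ltr1n.
  exact: bigmin_le_id.
- apply/andP; split.
    apply: lt_le_trans (_ : 2^-1 <= _); first by rewrite invr_gt0.
    exact: bigmax_ge_id.
  apply/bigmax_ltP; split=> [|i _]; first by rewrite invf_lt1// ltr1n.
  by have [_ /andP[]] := qP i.
- by apply: sumr_ge0 => i _; have [] := qP i.
move=> a b ab; have [_ _ C0 /(_ ab)] := qP (a, b).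
apply: contracting_branch_weaken.
- by apply: (@bigmin_le _ _ _ _ (a, b) (fun i => (q i).1.1)).
- by apply: (@le_bigmax _ _ _ _ (fun i => (q i).1.2) (a, b)).
- rewrite (bigD1 (a, b))//= lerDl; apply: sumr_ge0 => i _.
  by have [] := qP i.
Qed.

End UniformBranches.

(** * Composition of branches *)

Section Composition.
Context {R : realType}.
Implicit Types (f : R -> R).

Lemma contracting_branch_id (C e0 : R) : 0 <= C -> contracting_branch 1 1 C e0 (@id R).
Proof.
move=> C0; split=> //.
- by move=> x y _ _; rewrite mul1r.
- by move=> x y _ _; rewrite mul1r.
- by exists false => x y _ _; rewrite expr0 mul1r -expr2 sqr_ge0.
- move=> D x y x' y' _ _; rewrite [X in X <= _]mulrC ler_peMl ?mulr_ge0//.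
  by rewrite -[leLHS]expR0 ler_expR mulr_ge0// powR_ge0.
Qed.

(** The map [F] acts first and contributes [C * D ^ e0]; its values are within [k * D] of each
    other, so [f] contributes [C1 * k ^ e0 * D ^ e0]. The inequality on [C1] keeps the total below
    [C1 * D ^ e0], however long the composition. *)
Lemma contracting_branch_comp (m k C m1 k1 C1 e0 : R) f F :
  0 < m -> 0 <= k -> 0 <= m1 -> 0 <= k1 -> 0 < e0 -> 0 <= C1 ->
  C + C1 * k `^ e0 <= C1 ->
  contracting_branch m1 k1 C1 e0 f -> contracting_branch m k C e0 F ->
  contracting_branch (m1 * m) (k1 * k) C1 e0 (f \o F).
Proof.
move=> m0 k0 m10 k10 e00 C10 CC hf hF.
have F01 := branch_unit hF; have f01 := branch_unit hf.
have Finj x y : 0 <= x <= 1 -> 0 <= y <= 1 -> F x - F y = 0 -> x - y = 0.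
  move=> hx hy h; have := branch_ge hF hx hy; rewrite h normr0.
  by rewrite pmulr_rle0// normr_le0 => /eqP.
split.
- by move=> x hx; exact: f01 (F01 _ hx).
- move=> x y hx hy /=; apply: le_trans (branch_ge hf (F01 _ hx) (F01 _ hy)).
  by rewrite -mulrA ler_wpM2l//; exact: (branch_ge hF hx hy).
- move=> x y hx hy /=; apply: le_trans (branch_le hf (F01 _ hx) (F01 _ hy)) _.
  by rewrite -mulrA ler_wpM2l//; exact: (branch_le hF hx hy).
- have [s sP] := branch_sign hf; have [t tP] := branch_sign hF.
  exists (s (+) t) => x y hx hy /=; rewrite signr_addb.
  have h1 := sP _ _ (F01 _ hx) (F01 _ hy); have h2 := tP _ _ hx hy.
  have [z|nz] := eqVneq (F x - F y) 0; first by rewrite (Finj _ _ hx hy z) mulr0.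
  rewrite -(pmulr_rge0 _ (_ : 0 < (F x - F y) ^+ 2)); last by rewrite exprn_even_gt0.
  rewrite [leRHS](_ : _ = ((-1) ^+ s * (f (F x) - f (F y)) * (F x - F y)) *
    ((-1) ^+ t * (F x - F y) * (x - y))); first exact: mulr_ge0.
  by move: ((-1) ^+ s) ((-1) ^+ t) => a b; ring.
- move=> D x y x' y' us cl /=.
  have [i1 i2 i3 i4] : [/\ x \in [:: x; y; x'; y'], y \in [:: x; y; x'; y'],
     x' \in [:: x; y; x'; y'] & y' \in [:: x; y; x'; y']].
    by split; rewrite !inE eqxx ?orbT.
  have [hx hy hx' hy'] := And4 (us _ i1) (us _ i2) (us _ i3) (us _ i4).
  have D0 : 0 <= D by apply: le_trans (cl _ _ i1 i2).
  have h1 := branch_distorted hF us cl.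
  have usF : in_unit_seq [:: F x; F y; F x'; F y'].
    move=> u; rewrite (_ : [:: F x; F y; F x'; F y'] = map F [:: x; y; x'; y'])//.
    by move=> /mapP[v vs ->]; apply: F01; exact: us.
  have clF : clustered (k * D) [:: F x; F y; F x'; F y'].
    move=> u v; rewrite (_ : [:: F x; F y; F x'; F y'] = map F [:: x; y; x'; y'])//.
    move=> /mapP[u' u's ->] /mapP[v' v's ->].
    apply: le_trans (branch_le hF (us _ u's) (us _ v's)) _.
    by rewrite ler_wpM2l//; exact: cl.
  have h2 := branch_distorted hf usF clF.
  have [z|nz] := eqVneq (F x - F y) 0.
    have xy : x = y by apply/eqP; rewrite -subr_eq0; apply/eqP; exact: Finj.
    by rewrite xy subrr normr0 mul0r !mulr_ge0// expR_ge0.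
  have [z'|nz'] := eqVneq (F x' - F y') 0.
    by rewrite (Finj _ _ hx' hy' z') normr0 mulr0 !mulr_ge0// expR_ge0.
  (* Multiplying by the increments of [F] chains the two distortion bounds as a product of
     quotients. *)
  have p0 : 0 < `|F x - F y| * `|F x' - F y'| by rewrite mulr_gt0// normr_gt0.
  rewrite -(ler_pM2r p0).
  apply: le_trans (_ : (`|f (F x) - f (F y)| * `|F x' - F y'|) * (`|F x - F y| * `|x' - y'|) <= _).
    by apply: le_of_eq; ring.
  apply: le_trans (ler_pM _ _ h2 h1) _; rewrite ?mulr_ge0//.
  set P := `|f (F x') - f (F y')|.
  apply: le_trans (_ : (expR (C1 * (k * D) `^ e0) * expR (C * D `^ e0)) *
     (P * `|x - y| * (`|F x - F y| * `|F x' - F y'|)) <= _).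
    by apply: le_of_eq; ring.
  rewrite -expRD [leLHS]mulrA; apply: ler_wpM2r; first exact: ltW.
  apply: ler_wpM2r; first by apply: mulr_ge0; exact: normr_ge0.
  rewrite ler_expR powRM//.
  by rewrite mulrA -mulrDl addrC ler_wpM2r ?powR_ge0.
Qed.

(** Distortion at [D = 1] compares every quotient of [f] with the one over the whole of [[0, 1]]. *)
Lemma contracting_branch_quasi_affine (m k C e0 : R) f : 0 < m -> 0 <= C ->
  contracting_branch m k C e0 f -> quasi_affine (expR C) f.
Proof.
move=> m0 C0 hf; have u1 := @unit1 R; have u0 := @unit0 R.
have s0 : 0 < sz f.
  have := branch_ge hf u1 u0; rewrite subr0 normr1 mulr1.
  exact: lt_le_trans.
split=> //; first exact: branch_unit hf.
have cl (x y : R) : 0 <= x <= 1 -> 0 <= y <= 1 -> in_unit_seq [:: x; y; 1; 0] /\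
    clustered 1 [:: x; y; 1; 0].
  move=> hx hy; have us : in_unit_seq [:: x; y; 1; 0].
    by move=> u; rewrite !inE => /or4P[] /eqP ->; [exact: hx|exact: hy|exact: u1|exact: u0].
  split=> // u v /us /andP[a1 a2] /us /andP[b1 b2].
  by rewrite ler_norml; apply/andP; split; lra.
have cl' (x y : R) : 0 <= x <= 1 -> 0 <= y <= 1 -> in_unit_seq [:: 1; 0; x; y] /\
    clustered 1 [:: 1; 0; x; y].
  move=> hx hy; have us : in_unit_seq [:: 1; 0; x; y].
    by move=> u; rewrite !inE => /or4P[] /eqP ->; [exact: u1|exact: u0|exact: hx|exact: hy].
  split=> // u v /us /andP[a1 a2] /us /andP[b1 b2].
  by rewrite ler_norml; apply/andP; split; lra.
move=> x y hx hy; have [us c] := cl _ _ hx hy; have [us' c'] := cl' _ _ hx hy.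
split.
- have := branch_distorted hf us' c'; rewrite powR1 mulr1 subr0 normr1 mulr1.
  by rewrite -mulrA ler_pdivrMl ?expR_gt0.
- have := branch_distorted hf us c; rewrite powR1 mulr1 subr0 normr1 mulr1.
  by rewrite mulrA.
- have [s sP] := branch_sign hf.
  have mono a b : 0 <= a <= 1 -> 0 <= b <= 1 -> a <= b -> 0 <= (-1) ^+ s * (f b - f a).
    move=> ha hb; rewrite le_eqVlt => /orP[/eqP ->|ab]; first by rewrite subrr mulr0.
    by have := sP _ _ hb ha; rewrite pmulr_lge0// subr_gt0.
  have ns (z : R) : `|(-1) ^+ s * z| = `|z| by rewrite normrM normr_sign mul1r.
  have key a b : 0 <= a <= 1 -> 0 <= b <= 1 -> a <= b -> `|f b - f a| <= sz f.
    move=> ha hb ab; rewrite /sz -ns -[leRHS]ns.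
    have /andP[a0 a1] := ha; have /andP[b0 b1] := hb.
    have m1 := mono _ _ u0 ha a0; have m2 := mono _ _ ha hb ab; have m3 := mono _ _ hb u1 b1.
    have m4 := mono _ _ u0 u1 ler01.
    by rewrite !ger0_norm//; move: m1 m2 m3; rewrite !mulrBr; lra.
  have [xy|/ltW yx] := leP x y; first by rewrite distrC; exact: key.
  exact: key.
Qed.

End Composition.

(** * Words, loops and slices of the Cantor set *)

Section Paths.
Context {R : realType} {A : finType} (g : expanding_data R A) (r : \bar R).
Variables (e0 m k C : R).
Hypotheses (r1 : (1 < r)%E) (hg : expanding g r) (e01 : 0 < e0 <= 1)
  (m01 : 0 < m < 1) (k01 : 0 < k < 1) (C0 : 0 <= C)
  (hb : forall a b, trans g a b -> contracting_branch m k C e0 (inverse_branch g a b)).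

Definition slice (a : A) : set R := [set x | cantor_set g (x, a)].

(** The solution of [C1 = C + C1 * k ^ e0]: the geometric series of the distortions along a word. *)
Definition path_const : R := C / (1 - k `^ e0).

Let ke : k `^ e0 < 1.
Proof.
have /andP[k0 k1] := k01; have /andP[e00 _] := e01.
have := @gt0_ltr_powR R e0 e00 k 1; rewrite powR1; apply=> //.
  by rewrite nnegrE ltW.
by rewrite nnegrE.
Qed.

Lemma path_const_ge0 : 0 <= path_const.
Proof. by rewrite /path_const divr_ge0// subr_ge0 ltW. Qed.

Lemma inverse_path_cat a s t :
  inverse_path g a (s ++ t) = inverse_path g a s \o inverse_path g (last a s) t.
Proof. by elim: s a => //= b s IH a; rewrite IH. Qed.

Lemma path_branch a s : path (trans g) a s ->
  contracting_branch (m ^+ size s) (k ^+ size s) path_const e0 (inverse_path g a s).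
Proof.
have /andP[m0 m1] := m01; have /andP[k0 k1] := k01; have /andP[e00 _] := e01.
elim/last_ind: s => [|s b IH] /=.
  by move=> _; rewrite !expr0; apply: contracting_branch_id; exact: path_const_ge0.
rewrite rcons_path => /andP[/IH hs ab].
rewrite -cats1 inverse_path_cat size_cat addn1 !exprSr.
apply: (@contracting_branch_comp _ m k C) (hb ab) => //.
- exact: ltW.
- by rewrite exprn_ge0// ltW.
- by rewrite exprn_ge0// ltW.
- exact: path_const_ge0.
- have n0 : 1 - k `^ e0 != 0 by rewrite gt_eqF// subr_gt0.
  by rewrite /path_const; apply: le_of_eq; field.
Qed.

(** Loops at one letter compose freely, which general words do not. The word [s] omits the initial
    letter [a]. *)
Definition loop_map (a : A) (f : R -> R) : Prop :=
  exists s, [/\ path (trans g) a s, last a s = a & f = inverse_path g a s].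

Lemma loop_monoid a : quasi_affine_monoid (expR path_const) (loop_map a).
Proof.
have /andP[m0 m1] := m01.
split.
- by exists [::].
- move=> f f' [s [ps ls ->]] [t [pt lt ->]]; exists (s ++ t); split.
  + by rewrite cat_path ls ps.
  + by rewrite last_cat ls.
  + by rewrite inverse_path_cat ls.
- move=> f [s [ps ls ->]]; apply: contracting_branch_quasi_affine (path_branch ps).
    by rewrite exprn_gt0.
  exact: path_const_ge0.
Qed.

Lemma slice_step a x : slice a x -> exists b, [/\ trans g a b, subint g a b x,
  slice b (gcoord g a x) & x = inverse_branch g a b (gcoord g a x)].
Proof.
move=> Kx; have [b /= ab xab] := Kx 0%N; exists b; split=> //; last by rewrite (gcoordK hg).
by move=> n; have := Kx n.+1; rewrite iterSr (gmapE hg ab xab).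
Qed.

Lemma slice_unit a x : slice a x -> 0 <= x <= 1.
Proof. by case/slice_step => b [ab xab _ _]; exact: (subint_unit hg ab xab). Qed.

Lemma branch_slice a b y : trans g a b -> slice b y -> slice a (inverse_branch g a b y).
Proof.
move=> ab Ky; have y01 := slice_unit Ky; have yin := inverse_branch_in hg ab y01.
move=> [|n]; first by exists b.
by rewrite iterSr (gmapE hg ab yin) (inverse_branchK hg)//; exact: Ky.
Qed.

Lemma path_slice a s y : path (trans g) a s -> slice (last a s) y ->
  slice a (inverse_path g a s y).
Proof.
elim: s a => //= b s IH a /andP[ab ps] Ky.
by apply: branch_slice => //; exact: IH.
Qed.

Lemma itinerary a x n : slice a x -> exists s y, [/\ size s = n, path (trans g) a s,
  slice (last a s) y & x = inverse_path g a s y].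
Proof.
elim: n a x => [|n IH] a x Kx; first by exists [::], x.
have [b [ab _ Kb ->]] := slice_step Kx.
have [s [y [sn ps Ky ->]]] := IH _ _ Kb.
by exists (b :: s), y; rewrite /= sn ab.
Qed.

Lemma domain_iter_path a s y i : path (trans g) a s -> 0 <= y <= 1 -> (i < size s)%N ->
  domain g (iter i (gmap g) (inverse_path g a s y, a)).
Proof.
move=> + y01; elim: s a i => //= b s IH a [|i] /andP[ab ps] isz.
  exists b => //=; apply: (inverse_branch_in hg ab).
  exact: (branch_unit (path_branch ps)).
have u := branch_unit (path_branch ps) y01.
rewrite iterSr (gmapE hg ab (inverse_branch_in hg ab u)) (inverse_branchK hg)//.
exact: IH.
Qed.

Lemma slice_compact a : compact (slice a).
Proof.
pose level n : set R := \big[setU/set0]_(s <- enum {: n.-tuple A} | path (trans g) a s)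
  (inverse_path g a s @` `[0, 1]).
have levelP n x : level n x <-> exists s : n.-tuple A, path (trans g) a s /\
    exists2 y, 0 <= y <= 1 & inverse_path g a s y = x.
  rewrite /level -bigcup_seq_cond; split.
    by move=> [s /andP[_ ps] [y /= yin <-]]; exists s; split=> //; exists y; rewrite -?in_itv.
  by move=> [s [ps [y yin <-]]]; exists s; [rewrite /= mem_enum|exists y; rewrite //= in_itv].
have sliceE : slice a = \bigcap_n level n.
  apply/seteqP; split=> x.
    move=> Kx n _; apply/levelP; have [s [y [sn ps Ky ->]]] := itinerary n Kx.
    by exists (Tuple (introT eqP sn)); split=> //; exists y => //; exact: slice_unit Ky.
  (* A word with [n.+1] transitions is needed for the [n]-th iterate to lie in the domain. *)
  move=> h n; have /levelP[s [ps [y y01 <-]]] := h n.+1 I.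
  by apply: domain_iter_path => //; rewrite size_tuple.
have cl n : compact (level n).
  apply: bigsetU_compact => s ps; apply: (lipschitz_compact_image (L := k ^+ size s)).
  - by move=> x /=; rewrite in_itv.
  - exact: segment_compact.
  - by move=> x y hx hy; exact: (branch_le (path_branch ps)).
rewrite sliceE; apply: (subclosed_compact (B := level 0%N)) (cl 0%N) _.
  by apply: closed_bigI => n _; apply: compact_closed (cl n); exact: Rhausdorff.
by move=> x h; exact: (h 0%N).
Qed.

(** Mixing is applied to the cylinders of [b] and [c] at index [0]; the point obtained is read from
    [0] to [N]. *)
Lemma connected_letters b c : exists s, path (trans g) b s /\ last b s = c.
Proof.
have [[mix all_l] _] := hg.
pose cyl (a : A) : set {ptws int -> discrete_topology A} := [set x | x 0 = a].
have opencyl a : open (cyl a).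
  have -> : cyl a = (fun x : {ptws int -> discrete_topology A} => x 0) @^-1` [set a] by [].
  apply: open_comp; last exact: discrete_open.
  by move=> x _; apply: (@proj_continuous int (fun=> discrete_topology A) 0 x).
have ne a : subshift (trans g) `&` cyl a !=set0.
  by have [x sx x0] := all_l a; exists x.
have [N hN] := mix _ _ (opencyl b) (opencyl c) (ne b) (ne c).
have [x [sx xb xc]] := hN N (leqnn N).
have iterE n (y : {ptws int -> discrete_topology A}) j : iter n (@left_shift A) y j = y (j + n%:Z).
  elim: n j => [|n IH] j; first by rewrite addr0.
  by rewrite iterS /left_shift IH -addrA -PoszD add1n.
have xN : x N%:Z = c by have := xc; rewrite /cyl/= iterE add0r.
suff h n : exists s, path (trans g) (x 0) s /\ last (x 0) s = x n%:Z.
  by rewrite -xb -xN; exact: h.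
elim: n => [|n [s [ps ls]]]; first by exists [::].
exists (rcons s (x n.+1%:Z)); rewrite rcons_path last_rcons ps ls; split=> //=.
by have := sx n%:Z; rewrite -PoszD addn1.
Qed.

End Paths.

(** * Covers by cylinders *)

Section FiniteEnumeration.

(** A duplicate-free list that is not complete can be extended, which the bound stops. *)
Lemma enum_bounded (T : eqType) (P : T -> Prop) (B : nat) :
  (forall L : seq T, uniq L -> (forall s, s \in L -> P s) -> (size L <= B)%N) ->
  exists L : seq T, uniq L /\ forall s, s \in L <-> P s.
Proof.
move=> h; apply: contrapT => nex.
suff H n : exists L : seq T, [/\ uniq L, forall s, s \in L -> P s & size L = n].
  by have [L [u p sz]] := H B.+1; have := h _ u p; rewrite sz ltnn.
elim: n => [|n [L [u p sz]]]; first by exists [::].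
have [s [sL Ps]] : exists s, s \notin L /\ P s.
  apply: contrapT => /forallNP ns; apply: nex; exists L; split=> // s; split; first exact: p.
  by move=> Ps; apply: contrapT => /negP sL; apply: (ns s).
exists (s :: L); rewrite /= sL sz; split=> // x; rewrite inE => /orP[/eqP ->//|].
exact: p.
Qed.

Lemma leq_sum_count (T U : eqType) (L : seq T) (l : seq U) (e : T -> U -> bool) (B : nat) :
  (forall v, v \in L -> exists2 c, c \in l & e v c) ->
  (forall c, c \in l -> (count (e^~ c) L <= B)%N) -> (size L <= size l * B)%N.
Proof.
elim: l L => [|c l IH] L cov cnt.
  case: L cov cnt => // v L /(_ v); rewrite mem_head => /(_ isT)[c].
  by rewrite in_nil.
rewrite /= mulSn -(count_predC (e^~ c) L) leq_add//; first exact: cnt (mem_head _ _).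
rewrite -size_filter; apply: IH => [v|c' c'l].
  rewrite mem_filter => /andP[/= nec vL]; have [c' + ec'] := cov v vL.
  rewrite inE => /orP[/eqP c'c|c'l]; last by exists c'.
  by move: nec; rewrite -c'c ec'.
rewrite count_filter; apply: leq_trans (cnt c' _); last by rewrite inE c'l orbT.
by apply: sub_count => v /andP[].
Qed.

End FiniteEnumeration.

Section Sections.
Context {R : realType} {A : finType} (g : expanding_data R A) (r : \bar R).
Variables (e0 m k C : R).
Hypotheses (r1 : (1 < r)%E) (hg : expanding g r) (e01 : 0 < e0 <= 1)
  (m01 : 0 < m < 1) (k01 : 0 < k < 1) (C0 : 0 <= C)
  (hb : forall a b, trans g a b -> contracting_branch m k C e0 (inverse_branch g a b)).

Let pb := path_branch e01 m01 k01 C0 hb.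
Definition Cq : R := expR (path_const e0 k C).

Lemma Cq_ge1 : 1 <= Cq.
Proof. by rewrite -expR0 ler_expR; exact: (path_const_ge0 e01 k01 C0). Qed.

Let Cq0 : 0 < Cq. Proof. exact: expR_gt0. Qed.

Lemma path_quasi_affine a s : path (trans g) a s -> quasi_affine Cq (inverse_path g a s).
Proof.
have /andP[m0 _] := m01.
move=> ps; apply: contracting_branch_quasi_affine (pb ps); first by rewrite exprn_gt0.
exact: (path_const_ge0 e01 k01 C0).
Qed.

Lemma path_unit a s x : path (trans g) a s -> 0 <= x <= 1 -> 0 <= inverse_path g a s x <= 1.
Proof. by move=> ps; have [_ h _] := path_quasi_affine ps; exact: h. Qed.

Lemma path_sz_gt0 a s : path (trans g) a s -> 0 < sz (inverse_path g a s).
Proof. by move=> /path_quasi_affine[]. Qed.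

Lemma path_dist_sz a s x y : path (trans g) a s -> 0 <= x <= 1 -> 0 <= y <= 1 ->
  `|inverse_path g a s x - inverse_path g a s y| <= sz (inverse_path g a s).
Proof. by move=> ps hx hy; have [_ _ h] := path_quasi_affine ps; have [] := h _ _ hx hy. Qed.

Lemma path_dist_le a s x y : path (trans g) a s -> 0 <= x <= 1 -> 0 <= y <= 1 ->
  `|inverse_path g a s x - inverse_path g a s y| <= Cq * sz (inverse_path g a s) * `|x - y|.
Proof. by move=> ps hx hy; have [_ _ h] := path_quasi_affine ps; have [] := h _ _ hx hy. Qed.

Lemma path_dist_ge a s x y : path (trans g) a s -> 0 <= x <= 1 -> 0 <= y <= 1 ->
  Cq^-1 * sz (inverse_path g a s) * `|x - y| <= `|inverse_path g a s x - inverse_path g a s y|.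
Proof. by move=> ps hx hy; have [_ _ h] := path_quasi_affine ps; have [] := h _ _ hx hy. Qed.

Lemma path_sz_le a s : path (trans g) a s -> sz (inverse_path g a s) <= k ^+ size s.
Proof.
move=> ps; have := branch_le (pb ps) (@unit1 R) (@unit0 R).
by rewrite subr0 normr1 mulr1.
Qed.

Lemma path_sz_cat a s t : path (trans g) a (s ++ t) ->
  sz (inverse_path g a (s ++ t)) <= sz (inverse_path g a s).
Proof.
rewrite cat_path => /andP[ps pt]; rewrite inverse_path_cat.
by apply: path_dist_sz => //; apply: path_unit => //; rewrite ?unit1 ?unit0.
Qed.

(* The finite words minimal for [sz <= rho], which are the first such prefixes of
   the itineraries. *)
Definition sect (a : A) (rho : R) (s : seq A) : Prop :=
  [/\ path (trans g) a s, sz (inverse_path g a s) <= rho &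
    exists s' b, s = rcons s' b /\ rho < sz (inverse_path g a s')].

Definition sect_ratio : R := Cq^-1 * m.

Lemma sect_ratio_gt0 : 0 < sect_ratio.
Proof. by have /andP[m0 _] := m01; rewrite mulr_gt0// invr_gt0. Qed.

(** Without its last letter the word is longer than [rho], and one letter costs at most the factor
    [Cq^-1 * m]. *)
Lemma sect_sz_ge a rho s : sect a rho s -> sect_ratio * rho <= sz (inverse_path g a s).
Proof.
have /andP[m0 _] := m01.
move=> [ps _ [s' [b [sE lt]]]]; move: ps; rewrite sE rcons_path => /andP[ps ab].
rewrite -cats1 inverse_path_cat /=.
have u1 := path_unit (s := [:: b]) (a := last a s') (x := 1); have u0 := path_unit (s := [:: b]) (a := last a s') (x := 0).
rewrite /= ab /= in u1 u0.
apply: le_trans (path_dist_ge ps (u1 isT (@unit1 R)) (u0 isT (@unit0 R))).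
have := branch_ge (hb ab) (@unit1 R) (@unit0 R); rewrite subr0 normr1 mulr1 => h.
apply: le_trans (_ : Cq^-1 * sz (inverse_path g a s') * m <= _).
  rewrite /sect_ratio mulrAC ler_pM2r// ler_pM2l ?invr_gt0//; exact: ltW.
by rewrite ler_wpM2l// mulr_ge0 ?invr_ge0 ?(ltW Cq0)// normr_ge0.
Qed.

Lemma sect_point a rho x : 0 < rho < 1 -> slice g a x -> exists s y,
  [/\ sect a rho s, slice g (last a s) y & x = inverse_path g a s y].
Proof.
move=> /andP[rho0 rho1] Kx; have /andP[k0 k1] := k01.
have [n hn] : exists n, k ^+ n < rho by apply: expr_small; rewrite ?(ltW k0).
have [s [y [sn ps Ky xE]]] := itinerary hg n Kx.
have ex : exists i, (i <= n)%N && (sz (inverse_path g a (take i s)) <= rho).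
  exists n; rewrite leqnn -sn take_size/=; apply: le_trans (path_sz_le ps) _.
  by rewrite sn ltW.
case: (ex_minnP ex) => i /andP[i_n hi] imin.
have pi : path (trans g) a (take i s) by move: ps; rewrite -{1}(cat_take_drop i s) cat_path => /andP[].
have pd : path (trans g) (last a (take i s)) (drop i s).
  by move: ps; rewrite -{1}(cat_take_drop i s) cat_path => /andP[].
exists (take i s), (inverse_path g (last a (take i s)) (drop i s) y); split.
- split=> //; case: i i_n hi imin pi pd => [|i] i_n hi imin pi pd.
    (* The empty prefix has length [1] and is excluded by [rho < 1]. *)
    move: hi; rewrite take0 /= /sz subr0 normr1 => h.
    by have := le_lt_trans h rho1; rewrite ltxx.
  exists (take i s), (nth a s i); split; first by rewrite -take_nth// sn.
  rewrite ltNge; apply/negP => h; have := imin i; rewrite h (ltnW i_n) => /(_ isT).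
  by rewrite ltnn.
- apply: (path_slice hg pd); rewrite -last_cat cat_take_drop//.
- rewrite xE -{1}(cat_take_drop i s) inverse_path_cat //.
Qed.

(** The subintervals of one letter are disjoint, so a common point forces equal letters as long as
    both words continue. *)
Lemma paths_meet a s t x y : path (trans g) a s -> path (trans g) a t ->
  0 <= x <= 1 -> 0 <= y <= 1 -> inverse_path g a s x = inverse_path g a t y ->
  prefix s t \/ prefix t s.
Proof.
move=> + + hx hy; elim: s t a => [|b s IH] [|b' t] a //=; try by [left|right].
move=> /andP[ab ps] /andP[ab' pt] E.
have us := path_unit ps hx; have ut := path_unit pt hy.
have bb' : b = b'.
  apply: (subint_disjoint hg ab ab' (inverse_branch_in hg ab us)).
  by rewrite E; exact: (inverse_branch_in hg ab' ut).
move: ab' pt E ut; rewrite -bb' => ab' pt E ut.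
have E' : inverse_path g b s x = inverse_path g b t y.
  by rewrite -(inverse_branchK hg ab us) -(inverse_branchK hg ab ut); congr (gcoord g a _).
by have [h|h] := IH _ _ ps pt E'; rewrite eqxx; [left|right].
Qed.

(** Words that meet are comparable, and a strict prefix of a word of the section is still longer
    than [rho]. *)
Lemma sect_disjoint a rho s t x y : sect a rho s -> sect a rho t ->
  0 <= x <= 1 -> 0 <= y <= 1 -> inverse_path g a s x = inverse_path g a t y -> s = t.
Proof.
have key u v : sect a rho u -> sect a rho v -> prefix u v -> u = v.
  move=> [pu su _] [pv _ [v' [b [vE lt]]]] /prefixP[w vuw].
  case: (lastP w) vuw => [|w' c]; first by rewrite cats0.
  rewrite -rcons_cat vE => /rcons_inj[v'E _].
  have pv' : path (trans g) a v' by move: pv; rewrite vE rcons_path => /andP[].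
  have := path_sz_cat (s := u) (t := w') (a := a); rewrite -v'E => /(_ pv') h.
  by have := lt_le_trans lt (le_trans h su); rewrite ltxx.
move=> hs ht hx hy E; have [ps _ _] := hs; have [pt _ _] := ht.
by have [h|h] := paths_meet ps pt hx hy E; [exact: key|exact/esym/key].
Qed.

Definition left_of (f : R -> R) : R := Num.min (f 0) (f 1).

Lemma path_ivt a s z : path (trans g) a s ->
  left_of (inverse_path g a s) <= z <= left_of (inverse_path g a s) + sz (inverse_path g a s) ->
  exists2 x, 0 <= x <= 1 & inverse_path g a s x = z.
Proof.
move=> ps zin; set f := inverse_path g a s in zin *.
have cf : {within `[0, 1], continuous f}.
  apply: continuous_withinP => x e; rewrite /= in_itv/= => hx ep.
  have L0 : 0 < Cq * sz f by rewrite mulr_gt0// path_sz_gt0.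
  exists (e / (Cq * sz f)); first by rewrite divr_gt0.
  move=> y; rewrite /= in_itv/= => hy yx.
  by apply: le_lt_trans (path_dist_le ps hy hx) _; rewrite mulrC -ltr_pdivlMr.
have [|x] := IVT (@ler01 R) cf (v := z).
  have -> : Num.max (f 0) (f 1) = left_of f + sz f; last exact: zin.
  rewrite /left_of /sz; case: (leP (f 0) (f 1)) => h; first by rewrite ger0_norm ?subr_ge0//; ring.
  by rewrite ltr0_norm ?subr_lt0//; ring.
by rewrite in_itv /= => hx fx; exists x.
Qed.

Lemma path_left_of a s x : path (trans g) a s -> 0 <= x <= 1 ->
  left_of (inverse_path g a s) <= inverse_path g a s x
    <= left_of (inverse_path g a s) + sz (inverse_path g a s).
Proof.
move=> ps hx; set f := inverse_path g a s.
have := path_dist_sz ps hx (@unit0 R); have := path_dist_sz ps hx (@unit1 R).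
rewrite -/f /left_of !ler_norml /sz; case: (leP (f 0) (f 1)) => h.
  rewrite ger0_norm ?subr_ge0// => /andP[h1 h2] /andP[h3 h4]; apply/andP; split; lra.
by rewrite ltr0_norm ?subr_lt0// => /andP[h1 h2] /andP[h3 h4]; apply/andP; split; lra.
Qed.

(** Otherwise the left end of one interval would belong to the other, and the two words would
    meet. *)
Lemma sect_separated a rho s t : 0 < rho -> sect a rho s -> sect a rho t -> s != t ->
  sect_ratio * rho <= `|left_of (inverse_path g a s) - left_of (inverse_path g a t)|.
Proof.
move=> rho0; wlog le : s t / left_of (inverse_path g a s) <= left_of (inverse_path g a t).
  move=> H hs ht st; have [le|/ltW le] := leP (left_of (inverse_path g a s)) (left_of (inverse_path g a t)).
    exact: H.
  by rewrite distrC; apply: H => //; rewrite eq_sym.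
move=> hs ht st; have [ps _ _] := hs; have [pt _ _] := ht.
apply: le_trans (sect_sz_ge hs) _; rewrite distrC ger0_norm ?subr_ge0//.
rewrite leNgt; apply/negP => lt.
have [|x hx fx] := path_ivt (z := left_of (inverse_path g a t)) ps.
  by rewrite le/= addrC -lerBlDr ltW.
have [|y hy fy] := path_ivt (z := left_of (inverse_path g a t)) pt.
  by rewrite lexx lerDl normr_ge0.
by move/eqP: st; apply; apply: (sect_disjoint hs ht hx hy); rewrite fx fy.
Qed.

(** An interval that meets the window starts at most [rho] before it; left ends are then counted by
    separation. *)
Lemma sect_packing a rho lo len (L : seq (seq A)) : 0 < rho -> 0 <= len -> uniq L ->
  (forall s, s \in L -> sect a rho s /\
     exists2 x, 0 <= x <= 1 & lo <= inverse_path g a s x <= lo + len) ->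
  (size L)%:R <= (len + rho) / (sect_ratio * rho) + 1.
Proof.
move=> rho0 len0 uL h.
apply: (separated_count (pos := fun s => left_of (inverse_path g a s)) (lo := lo - rho)) => //.
- by rewrite mulr_gt0// sect_ratio_gt0.
- move=> s /h[[ps sr _] [x hx /andP[h1 h2]]].
  by have /andP[h3 h4] := path_left_of ps hx; apply/andP; split; lra.
- by move=> s t /h[hs _] /h[ht _] st; exact: sect_separated.
- by rewrite addr_ge0// ltW.
Qed.

Lemma sect_cover a rho lo len : 0 < rho < 1 -> 0 <= len ->
  exists L : seq (seq A), [/\ uniq L, (size L)%:R <= (len + rho) / (sect_ratio * rho) + 1,
    forall s, s \in L -> sect a rho s &
    forall x, slice g a x -> lo <= x <= lo + len -> exists s y,
      [/\ s \in L, slice g (last a s) y & x = inverse_path g a s y]].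
Proof.
move=> rho01 len0; have /andP[rho0 rho1] := rho01.
pose P s := sect a rho s /\ exists2 x, 0 <= x <= 1 & lo <= inverse_path g a s x <= lo + len.
have [L [uL LP]] : exists L : seq (seq A), uniq L /\ forall s, s \in L <-> P s.
  apply: (enum_bounded (B := Num.truncn ((len + rho) / (sect_ratio * rho) + 1))) => L uL h.
  have le := sect_packing rho0 len0 uL h.
  by rewrite truncn_ge_nat// (le_trans _ le).
exists L; split=> //.
- by apply: (sect_packing (a := a) (lo := lo) rho0 len0 uL) => s sL; exact: (proj1 (LP s) sL).
- by move=> s /LP[].
move=> x Kx xin; have [s [y [hs Ky xE]]] := sect_point rho01 Kx.
exists s, y; split=> //; apply/LP; split=> //; exists y; last by rewrite -xE.
exact: (slice_unit hg Ky).
Qed.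

End Sections.

(** * Covering numbers and Hausdorff dimension *)

Section CoveringNumbers.
Context {R : realType} {A : finType} (g : expanding_data R A) (r : \bar R).
Variables (e0 m k C : R).
Hypotheses (r1 : (1 < r)%E) (hg : expanding g r) (e01 : 0 < e0 <= 1)
  (m01 : 0 < m < 1) (k01 : 0 < k < 1) (C0 : 0 <= C)
  (hb : forall a b, trans g a b -> contracting_branch m k C e0 (inverse_branch g a b)).

Notation CQ := (Cq e0 k C).
Notation ratio := (sect_ratio e0 m k C).

Let CQ1 : 1 <= CQ. Proof. exact: (Cq_ge1 e01 k01 C0). Qed.
Let CQ0 : 0 < CQ. Proof. exact: lt_le_trans CQ1. Qed.
Let ratio0 : 0 < ratio. Proof. exact: sect_ratio_gt0. Qed.

Lemma powR_le1 (x a : R) : 0 <= a -> 0 <= x <= 1 -> x `^ a <= 1.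
Proof.
move=> a0 /andP[x0 x1]; apply: le_trans (_ : 1 `^ a <= _); last by rewrite powR1.
by apply: ge0_ler_powR; rewrite ?nnegrE.
Qed.

Definition covering (S : set R) (e : R) (l : seq R) : Prop :=
  (forall c, c \in l -> 0 <= c <= 1) /\
  forall x, S x -> exists2 c, c \in l & `|x - c| <= e.

Lemma covering_grid (S : set R) (e : R) : 0 < e <= 1 ->
  (forall x, S x -> 0 <= x <= 1) ->
  exists2 l, (size l)%:R <= 2 / e & covering S e l.
Proof.
move=> /andP[ep e1] S01; exists [seq i%:R * e | i <- iota 0 (Num.truncn e^-1).+1].
  rewrite size_map size_iota -natr1 (_ : 2 / e = e^-1 + e^-1); last by ring.
  by rewrite lerD// ?invf_ge1// truncn_le// invr_ge0 ltW.
split=> [c /mapP[i]|x /S01 /andP[x0 x1]].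
  rewrite mem_iota add0n ltnS => /andP[_ ie] ->; apply/andP; split; first by rewrite mulr_ge0// ltW.
  rewrite -ler_pdivlMr// div1r; apply: le_trans (_ : (Num.truncn e^-1)%:R <= _).
    by rewrite ler_nat.
  by rewrite truncn_le// invr_ge0 ltW.
have xe : 0 <= x / e by rewrite divr_ge0// ltW.
exists ((Num.truncn (x / e))%:R * e).
  apply/mapP; exists (Num.truncn (x / e)) => //; rewrite mem_iota add0n ltnS /=.
  by apply: le_truncn; rewrite ler_pdivrMr// mulVf ?gt_eqF.
have /andP[h1 h2] := truncn_itv xe.
rewrite ler_pdivlMr// in h1; rewrite ltr_pdivrMr// -natr1 mulrDl mul1r in h2.
by rewrite ger0_norm ?subr_ge0// lerBlDl ltW.
Qed.

(** Self-similarity: each word of the section at scale [rho] that meets the window carries a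
    covering of a slice at scale [e / (CQ * rho)] to a covering at scale [e]. *)
Lemma local_cover a rho lo len e (n : R) : 0 < rho < 1 -> 0 <= len -> 0 <= n ->
  (forall b, exists2 l, (size l)%:R <= n & covering (slice g b) (e / (CQ * rho)) l) ->
  exists2 l, (size l)%:R <= ((len + rho) / (ratio * rho) + 1) * n &
    covering [set x | slice g a x /\ lo <= x <= lo + len] e l.
Proof.
move=> rho01 len0 n0 hn; have /andP[rho0 _] := rho01.
have /choice[lb lbP] b : exists l : seq R,
    (size l)%:R <= n /\ covering (slice g b) (e / (CQ * rho)) l.
  by have [l h1 h2] := hn b; exists l.
have [L [uL sL LP Lcov]] := sect_cover hg e01 m01 k01 C0 hb a lo rho01 len0.
exists (flatten [seq [seq inverse_path g a s c | c <- lb (last a s)] | s <- L]).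
  apply: le_trans (_ : (size L)%:R * n <= _); last by rewrite ler_wpM2r.
  elim: (L) => [|s L' IH] /=; first by rewrite mul0r.
  rewrite size_cat size_map natrD -add1n natrD mulrDl mul1r lerD//.
  by have [h _] := lbP (last a s).
split=> [c /flatten_mapP[s sinL /mapP[c' c'l ->]]|x [Kx xin]].
  have [ps _ _] := LP _ sinL; apply: (path_unit e01 m01 k01 C0 hb ps).
  by have [_ [h _]] := lbP (last a s); exact: h.
have [s [y [sinL Ky ->]]] := Lcov _ Kx xin.
have [_ [lb01 lbc]] := lbP (last a s); have [c cl yc] := lbc _ Ky.
have [ps ss _] := LP _ sinL.
exists (inverse_path g a s c); first by apply/flatten_mapP; exists s => //; apply/mapP; exists c.
apply: le_trans (path_dist_le e01 m01 k01 C0 hb ps (slice_unit hg Ky) (lb01 _ cl)) _.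
apply: le_trans (_ : CQ * rho * (e / (CQ * rho)) <= _).
  by rewrite ler_pM ?mulr_ge0 ?(ltW CQ0) ?normr_ge0// ler_pM2l.
by rewrite mulrCA divff ?mulr1// gt_eqF// mulr_gt0.
Qed.

Let scompact a : compact (slice g a).
Proof. exact: (slice_compact hg e01 m01 k01 C0 hb). Qed.

(** A finite cover by sets of radii [rad i] yields, through [local_cover], a recursion: the covering
    number at scale [e] is at most [B] times the sum over [i] of those at scales [e / (CQ * rad i)].
    A bound [M * e ^ (- s)] at larger scales reproduces itself as soon as the sum of the [rad i ^ s]
    is at most [1 / (B * CQ ^ s)], which [s > HD] allows. *)
Lemma covering_number_le (s : R) : (HD (cantor_set g) < s%:E)%E ->
  exists2 M : R, 0 <= M & forall a e, 0 < e <= 1 ->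
    exists2 l, (size l)%:R <= M * e `^ (- s) & covering (slice g a) e l.
Proof.
move=> HDs; have s0 : 0 < s by rewrite -lte_fin; apply: le_lt_trans HDs; exact: HD_ge0.
(* [B] counts the section words in a window of length [4 * rad i]; [delta] makes the scale at least
   double at each recursion, which therefore ends; [eta] closes the recursion. *)
pose B := 5 / ratio + 1.
have B0 : 0 < B by rewrite ltr_wpDl// divr_ge0// ltW.
pose delta := (2 * CQ)^-1.
have delta0 : 0 < delta by rewrite invr_gt0 mulr_gt0.
pose eta := (B * CQ `^ s)^-1.
have eta0 : 0 < eta by rewrite invr_gt0 mulr_gt0// powR_gt0.
have [U [rad [KU rad0 Urad sumr]]] := HD_lt_cover HDs delta0 eta0.
have radp i : 0 < rad i by have /andP[] := rad0 i.
have radC i : CQ * rad i <= 2^-1.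
  have /andP[_ h] := rad0 i; apply: le_trans (_ : CQ * delta <= _); first by rewrite ler_pM2l.
  by rewrite /delta invfM mulrCA divff ?mulr1// gt_eqF.
have rad1 i : 0 < rad i < 1.
  rewrite radp/=; apply: le_lt_trans (_ : CQ * rad i < 1); first by rewrite ler_peMl// ltW.
  by apply: le_lt_trans (radC i) _; rewrite invf_lt1// ltr1n.
(* Open neighbourhoods of the traces of the [U i], so that compactness leaves finitely many. *)
pose O a i : set R := [set x | exists z, U i (z, a) /\ `|x - z| < rad i].
have Oopen a i : open (O a i).
  rewrite openE => x [z [Uz xz]]; apply/nbhs_ballP.
  exists (rad i - `|x - z|); first by rewrite /= subr_gt0.
  move=> y; rewrite -ball_normE /= => xy; exists z; split=> //.
  rewrite (_ : y - z = (x - z) - (x - y)); last by ring.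
  by apply: le_lt_trans (ler_normB _ _) _; rewrite addrC -ltrBrDr.
have [N NP] : exists N, forall a x, slice g a x -> exists2 i, (i < N)%N & O a i x.
  have /choice[Na NaP] a : exists N, forall x, slice g a x -> exists2 i, (i < N)%N & O a i x.
    have := @scompact a; rewrite compact_cover => /(_ nat setT (O a)).
    case=> [i _|x Kx|D' _ cov]; first exact: Oopen.
      have [i _ Ui] := KU (x, a) Kx; exists i => //; exists x; split=> //.
      by rewrite subrr normr0.
    exists (\max_(i <- enum_fset D') i).+1 => x /cov[i /= iD Ox]; exists i => //.
    by rewrite ltnS; exact: (@leq_bigmax_seq _ (enum_fset D') xpredT id i iD).
  exists (\max_a Na a) => a x Kx; have [i iN Ox] := NaP _ _ Kx; exists i => //.
  by apply: leq_trans iN _; exact: leq_bigmax.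
(* Up to [e1] every scale [e / (CQ * rad i)] is at most [1]; above [e1] a grid of [M = 2 / e1]
   points suffices. *)
pose e1 := CQ * \big[Num.min/delta]_(i < N) rad i.
have mp : 0 < \big[Num.min/delta]_(i < N) rad i by apply/bigmin_gtP; split.
have e10 : 0 < e1 by rewrite mulr_gt0.
pose M := 2 / e1; have M0 : 0 < M by rewrite divr_gt0.
exists M; first exact: ltW.
suff H n : forall e, 2^-1 ^+ n <= e -> e <= 1 -> forall a,
    exists2 l, (size l)%:R <= M * e `^ (- s) & covering (slice g a) e l.
  move=> a e /andP[ep e1']; have [n hn] : exists n, 2^-1 ^+ n < e.
    by apply: expr_small => //; rewrite invr_ge0 invf_lt1// ler0n ltr1n.
  exact: H (ltW hn) e1' a.
have triv e a : e1 < e -> e <= 1 ->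
    exists2 l, (size l)%:R <= M * e `^ (- s) & covering (slice g a) e l.
  move=> ee1 he; have ep : 0 < e by exact: lt_trans ee1.
  have ep1 : 0 < e <= 1 by rewrite ep.
  have [l ls lc] := covering_grid ep1 (fun x => @slice_unit R A g r hg a x).
  exists l => //; apply: le_trans ls _; apply: le_trans (_ : M <= _).
    by rewrite /M ler_pM2l// lef_pV2 ?posrE// ltW.
  rewrite ler_peMr ?(ltW M0)// powRN invf_ge1 ?powR_gt0//.
  by apply: powR_le1; rewrite ?(ltW s0)// (ltW ep).
elim: n => [|n IH] e hn he a.
  apply: triv => //; rewrite expr0 in hn; apply: lt_le_trans hn.
  apply: le_lt_trans (_ : 2^-1 < 1); last by rewrite invf_lt1// ltr1n.
  apply: le_trans (_ : CQ * delta <= _); first by rewrite ler_pM2l// bigmin_le_id.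
  by rewrite /delta invfM mulrCA divff ?mulr1// gt_eqF.
have [ee1|ee1] := ltP e1 e; first exact: triv.
have ep : 0 < e by apply: lt_le_trans hn; rewrite exprn_gt0// invr_gt0.
have ei i : (i < N)%N -> 2 * e <= e / (CQ * rad i) <= 1.
  move=> iN; have p : 0 < CQ * rad i by rewrite mulr_gt0.
  rewrite ler_pdivlMr// ler_pdivrMr// mul1r; apply/andP; split.
    by rewrite mulrAC -[leRHS]mul1r ler_pM2r// -ler_pdivlMl// mulr1.
  apply: le_trans ee1 _; rewrite /e1 ler_pM2l//.
  exact: (@bigmin_le _ _ _ _ (Ordinal iN) (fun i : 'I_N => rad i)).
have loc i : exists2 l, (i < N)%N -> (size l)%:R <= B * (M * (e / (CQ * rad i)) `^ (- s)) &
    (i < N)%N -> covering [set x | slice g a x /\ O a i x] e l.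
  have [iN|_] := boolP (i < N)%N; last by exists [::].
  have [[z Uz]|nz] := pselect (exists z, U i (z, a)); last first.
    exists [::] => _ /=; first by rewrite mulr_ge0 ?(ltW B0)// mulr_ge0 ?powR_ge0// ltW.
    by split=> // x [_ [z [Uz _]]]; exfalso; apply: nz; exists z.
  have /andP[h1 h2] := ei _ iN.
  have [||b|l ls [l01 lc]] := @local_cover a (rad i) (z - 2 * rad i) (4 * rad i) e
      (M * (e / (CQ * rad i)) `^ (- s)) (rad1 i).
  - by rewrite mulr_ge0// ltW.
  - by rewrite mulr_ge0 ?powR_ge0// ltW.
  - apply: IH => //; apply: le_trans h1.
    by move: hn; rewrite exprS ler_pdivrMl.
  exists l => _.
    apply: le_trans ls _; apply: ler_wpM2r.
      by apply: mulr_ge0; [exact: ltW|exact: powR_ge0].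
    apply: le_of_eq; rewrite /B; field.
    by rewrite (gt_eqF (radp i)) (gt_eqF ratio0).
  split=> // x [Kx [z' [Uz' xz']]]; apply: lc; split=> //.
  have := Urad i _ _ Uz Uz'; move=> [/= zz _]; move: zz; rewrite -ball_normE /= => zz.
  move: xz' zz; rewrite !ltr_norml => /andP[a1 a2] /andP[a3 a4].
  by apply/andP; split; lra.
have /choice[l lP] : forall i, exists l : seq R, (i < N)%N ->
   (size l)%:R <= B * (M * (e / (CQ * rad i)) `^ (- s)) /\
   covering [set x | slice g a x /\ O a i x] e l.
  by move=> i; have [l h1 h2] := loc i; exists l => iN; split; [exact: h1|exact: h2].
exists (flatten [seq l i | i <- iota 0 N]).
  apply: le_trans (_ : \sum_(i < N) B * (M * (e / (CQ * rad i)) `^ (- s)) <= _).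
    rewrite size_flatten /shape -map_comp sumnE big_map natr_sum.
    rewrite -[X in iota 0 X]subn0 -/(index_iota 0 N) big_mkord.
    by apply: ler_sum => i _; have [] := lP i (ltn_ord i).
  apply: le_trans (_ : \sum_(i < N) (M * e `^ (- s) * (B * CQ `^ s)) * rad i `^ s <= _).
    apply: ler_sum => i _; apply: le_of_eq.
    rewrite powRM ?(ltW ep) ?invr_ge0 ?mulr_ge0 ?(ltW CQ0) ?(ltW (radp i))//.
    rewrite -[(CQ * rad i)^-1]powR_inv1 ?mulr_ge0 ?(ltW CQ0) ?(ltW (radp i))//.
    rewrite -powRrM mulN1r opprK powRM ?(ltW CQ0) ?(ltW (radp i))//.
    by ring.
  have BC : 0 < B * CQ `^ s by rewrite mulr_gt0// powR_gt0.
  have Me : 0 <= M * e `^ (- s) by apply: mulr_ge0; [exact: ltW|exact: powR_ge0].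
  rewrite -mulr_sumr; apply: le_trans (ler_wpM2l _ (sumr N)) _.
    exact: (mulr_ge0 Me (ltW BC)).
  by rewrite /eta mulfK ?gt_eqF.
split=> [c /flatten_mapP[i]|x Kx].
  by rewrite mem_iota add0n => /andP[_ iN] cl; have [_ [h _]] := lP _ iN; exact: h.
have [i iN Ox] := NP _ _ Kx; have [_ [_ h]] := lP _ iN.
have [c cl xc] := h x (conj Kx Ox); exists c => //.
by apply/flatten_mapP; exists i => //; rewrite mem_iota add0n.
Qed.

End CoveringNumbers.

(** * Counting words from above and from below *)

Section Families.
Context {R : realType} {A : finType} (g : expanding_data R A) (r : \bar R).
Variables (e0 m k C : R).
Hypotheses (r1 : (1 < r)%E) (hg : expanding g r) (e01 : 0 < e0 <= 1)
  (m01 : 0 < m < 1) (k01 : 0 < k < 1) (C0 : 0 <= C)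
  (hb : forall a b, trans g a b -> contracting_branch m k C e0 (inverse_branch g a b)).

Notation CQ := (Cq e0 k C).
Notation ratio := (sect_ratio e0 m k C).

Let CQ1 : 1 <= CQ. Proof. exact: (Cq_ge1 e01 k01 C0). Qed.
Let CQ0 : 0 < CQ. Proof. exact: lt_le_trans CQ1. Qed.
Let ratio0 : 0 < ratio. Proof. exact: sect_ratio_gt0. Qed.

Lemma powRV (x a : R) : 0 <= x -> x^-1 `^ a = x `^ (- a).
Proof. by move=> x0; rewrite -powR_inv1// -powRrM mulN1r. Qed.

(** By self-similarity at scale [t], a window of length [2 * t] is covered by a multiple of
    [(t / e) ^ s] balls of radius [e], and such a ball meets a bounded number of intervals of the
    section at scale [e]. For [t >= 1] a covering of the whole slice is used. *)
Lemma sect_point_count (s : R) : (HD (cantor_set g) < s%:E)%E ->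
  exists2 B : R, 0 <= B & forall a e t lo (y : seq A -> R) (L : seq (seq A)),
    0 < e < 1 -> e <= t -> uniq L ->
    (forall v, v \in L -> [/\ sect g a e v, slice g (last a v) (y v) &
       lo <= inverse_path g a v (y v) <= lo + 2 * t]) ->
    (size L)%:R <= B * (t / e) `^ s.
Proof.
move=> HDs; have s0 : 0 < s by rewrite -lte_fin; apply: le_lt_trans HDs; exact: HD_ge0.
have [M M0 HM] := covering_number_le hg e01 m01 k01 C0 hb HDs.
pose B1 := Num.truncn (3 / ratio + 1); pose B2 := (3 / ratio + 1) * CQ `^ s.
have r30 : 0 <= 3 / ratio + 1 by rewrite addr_ge0// divr_ge0// ltW.
have CQs : 1 <= CQ `^ s.
  rewrite -(powRr0 CQ); apply: ler_powR => //; exact: ltW.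
have B21 : 1 <= B2.
  rewrite /B2 -[leLHS]mulr1; apply: ler_pM => //.
  by rewrite lerDr divr_ge0// ltW.
exists (B2 * M * B1%:R); first by rewrite !mulr_ge0// (le_trans ler01).
move=> a e t lo y L /andP[ep e1] et uL LP.
have tp : 0 < t by exact: lt_le_trans et.
pose S : set R := [set x | slice g a x /\ lo <= x <= lo + 2 * t].
have [l ls [l01 lc]] : exists2 l, (size l)%:R <= B2 * M * (t / e) `^ s & covering S e l.
  have [t1|t1] := ltP t 1.
    have t01 : 0 < t < 1 by rewrite tp.
    have ect : 0 < e / (CQ * t) <= 1.
      rewrite divr_gt0 ?mulr_gt0//= ler_pdivrMr ?mulr_gt0// mul1r.
      by apply: le_trans et _; rewrite ler_peMl// ltW.
    have n0 : 0 <= M * (e / (CQ * t)) `^ (- s) by rewrite mulr_ge0// powR_ge0.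
    have len0 : 0 <= 2 * t by rewrite mulr_ge0// ltW.
    have [l ls lc] := local_cover hg e01 m01 k01 C0 hb a lo t01 len0 n0 (fun b => HM b _ ect).
    exists l => //; apply: le_trans ls _; apply: le_of_eq.
    have -> : (e / (CQ * t)) `^ (- s) = CQ `^ s * (t / e) `^ s.
      rewrite -powRM ?divr_ge0 ?(ltW ep) ?(ltW tp) ?(ltW CQ0)//.
      rewrite -powRV ?divr_ge0 ?mulr_ge0 ?(ltW ep) ?(ltW tp) ?(ltW CQ0)//.
      by rewrite invf_div mulrA.
    rewrite (_ : (2 * t + t) / (ratio * t) = 3 / ratio); last first.
      by field; rewrite (gt_eqF tp) (gt_eqF ratio0).
    by rewrite /B2; ring.
  have e01' : 0 < e <= 1 by rewrite ep ltW.
  have [l ls [l01 lc]] := HM a e e01'; exists l; last first.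
    by split=> // x [Kx _]; exact: lc.
  apply: le_trans ls _; apply: ler_pM; rewrite ?powR_ge0//; first by rewrite ler_peMl.
  rewrite -powRV ?(ltW ep)//; apply: ge0_ler_powR.
  - exact: ltW.
  - by rewrite nnegrE invr_ge0 ltW.
  - by rewrite nnegrE divr_ge0// ltW.
  - by rewrite ler_peMl// invr_ge0 ltW.
have sz : (size L <= size l * B1)%N.
  apply: (leq_sum_count (e := fun v c => `|inverse_path g a v (y v) - c| <= e)) => [v vL|c cl].
    by have [hs hy hin] := LP _ vL; apply: lc; split=> //; have [ps _ _] := hs; apply: (path_slice hg ps).
  rewrite -size_filter truncn_ge_nat//.
  have eL0 : 0 <= 2 * e by rewrite mulr_ge0// ltW.
  have := sect_packing hg e01 m01 k01 C0 hb (a := a) (lo := c - e) ep eL0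
    (filter_uniq (fun v => `|inverse_path g a v (y v) - c| <= e) uL).
  have -> : (2 * e + e) / (ratio * e) = 3 / ratio.
    by field; rewrite (gt_eqF ep) (gt_eqF ratio0).
  apply=> v; rewrite mem_filter => /andP[hv vL]; have [hs hy _] := LP _ vL; split=> //.
  exists (y v); first exact: (slice_unit hg hy).
  by move: hv; rewrite ler_norml => /andP[h1 h2]; apply/andP; split; lra.
apply: le_trans (_ : (size l)%:R * B1%:R <= _); first by rewrite -natrM ler_nat.
by rewrite mulrAC ler_wpM2r.
Qed.

Lemma size_sum_count (T : Type) (f : T -> A) (L : seq T) :
  size L = \sum_b count (fun v => f v == b) L.
Proof.
elim: L => [|v L IH] /=; first by rewrite big1.
rewrite big_split/= -IH (bigD1 (f v))//= eqxx big1 ?addn0// => b.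
by rewrite eq_sym => /negbTE ->.
Qed.

(** The intervals of the sections cover the Cantor set, so too few of them would contradict its
    dimension; one pair of end letters gets a fixed share of the words. *)
Lemma sect_many (s : R) : 0 <= s -> (s%:E < HD (cantor_set g))%E ->
  exists c eps : R, [/\ 0 < c, 0 < eps & forall e, 0 < e < eps -> e < 1 ->
    exists (a b : A) (L : seq (seq A)), [/\ uniq L,
      forall v, v \in L -> sect g a e v /\ last a v = b &
      c * e `^ (- s) <= (size L)%:R]].
Proof.
move=> s0 sHD; have [c [delta [c0 delta0 HDc]]] := HD_gt_count s0 sHD.
pose nA : R := 2 * (#|A|%:R * #|A|%:R + 1).
have nA0 : 0 < nA by rewrite mulr_gt0// ltr_wpDl// mulr_ge0.
pose c' := c / 2 `^ s / nA.
have c'0 : 0 < c' by rewrite !divr_gt0// powR_gt0.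
exists c', (delta / 2); split=> //; first by rewrite divr_gt0.
move=> e /andP[ep ed] e1; have e01' : 0 < e < 1 by rewrite ep.
have /choice[La LaP] a : exists L : seq (seq A), [/\ uniq L,
    forall v, v \in L -> sect g a e v &
    forall x, slice g a x -> exists v y,
      [/\ v \in L, slice g (last a v) y & x = inverse_path g a v y]].
  have [L [uL _ h1 h2]] := sect_cover hg e01 m01 k01 C0 hb a 0 e01' (@ler01 R).
  exists L; split=> // x Kx; apply: h2 => //.
  by rewrite add0r; exact: (slice_unit hg Kx).
apply: contrapT => nex.
have small a b : (count (fun v => last a v == b) (La a))%:R <= c' * e `^ (- s).
  rewrite leNgt; apply/negP => lt; apply: nex.
  have [uL h1 _] := LaP a.
  exists a, b, [seq v <- La a | last a v == b]; split.
  - exact: filter_uniq.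
  - by move=> v; rewrite mem_filter => /andP[/eqP -> vL]; split=> //; exact: h1.
  - by rewrite size_filter ltW.
pose T := flatten [seq [seq (a, v) | v <- La a] | a <- enum A].
pose tr (j : nat) : set (lines R A) :=
  [set z | (j < size T)%N /\ exists a v y, [/\ onth T j = Some (a, v), z.2 = a,
     v \in La a, 0 <= y <= 1 & z.1 = inverse_path g a v y]].
have trcov : cantor_set g `<=` \bigcup_(i in `I_(size T)) tr i.
  move=> [x a] Kx; have [_ _ h] := LaP a; have [v [y [vL Ky xE]]] := h x Kx.
  have avT : (a, v) \in T.
    by apply/flatten_mapP; exists a; [rewrite mem_enum|apply/mapP; exists v].
  exists (index (a, v) T) => /=; first by rewrite index_mem.
  split; first by rewrite index_mem.
  exists a, v, y; split=> //; last exact: (slice_unit hg Ky).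
  by rewrite onthE (nth_map (a, v)) ?index_mem// nth_index.
have trsmall i : small_in (2 * e) (tr i).
  move=> [x a] [x' a'] [_ [b [v [y [ov /= -> vL hy ->]]]]] [_ [b' [v' [y' [ov' /= -> _ hy' ->]]]]].
  move: ov'; rewrite ov => -[<- <-]; split=> //=.
  have [_ hs _] := LaP b; have [ps ss _] := hs _ vL.
  rewrite -ball_normE /=; apply: le_lt_trans (path_dist_sz e01 m01 k01 C0 hb ps hy hy') _.
  by apply: le_lt_trans ss _; rewrite ltr_pMl// ltr1n.
have := HDc (size T) tr (2 * e) _ trcov trsmall.
have h2e : 0 < 2 * e <= delta.
  by rewrite mulr_gt0//= mulrC -ler_pdivlMr// ltW.
move=> /(_ h2e); apply/negP; rewrite -ltNge.
have sT : (size T)%:R <= #|A|%:R * #|A|%:R * (c' * e `^ (- s)).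
  rewrite /T size_flatten /shape -map_comp sumnE big_map big_enum/= natr_sum.
  apply: le_trans (_ : \sum_(a : A) \sum_(b : A) c' * e `^ (- s) <= _); last first.
    by rewrite !sumr_const -mulrnA -[leLHS]mulr_natl natrM.
  apply: ler_sum => a _; rewrite size_map (size_sum_count (last a)) natr_sum.
  by apply: ler_sum => b _.
apply: le_lt_trans (ler_wpM2r (powR_ge0 _ _) sT) _.
have es : e `^ (- s) * (2 * e) `^ s = 2 `^ s.
  rewrite powRM ?(ltW ep)// mulrCA -powRD; last by apply/implyP => _; rewrite gt_eqF.
  by rewrite addNr powRr0 mulr1.
rewrite [ltLHS](_ : _ = #|A|%:R * #|A|%:R * c' * (e `^ (- s) * (2 * e) `^ s)); last by ring.
rewrite es /c'; rewrite [ltLHS](_ : _ = (#|A|%:R * #|A|%:R) / nA * c); last first.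
  by field; rewrite (gt_eqF nA0) gt_eqF// powR_gt0.
rewrite gtr_pMl// ltr_pdivrMr// mul1r /nA.
have : 0 <= #|A|%:R * #|A|%:R :> R by rewrite mulr_ge0.
by move: (_ * _) => z z0; lra.
Qed.

End Families.

Section LoopFamilies.
Context {R : realType} {A : finType} (g : expanding_data R A) (r : \bar R).
Variables (e0 m k C : R).
Hypotheses (r1 : (1 < r)%E) (hg : expanding g r) (e01 : 0 < e0 <= 1)
  (m01 : 0 < m < 1) (k01 : 0 < k < 1) (C0 : 0 <= C)
  (hb : forall a b, trans g a b -> contracting_branch m k C e0 (inverse_branch g a b)).

Notation CQ := (Cq e0 k C).
Notation ratio := (sect_ratio e0 m k C).

Let CQ1 : 1 <= CQ. Proof. exact: (Cq_ge1 e01 k01 C0). Qed.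
Let CQ0 : 0 < CQ. Proof. exact: lt_le_trans CQ1. Qed.
Let ratio0 : 0 < ratio. Proof. exact: sect_ratio_gt0. Qed.
Let pb := path_branch e01 m01 k01 C0 hb.

(** For [eta > d] the exponent makes the required number at most [1], and the word of the point [o]
    is enough. *)
Lemma many_words a0 o (d eta : R) : slice g a0 o -> HD (cantor_set g) = d%:E ->
  0 < eta -> exists c eps : R, [/\ 0 < c, 0 < eps & forall e, 0 < e < eps -> e < 1 ->
    exists (a b : A) (L : seq (seq A)), [/\ uniq L,
      forall v, v \in L -> sect g a e v /\ last a v = b &
      c * e `^ (- (d - eta)) <= (size L)%:R]].
Proof.
move=> Ko HDd eta0; have [ed|de] := leP eta d.
  apply: (sect_many hg e01 m01 k01 C0 hb); first by rewrite subr_ge0.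
  by rewrite HDd lte_fin ltrBlDr ltrDl.
exists 1, 1; split=> // e /andP[ep _] e1; have ep1 : 0 < e < 1 by rewrite ep.
have [s [y [hs _ _]]] := sect_point hg e01 m01 k01 C0 hb ep1 Ko.
exists a0, (last a0 s), [:: s]; split=> //.
  by move=> v; rewrite inE => /eqP ->.
rewrite mul1r opprB; apply: powR_le1; first by rewrite subr_ge0 ltW.
by rewrite (ltW ep) ltW.
Qed.

(** Fixed connecting words turn words from [a] to [b] into loops at [a0], at the price of constants.
    The proportion of loops sending [o] into a window is then an upper count at exponent [d + eta1]
    divided by a lower count at [d - eta1]. *)
Lemma loop_families a0 o (d : R) : slice g a0 o -> HD (cantor_set g) = d%:E ->
  exists2 c1, 0 < c1 <= 1 & has_families (loop_map g a0) o d c1.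
Proof.
move=> Ko HDd; have /andP[m0 m1] := m01; have /andP[k0 k1] := k01.
have d0 : 0 <= d by rewrite -lee_fin -HDd HD_ge0.
have /choice[cn cnP] (bc : A * A) : exists s, path (trans g) bc.1 s /\ last bc.1 s = bc.2.
  exact: (connected_letters hg).
pose N := (\sum_bc size (cn bc))%N.
have szN bc : (size (cn bc) <= N)%N by rewrite /N (bigD1 bc)//= leq_addr.
have mN0 : 0 < m ^+ N by rewrite exprn_gt0.
have mNle bc : m ^+ N <= m ^+ size (cn bc) by apply: ler_wiXn2l (szN bc); rewrite ?ltW.
have CQi1 : CQ^-1 <= 1 by rewrite invf_le1.
have CQi0 : 0 < CQ^-1 by rewrite invr_gt0.
have ratio1 : ratio <= 1.
  by rewrite /sect_ratio; apply: mulr_ile1; rewrite ?(ltW CQi0) ?(ltW m0) ?(ltW m1).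
have mN1 : m ^+ N <= 1 by rewrite exprn_ile1// ltW.
pose c1 := m ^+ N * (CQ^-1 * ratio * m ^+ N).
have c10 : 0 < c1 by apply: mulr_gt0 => //; apply: mulr_gt0 => //; apply: mulr_gt0.
exists c1.
  rewrite c10/=; apply: mulr_ile1; rewrite ?(ltW mN0)//.
    by apply: mulr_ge0; rewrite ?(ltW mN0)//; apply: mulr_ge0; apply: ltW.
  apply: mulr_ile1; rewrite ?(ltW mN0)//.
    by apply: mulr_ge0; apply: ltW.
  by apply: mulr_ile1; rewrite ?(ltW CQi0) ?(ltW ratio0).
(* Of the four parts of [eta], two pay for the exponents [d + eta1] and [d - eta1], and two absorb
   the constant [B']. *)
move=> eta eta0; pose eta1 := eta / 4.
have eta10 : 0 < eta1 by rewrite divr_gt0.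
have HDs : (HD (cantor_set g) < (d + eta1)%:E)%E by rewrite HDd lte_fin ltrDl.
have [B B0 HB] := sect_point_count hg e01 m01 k01 C0 hb HDs.
have [c [eps1 [c0 eps10 many]]] := many_words Ko HDd eta10.
pose B' := B * (m ^+ N)^-1 `^ (d + eta1) / c.
have e2 : 0 < 2 * eta1 by rewrite mulr_gt0.
have [eps2 eps20 small] := powR_small B' e2.
exists (Num.min 1 (Num.min eps1 eps2)); first by rewrite !lt_min ltr01 eps10.
move=> e; rewrite !lt_min => /andP[ep /and3P[e1 ee1 ee2]].
have ep1 : 0 < e < 1 by rewrite ep.
have epe1 : 0 < e < eps1 by rewrite ep.
have [a [b [L [uL LP sizeL]]]] := many _ epe1 e1.
have sL0 : 0 < (size L)%:R :> R.
  by apply: lt_le_trans sizeL; rewrite mulr_gt0// powR_gt0.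
pose p := cn (a0, a); pose q := cn (b, a0).
have [pp lp] := cnP (a0, a); have [pq lq] := cnP (b, a0); rewrite /= in pp lp pq lq.
pose word v := p ++ v ++ q.
have wordP v : v \in L -> [/\ path (trans g) a0 (word v), last a0 (word v) = a0 &
    inverse_path g a0 (word v) = inverse_path g a0 p \o inverse_path g a v \o inverse_path g b q].
  move=> vL; have [[pv _ _] lv] := LP _ vL; split.
  - by rewrite /word !cat_path pp lp pv lv pq.
  - by rewrite /word !last_cat lp lv lq.
  - by rewrite /word !inverse_path_cat lp lv.
have hp := pb pp; have hq := pb pq.
have q01 x : 0 <= x <= 1 -> 0 <= inverse_path g b q x <= 1 by exact: (branch_unit hq).
have v01 v x : v \in L -> 0 <= x <= 1 -> 0 <= inverse_path g a v x <= 1.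
  by move=> vL; have [[pv _ _] _] := LP _ vL; exact: (branch_unit (pb pv)).
exists (size L), (fun i => inverse_path g a0 (word (nth [::] L i))); split.
- by rewrite -(ltr0n R).
- move=> i; set v := nth _ _ _; have vL : v \in L by rewrite mem_nth.
  have [pw lw wE] := wordP _ vL; split; first by exists (word v).
  have [hs lv] := LP _ vL; have [pv sv _] := hs.
  have u1 := q01 _ (@unit1 R); have u0 := q01 _ (@unit0 R).
  have pk : k ^+ size p <= 1 by rewrite exprn_ile1// ltW.
  rewrite wE /sz /=; apply/andP; split; last first.
    apply: le_trans (branch_le hp (v01 _ _ vL u1) (v01 _ _ vL u0)) _.
    apply: le_trans (_ : 1 * e <= _); last by rewrite mul1r.
    apply: ler_pM => //; first by rewrite exprn_ge0// ltW.
    exact: le_trans (path_dist_sz e01 m01 k01 C0 hb pv u1 u0) sv.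
  apply: le_trans (branch_ge hp (v01 _ _ vL u1) (v01 _ _ vL u0)).
  rewrite /c1 -mulrA; apply: ler_pM; rewrite ?(ltW mN0) ?mNle//.
    apply: mulr_ge0; last exact: ltW.
    by apply: mulr_ge0; rewrite ?(ltW mN0)//; apply: mulr_ge0; apply: ltW.
  apply: le_trans (path_dist_ge e01 m01 k01 C0 hb pv u1 u0).
  rewrite mulrAC; apply: ler_pM; rewrite ?(ltW mN0)//.
  + by apply: mulr_ge0; rewrite ?(ltW ep)//; apply: mulr_ge0; apply: ltW.
  + by rewrite -mulrA ler_pM2l//; exact: (sect_sz_ge e01 m01 k01 C0 hb hs).
  + have := branch_ge hq (@unit1 R) (@unit0 R); rewrite subr0 normr1 mulr1.
    by apply: le_trans; exact: mNle.
move=> i t /andP[et t1]; set vi := nth _ _ _; have viL : vi \in L by rewrite mem_nth.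
have tp : 0 < t by exact: lt_le_trans et.
have [_ _ wiE] := wordP _ viL.
pose y := inverse_path g b q o; have Ky : slice g b y by apply: (path_slice hg pq); rewrite lq.
have y01 := slice_unit hg Ky.
pose close v := `|inverse_path g a0 (word v) o - inverse_path g a0 (word vi) o| <= t.
(* Removing the prefix [p] expands distances by at most [1 / m ^ N]. *)
pose t' := t / m ^+ N.
have tt' : t <= t' by rewrite ler_pdivlMr// ler_piMr// ltW.
have cnt := HB a e t' (inverse_path g a vi y - t') (fun=> y) [seq v <- L | close v] ep1
  (le_trans et tt') (filter_uniq close uL).
have {}cnt : (count close L)%:R <= B * (t' / e) `^ (d + eta1).
  rewrite -size_filter; apply: cnt => v; rewrite mem_filter => /andP[cv vL].
  have [hs lv] := LP _ vL; split=> //; first by rewrite lv.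
  have [_ _ wE] := wordP _ vL; move: cv; rewrite /close wE wiE /= -/y => cv.
  have := branch_ge hp (v01 _ _ vL y01) (v01 _ _ viL y01) => h.
  have {}h : m ^+ N * `|inverse_path g a v y - inverse_path g a vi y| <= t.
    by apply: le_trans (le_trans h cv); rewrite ler_wpM2r// mNle.
  move: h; rewrite mulrC -ler_pdivlMr// -/t' ler_norml => /andP[h1 h2].
  by apply/andP; split; lra.
have -> : avg (fun l : 'I_(size L) => (`|inverse_path g a0 (word (nth [::] L l)) o -
    inverse_path g a0 (word vi) o| <= t)%R%:R) = (count close L)%:R / (size L)%:R :> R.
  rewrite /avg card_ord; congr (_ / _); rewrite -natr_sum; congr (_%:R).
  rewrite -sum1_count [RHS]big_mkcond/= (big_nth [::]) big_mkord.
  by apply: eq_bigr => l _; rewrite /close; case: (_ <= t).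
rewrite ler_pdivrMr//; apply: le_trans cnt _.
apply: le_trans (_ : e `^ (- eta) * t `^ d * (c * e `^ (- (d - eta1))) <= _); last first.
  by rewrite ler_wpM2l// mulr_ge0 ?powR_ge0.
have tE : (t' / e) `^ (d + eta1) = (m ^+ N)^-1 `^ (d + eta1) * (t `^ d * t `^ eta1) * e `^ (- (d + eta1)).
  rewrite /t' powRM ?invr_ge0 ?divr_ge0 ?(ltW tp) ?(ltW mN0) ?(ltW ep)//.
  rewrite powRM ?invr_ge0 ?(ltW tp) ?(ltW mN0)// (@powRV _ e) ?(ltW ep)// (@powRV _ (m ^+ N)) ?(ltW mN0)//.
  rewrite (@powRD _ t d); last by rewrite (gt_eqF tp) implybT.
  by ring.
have teta : t `^ eta1 <= 1 by apply: powR_le1; rewrite ?(ltW eta10)// (ltW tp) t1.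
have key : B' * e `^ (2 * eta1) <= 1 by apply: small; rewrite ep.
have eE : e `^ (- eta) * e `^ (- (d - eta1)) = e `^ (- (d + eta1)) * e `^ (- (2 * eta1)).
  have en : e != 0 by rewrite gt_eqF.
  rewrite -!powRD; try by rewrite en implybT.
  by congr (powR _ _); rewrite /eta1; lra.
rewrite tE (_ : _ * (c * _) = (e `^ (- eta) * e `^ (- (d - eta1))) * (c * t `^ d)); last by ring.
rewrite eE.
have E0 : 0 <= e `^ (- (d + eta1)) * (c * t `^ d).
  by apply: mulr_ge0; [exact: powR_ge0|apply: mulr_ge0; [exact: ltW|exact: powR_ge0]].
apply: le_trans (_ : (B' * t `^ eta1) * (e `^ (- (d + eta1)) * (c * t `^ d)) <= _).
  by apply: le_of_eq; rewrite /B'; field; rewrite gt_eqF.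
rewrite [leRHS](_ : _ = e `^ (- (2 * eta1)) * (e `^ (- (d + eta1)) * (c * t `^ d))); last by ring.
apply: ler_wpM2r => //; rewrite powRN -[leRHS]mul1r ler_pdivlMr ?powR_gt0//.
have B'0 : 0 <= B' by rewrite /B' divr_ge0 ?(ltW c0)// mulr_ge0// powR_ge0.
apply: le_trans key; rewrite ler_wpM2r ?powR_ge0// ler_piMr//.
Qed.

End LoopFamilies.

(** * Multipliers of periodic points *)

Section LogQuotients.
Context {R : realType}.
Implicit Types (f : R -> R).

Definition log_quotient f (x y : R) : R := ln (`|f x - f y| / `|x - y|).

(** The logarithm of the norm of the derivative at [z], as a limit of logarithmic quotients. *)
Definition log_multiplier f (z L : R) : Prop := forall eta, 0 < eta ->
  exists2 delta, 0 < delta & forall x, 0 <= x <= 1 -> x != z -> `|x - z| < delta ->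
    `|log_quotient f x z - L| <= eta.

Definition in_ball_unit (z D x : R) : Prop := 0 <= x <= 1 /\ `|x - z| <= D.

Lemma unit_limit (z d : R) : 0 <= z <= 1 -> 0 < d ->
  exists x, [/\ 0 <= x <= 1, x != z & `|x - z| < d].
Proof.
move=> /andP[z0 z1] d0; pose e := Num.min (d / 2) (1 / 2).
have e0 : 0 < e by rewrite lt_min !divr_gt0.
have ed : e < d.
  apply: le_lt_trans (_ : d / 2 < _); first by rewrite /e ge_min lexx.
  by rewrite ltr_pdivrMr// mulr_natr mulr2n ltrDl.
have e1 : e <= 1 / 2 by rewrite /e ge_min lexx orbT.
have [zh|zh] := leP z (1 / 2).
  exists (z + e); rewrite addrAC subrr add0r gtr0_norm//; split=> //; first by lra.
  by rewrite gt_eqF// ltrDl.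
exists (z - e); rewrite addrAC subrr add0r normrN gtr0_norm//; split=> //; first by lra.
by rewrite lt_eqF// gtrDl oppr_lt0.
Qed.

Section Branch.
Variables (m k C e0 : R) (f : R -> R).
Hypotheses (m0 : 0 < m) (hf : contracting_branch m k C e0 f).

Lemma branch_neq x y : 0 <= x <= 1 -> 0 <= y <= 1 -> x != y -> f x != f y.
Proof.
move=> hx hy xy; rewrite -subr_eq0 -normr_gt0; apply: lt_le_trans (branch_ge hf hx hy).
by rewrite mulr_gt0// normr_gt0 subr_eq0.
Qed.

Lemma branch_quotient_gt0 x y : 0 <= x <= 1 -> 0 <= y <= 1 -> x != y ->
  0 < `|f x - f y| / `|x - y|.
Proof.
move=> hx hy xy; rewrite divr_gt0// normr_gt0 subr_eq0//; exact: branch_neq.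
Qed.

Lemma log_distance x y : 0 <= x <= 1 -> 0 <= y <= 1 -> x != y ->
  ln `|f x - f y| = log_quotient f x y + ln `|x - y|.
Proof.
move=> hx hy xy; have n0 : 0 < `|x - y| by rewrite normr_gt0 subr_eq0.
by rewrite -lnM ?posrE ?branch_quotient_gt0// divfK ?gt_eqF.
Qed.

Lemma log_quotient_close D z x y x' y' :
  in_ball_unit z D x -> in_ball_unit z D y -> in_ball_unit z D x' -> in_ball_unit z D y' ->
  x != y -> x' != y' ->
  `|log_quotient f x y - log_quotient f x' y'| <= C * (2 * D) `^ e0.
Proof.
move=> [x1 xD] [y1 yD] [x1' xD'] [y1' yD'] xy xy'.
have n0 : 0 < `|x - y| by rewrite normr_gt0 subr_eq0.
have n0' : 0 < `|x' - y'| by rewrite normr_gt0 subr_eq0.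
have q0 := branch_quotient_gt0 x1 y1 xy; have q0' := branch_quotient_gt0 x1' y1' xy'.
have us : in_unit_seq [:: x; y; x'; y'].
  by move=> u; rewrite !inE => /or4P[] /eqP ->.
have mem u : u \in [:: x; y; x'; y'] -> `|u - z| <= D.
  by rewrite !inE => /or4P[] /eqP ->.
have cl : clustered (2 * D) [:: x; y; x'; y'].
  move=> u v /mem hu /mem hv; rewrite -(subrKA z) (le_trans (ler_normD _ _))//.
  by rewrite (distrC z v) mulr_natl mulr2n lerD.
have h a b a' b' : distorted C e0 f -> in_unit_seq [:: a; b; a'; b'] ->
    clustered (2 * D) [:: a; b; a'; b'] -> 0 < `|a - b| -> 0 < `|a' - b'| ->
    0 < `|f a - f b| / `|a - b| -> 0 < `|f a' - f b'| / `|a' - b'| ->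
    log_quotient f a b - log_quotient f a' b' <= C * (2 * D) `^ e0.
  move=> df u c p p' q q'; rewrite /log_quotient lerBlDr.
  rewrite -[leLHS]expRK// -[leRHS]expRK ler_ln ?posrE ?expR_gt0// lnK ?posrE//.
  rewrite expRD lnK ?posrE// mulrA ler_pdivlMr// mulrAC ler_pdivrMr//.
  by rewrite -mulrA; apply: df.
have perm u : u \in [:: x'; y'; x; y] -> u \in [:: x; y; x'; y'].
  rewrite !inE => /or4P[] /eqP ->; by rewrite eqxx ?orbT.
rewrite ler_norml; apply/andP; split; last by apply: h => //; exact: branch_distorted hf.
rewrite lerNl opprB; apply: h => //; first exact: branch_distorted hf.
  by move=> u /perm; exact: us.
by move=> u v /perm hu /perm hv; exact: cl.
Qed.

Lemma log_multiplier_close D z L x y : 0 <= z <= 1 -> log_multiplier f z L -> 0 < D ->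
  in_ball_unit z D x -> in_ball_unit z D y -> x != y ->
  `|log_quotient f x y - L| <= C * (2 * D) `^ e0.
Proof.
move=> z1 hL D0 hx hy xy; apply/ler_addgt0Pr => eta eta0.
have [delta d0 hd] := hL _ eta0.
have [|x' [x1' xz]] := @unit_limit z (Num.min delta D) z1; first by rewrite lt_min d0.
rewrite lt_min => /andP[xd xD].
have hx' : in_ball_unit z D x' by split=> //; exact: ltW.
have hz : in_ball_unit z D z by split=> //; rewrite subrr normr0 ltW.
have h1 := log_quotient_close hx hy hx' hz xy xz.
have h2 : `|log_quotient f x' z - L| <= eta by exact: hd.
rewrite -(subrKA (log_quotient f x' z)) (le_trans (ler_normD _ _))//.
exact: lerD.
Qed.

(** By [log_quotient_close] the quotients are Cauchy at [z]. Their limit is taken as a lower limit,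
    the supremum of the local lower bounds. *)
Lemma log_multiplier_exists z : 0 <= C -> 0 < e0 -> 0 <= z <= 1 ->
  exists L, log_multiplier f z L.
Proof.
move=> C0 e00 z1.
pose S := [set a | exists2 D, 0 < D & forall x, in_ball_unit z D x -> x != z -> a <= log_quotient f x z].
have close D x y : 0 < D -> in_ball_unit z D x -> x != z -> in_ball_unit z D y -> y != z ->
    log_quotient f x z - C * (2 * D) `^ e0 <= log_quotient f y z.
  move=> D0 hx xz hy yz; have hz : in_ball_unit z D z by split=> //; rewrite subrr normr0 ltW.
  have := log_quotient_close hx hz hy hz xz yz.
  by rewrite ler_norml => /andP[_]; rewrite lerBlDr lerBlDr addrC.
have inS D x : 0 < D -> in_ball_unit z D x -> x != z ->
    S (log_quotient f x z - C * (2 * D) `^ e0).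
  by move=> D0 hx xz; exists D => // y hy yz; exact: close.
have ubS D x : 0 < D -> in_ball_unit z D x -> x != z ->
    ubound S (log_quotient f x z + C * (2 * D) `^ e0).
  move=> D0 hx xz a [D' D'0 ha].
  have [|y [y1 yz]] := @unit_limit z (Num.min D D') z1; first by rewrite lt_min D0.
  rewrite lt_min => /andP[yD yD']; apply: le_trans (ha y _ yz) _; first by split=> //; exact: ltW.
  by rewrite -lerBlDr; apply: close => //; split=> //; exact: ltW.
exists (sup S) => eta eta0; have [e e_gt0 he] := powR_small (C / eta) e00.
exists (e / 4) => [|x x1 xz xd]; first by rewrite divr_gt0.
pose D := e / 4; have D0 : 0 < D by rewrite divr_gt0.
have hx : in_ball_unit z D x by split=> //; exact: ltW.
have small : C * (2 * D) `^ e0 <= eta.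
  have : C / eta * (2 * D) `^ e0 <= 1 by apply: he; rewrite /D; apply/andP; split; lra.
  by rewrite mulrAC ler_pdivrMr// mul1r.
have hub := ubS _ _ D0 hx xz; have hin := inS _ _ D0 hx xz.
have s1 : sup S <= log_quotient f x z + C * (2 * D) `^ e0.
  by apply: ge_sup => //; exists (log_quotient f x z - C * (2 * D) `^ e0).
have s2 : log_quotient f x z - C * (2 * D) `^ e0 <= sup S.
  by apply: ub_le_sup => //; exists (log_quotient f x z + C * (2 * D) `^ e0).
by rewrite ler_norml; apply/andP; split; lra.
Qed.

Lemma log_multiplier_lt0 z L : k < 1 -> 0 <= z <= 1 -> log_multiplier f z L -> L < 0.
Proof.
move=> k1 z1 hL; have [x0 [x01 x0z _]] := unit_limit z1 ltr01.
have k0 : 0 < k.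
  have := branch_quotient_gt0 x01 z1 x0z; rewrite -(ltr_pM2r (_ : 0 < `|x0 - z|)).
    rewrite divfK ?normr_eq0 ?subr_eq0// mul0r => h.
    have := lt_le_trans h (branch_le hf x01 z1).
    by rewrite pmulr_lgt0// normr_gt0 subr_eq0.
  by rewrite normr_gt0 subr_eq0.
have lnk : ln k < 0 by rewrite ln_lt0// k0.
apply: le_lt_trans lnk; apply/ler_addgt0Pr => eta eta0.
have [d d0 hd] := hL _ eta0; have [x [x1 xz xd]] := unit_limit z1 d0.
have := hd _ x1 xz xd; rewrite ler_norml => /andP[h _].
have : log_quotient f x z <= ln k.
  rewrite /log_quotient ler_ln ?posrE ?branch_quotient_gt0//.
  by rewrite ler_pdivrMr ?normr_gt0 ?subr_eq0//; exact: (branch_le hf x1 z1).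
by move=> h'; lra.
Qed.

Lemma branch_sg : exists s : bool, forall x y, 0 <= x <= 1 -> 0 <= y <= 1 -> x != y ->
  Num.sg (f x - f y) = (-1) ^+ s * Num.sg (x - y).
Proof.
have [s sP] := branch_sign hf; exists s => x y hx hy xy.
have fxy := branch_neq hx hy xy; have := sP _ _ hx hy.
move: xy fxy; rewrite -subr_eq0 -(subr_eq0 (f x)).
case: s {sP}; rewrite ?expr0 ?expr1 ?mul1r ?mulN1r.
  move=> u0 v0; rewrite mulNr oppr_ge0 => h.
  case: (ltgtP (f x - f y) 0) v0 h => // v0 _; case: (ltgtP (x - y) 0) u0 => // u0 _ h.
  - by exfalso; move: h; rewrite leNgt nmulr_rgt0// u0.
  - by rewrite ltr0_sg// gtr0_sg.
  - by rewrite gtr0_sg// ltr0_sg// opprK.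
  - by exfalso; move: h; rewrite leNgt mulr_gt0.
move=> u0 v0 h.
case: (ltgtP (f x - f y) 0) v0 h => // v0 _; case: (ltgtP (x - y) 0) u0 => // u0 _ h.
- by rewrite !ltr0_sg.
- by exfalso; move: h; rewrite leNgt nmulr_rlt0// u0.
- by exfalso; move: h; rewrite leNgt pmulr_rlt0// u0.
- by rewrite !gtr0_sg.
Qed.

End Branch.

Section Iterates.
Variables (m k C e0 : R) (f : R -> R).
Hypotheses (m0 : 0 < m) (k01 : 0 < k < 1) (hf : contracting_branch m k C e0 f).

Lemma iter_unit n x : 0 <= x <= 1 -> 0 <= iter n f x <= 1.
Proof. by move=> hx; elim: n => //= n; exact: (branch_unit hf). Qed.

Lemma iter_neq n x y : 0 <= x <= 1 -> 0 <= y <= 1 -> x != y -> iter n f x != iter n f y.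
Proof.
by move=> hx hy xy; elim: n => //= n; apply: (branch_neq m0 hf); apply: iter_unit.
Qed.

Lemma iter_dist n x y : 0 <= x <= 1 -> 0 <= y <= 1 ->
  `|iter n f x - iter n f y| <= k ^+ n * `|x - y|.
Proof.
move=> hx hy; elim: n => [|n IH]; first by rewrite expr0 mul1r.
apply: le_trans (branch_le hf (iter_unit n hx) (iter_unit n hy)) _.
by rewrite exprS -mulrA ler_wpM2l//; case/andP: k01 => /ltW.
Qed.

Lemma iter_fixed n z : f z = z -> iter n f z = z.
Proof. by move=> fz; elim: n => //= n ->. Qed.

Lemma iter_sg_even n x y : 0 <= x <= 1 -> 0 <= y <= 1 -> x != y ->
  Num.sg (iter n.*2 f x - iter n.*2 f y) = Num.sg (x - y).
Proof.
have [s sP] := branch_sg m0 hf => hx hy xy.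
elim: n => // n IH; rewrite doubleS /=.
have u := iter_unit n.*2 hx; have v := iter_unit n.*2 hy; have w := iter_neq n.*2 hx hy xy.
rewrite sP ?(branch_neq m0 hf) ?(branch_unit hf)// sP// IH mulrA -expr2 sqrr_sign.
by rewrite mul1r.
Qed.

Lemma log_multiplier_iter n z L : 0 <= z <= 1 -> f z = z -> log_multiplier f z L ->
  log_multiplier (iter n f) z (n%:R * L).
Proof.
move=> z1 fz hL; elim: n => [|n IH] eta eta0.
  exists 1 => // x _ xz _; rewrite /log_quotient /= divff ?normr_eq0 ?subr_eq0//.
  by rewrite ln1 mul0r subrr normr0 ltW.
have e2 : 0 < eta / 2 by rewrite divr_gt0.
have [d1 d10 h1] := hL _ e2; have [d2 d20 h2] := IH _ e2.
exists (Num.min d1 d2); first by rewrite lt_min d10.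
move=> x x1 xz; rewrite lt_min => /andP[xd1 xd2].
have u := iter_unit n x1; have w := iter_neq n x1 z1 xz; rewrite (iter_fixed n fz) in w.
have ud : `|iter n f x - z| < d1.
  rewrite -{1}(iter_fixed n fz); apply: le_lt_trans (iter_dist n x1 z1) _.
  apply: le_lt_trans xd1; rewrite ler_piMl// exprn_ile1//; case/andP: k01 => /ltW// _ /ltW//.
have -> : log_quotient (iter n.+1 f) x z = log_quotient f (iter n f x) z + log_quotient (iter n f) x z.
  have p0 : 0 < `|x - z| by rewrite normr_gt0 subr_eq0.
  have p1 : 0 < `|iter n f x - z| by rewrite normr_gt0 subr_eq0.
  rewrite /log_quotient (iter_fixed n fz) -lnM ?posrE ?divr_gt0//.
    congr ln; rewrite /= (iter_fixed n fz) fz mulrA divfK ?gt_eqF//.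
  by rewrite normr_gt0 subr_eq0; exact: (branch_neq m0 hf).
have := h1 _ u w ud; have := h2 _ x1 xz xd2.
have -> : n.+1%:R * L = n%:R * L + L by rewrite -(natr1 n) mulrDl mul1r.
move=> a1 a2.
rewrite (_ : _ - _ = (log_quotient f (iter n f x) z - L) + (log_quotient (iter n f) x z - n%:R * L)); last by move: (log_quotient (iter n f) x z) (log_quotient f (iter n f x) z) => ? ?; ring.
by rewrite (le_trans (ler_normD _ _))// [leRHS](splitr eta) lerD.
Qed.

End Iterates.

End LogQuotients.

Section PeriodicWords.
Context {R : realType} {A : finType} (g : expanding_data R A) (r : \bar R).
Variables (e0 m k C : R).
Hypotheses (r1 : (1 < r)%E) (hg : expanding g r) (e01 : 0 < e0 <= 1)
  (m01 : 0 < m < 1) (k01 : 0 < k < 1) (C0 : 0 <= C)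
  (hb : forall a b, trans g a b -> contracting_branch m k C e0 (inverse_branch g a b)).

Let pb := path_branch e01 m01 k01 C0 hb.
Notation CP := (path_const e0 k C).

Lemma iter_inverse_path a s y : path (trans g) a s -> 0 <= y <= 1 ->
  iter (size s) (gmap g) (inverse_path g a s y, a) = (y, last a s).
Proof.
move=> + y01; elim: s a => // b s IH a /= /andP[ab ps].
have u := branch_unit (pb ps) y01.
by rewrite -iterS iterSr (gmapE hg ab (inverse_branch_in hg ab u)) (inverse_branchK hg)// IH.
Qed.

(** Near the point a single branch meets the domain of the iterate, relative to which [Diter] is
    defined. *)
Lemma domain_iter_near a s y : path (trans g) a s -> 0 <= y <= 1 ->
  exists2 delta, 0 < delta & forall x, domain_iter g (size s) (x, a) ->
    `|x - inverse_path g a s y| < delta -> 0 <= x <= 1 ->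
    exists2 z, 0 <= z <= 1 & x = inverse_path g a s z.
Proof.
have /andP[m0 m1] := m01.
move=> + y01; elim: s a => [|b s IH] a /=; first by exists 1 => // x _ _ x1; exists x.
move=> /andP[ab ps]; have u := branch_unit (pb ps) y01.
have [d1 d10 h1] := domain_near hg ab (inverse_branch_in hg ab u).
have [d2 d20 h2] := IH _ ps.
exists (Num.min d1 (m * d2)); first by rewrite lt_min d10 mulr_gt0.
move=> x dx; rewrite lt_min => /andP[xd1 xd2] x1.
have xab : subint g a b x by apply: h1 => //; exact: (dx 0%N).
have v := gcoord_unit hg ab xab.
have [||//|z z1 E] := h2 (gcoord g a x).
- move=> i isz; have := dx i.+1; rewrite ltnS => /(_ isz).
  by rewrite iterSr (gmapE hg ab xab).
- rewrite -(ltr_pM2l m0); apply: le_lt_trans xd2.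
  by rewrite -{2}(gcoordK hg ab xab); exact: (branch_ge (hb ab)).
by exists z => //; rewrite /= -E (gcoordK hg ab xab).
Qed.

(** The word read along one period gives the inverse of the iterate near [x], so the eigenvalue is
    the inverse of the multiplier of [f], with the sign of the orientation. *)
Lemma periodic_loop n x b : (0 < n)%N -> cantor_set g (x, b) ->
  iter n (gmap g) (x, b) = (x, b) ->
  exists f, [/\ loop_map g b f, f x = x, contracting_branch (m ^+ n) (k ^+ n) CP e0 f &
    log_multiplier f x (- ln `|Diter g n (x, b)|)].
Proof.
move=> n0 Kx per; have /andP[m0 m1] := m01; have /andP[k0 k1] := k01; have /andP[e00 _] := e01.
have CP0 := path_const_ge0 e01 k01 C0.
have [s [y [sn ps Ky xE]]] := itinerary hg n (Kx : slice g b x).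
have y01 := slice_unit hg Ky.
have := iter_inverse_path ps y01; rewrite -xE sn per => -[xy lb].
rewrite -xy in xE Ky y01 => {y xy}.
have hf := pb ps; rewrite sn in hf; set f := inverse_path g b s in xE hf.
have mn0 : 0 < m ^+ n by rewrite exprn_gt0.
have kn1 : k ^+ n <= 1 by rewrite exprn_ile1// ltW.
have [L hL] := log_multiplier_exists mn0 hf CP0 e00 y01.
exists f; split=> //; first by exists s.
have [sg sgP] := branch_sg mn0 hf.
suff -> : Diter g n (x, b) = (-1) ^+ sg * expR (- L).
  by rewrite normrMsign gtr0_norm ?expR_gt0// expRK opprK.
have [d1 d10 h1] := domain_iter_near ps y01; rewrite -/f -xE sn in h1.
have F01 z : domain_iter g n (z, b) -> 0 <= z <= 1.
  move=> dz; have [c bc zbc] := dz 0%N n0; exact: (subint_unit hg bc zbc).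
have fF z : 0 <= z <= 1 -> iter n (gmap g) (f z, b) = (z, b).
  by move=> z1; rewrite -sn (iter_inverse_path ps z1) -lb.
have fin z : 0 <= z <= 1 -> domain_iter g n (f z, b).
  by move=> z1 i; rewrite -sn => isz; exact: (domain_iter_path hg _ m01 _ _ hb ps z1 isz).
apply: derive_in_eq => [e e_gt0|delta delta0] /=; last first.
  have [z [z1 zx zd]] := unit_limit y01 delta0.
  exists (f z); split; first exact: fin.
    by rewrite {1}xE; exact: (branch_neq mn0 hf).
  rewrite {1}xE; apply: le_lt_trans (branch_le hf z1 y01) _.
  by apply: le_lt_trans zd; rewrite ler_piMl.
have /cvgrPdist_lt /(_ _ e_gt0) /nbhs_ballP[eta /= eta0 heta] := @continuous_expR R (- L).
have [d2 d20 h2] := hL _ (divr_gt0 eta0 (ltr0n R 2 : 0 < 2)).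
exists (Num.min d1 (m ^+ n * d2)); first by rewrite lt_min d10 mulr_gt0.
move=> y dy yx; rewrite lt_min => /andP[yd1 yd2].
have [z z1 yE] := h1 y dy yd1 (F01 _ dy).
have zx : z != x by apply: contraNneq yx => zx; rewrite yE zx -xE.
have zd : `|z - x| < d2.
  rewrite -(ltr_pM2l mn0); apply: le_lt_trans yd2.
  by rewrite yE {2}xE; exact: (branch_ge hf).
have -> : (iter n (gmap g) (y, b)).1 = z by rewrite yE fF.
have -> : (iter n (gmap g) (x, b)).1 = x by rewrite {1}xE fF.
have p0 : 0 < `|z - x| by rewrite normr_gt0 subr_eq0.
have fzx : 0 < `|f z - x| by rewrite {1}xE normr_gt0 subr_eq0; exact: (branch_neq mn0 hf).
have -> : (z - x) / (y - x) = (-1) ^+ sg * expR (- log_quotient f z x).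
  rewrite /log_quotient expRN lnK ?posrE; last by rewrite -xE divr_gt0.
  rewrite -xE invf_div yE {1}(numEsg (z - x)) {1}(numEsg (f z - x)).
  have -> : Num.sg (f z - x) = (-1) ^+ sg * Num.sg (z - x) by rewrite {1}xE sgP.
  rewrite !invfM invr_sign; field.
  by rewrite (gt_eqF fzx) sgr_eq0 subr_eq0 zx.
rewrite -mulrBr normrMsign distrC; apply: heta.
rewrite -ball_normE /= opprK addrC; apply: le_lt_trans (h2 _ z1 zx zd) _.
by rewrite ltr_pdivrMr// ltr_pMr// ltr1n.
Qed.

End PeriodicWords.

(** * Shifts from two expanding loops *)

Section LoopShifts.
Context {R : realType} {A : finType} (g : expanding_data R A) (r : \bar R).
Variables (e0 m k C : R).
Hypotheses (r1 : (1 < r)%E) (hg : expanding g r) (e01 : 0 < e0 <= 1)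
  (m01 : 0 < m < 1) (k01 : 0 < k < 1) (C0 : 0 <= C)
  (hb : forall a b, trans g a b -> contracting_branch m k C e0 (inverse_branch g a b)).

Let pb := path_branch e01 m01 k01 C0 hb.
Notation CP := (path_const e0 k C).

Definition path_map (a b : A) (f : R -> R) : Prop := exists s,
  [/\ path (trans g) a s, last a s = b & f = inverse_path g a s].

Lemma path_map_comp a b c f h : path_map a b f -> path_map b c h -> path_map a c (f \o h).
Proof.
move=> [s [ps ls ->]] [t [pt lt ->]]; exists (s ++ t).
by rewrite cat_path last_cat ps ls lt pt; split=> //; rewrite inverse_path_cat ls.
Qed.

Lemma path_map_iter a n f : path_map a a f -> path_map a a (iter n f).
Proof.
move=> hf; elim: n => [|n IH]; first by exists [::].
exact: path_map_comp hf IH.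
Qed.

Lemma path_map_branch a b f : path_map a b f ->
  exists2 m', 0 < m' & contracting_branch m' 1 CP e0 f.
Proof.
have /andP[m0 m1] := m01; have /andP[k0 k1] := k01.
move=> [s [ps _ ->]]; exists (m ^+ size s); first by rewrite exprn_gt0.
apply: contracting_branch_weaken (pb ps) => //.
by rewrite exprn_ile1// ltW.
Qed.

Lemma path_map_exists a b : exists f, path_map a b f.
Proof.
by have [s [ps ls]] := connected_letters hg a b; exists (inverse_path g a s), s.
Qed.

(** Since [f] is an inverse branch, [u] is the logarithm of the eigenvalue of the expanding map. *)
Definition expanding_loop (b : A) (x u : R) : Prop := exists m' k' f,
  [/\ [/\ 0 < m', 0 < k' < 1 & contracting_branch m' k' CP e0 f],
      0 <= x <= 1, loop_map g b f, f x = x & log_multiplier f x (- u)].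

Lemma iter_ball m' k' f z D n x : 0 < k' < 1 -> contracting_branch m' k' CP e0 f ->
  0 <= z <= 1 -> f z = z -> in_ball_unit z D x -> in_ball_unit z D (iter n f x).
Proof.
move=> k'01 hf z1 fz [x1 xD]; split; first exact: (iter_unit hf).
rewrite -{1}(iter_fixed n fz); apply: le_trans (iter_dist k'01 hf n x1 z1) _.
by apply: le_trans xD; rewrite ler_piMl// exprn_ile1//; case/andP: k'01 => /ltW// _ /ltW.
Qed.

Lemma contract_ball m' k' f z D n x : 0 < k' < 1 -> contracting_branch m' k' CP e0 f ->
  0 <= z <= 1 -> f z = z -> k' ^+ n <= D -> 0 <= x <= 1 -> in_ball_unit z D (iter n f x).
Proof.
move=> k'01 hf z1 fz kD x1; split; first exact: (iter_unit hf).
rewrite -{1}(iter_fixed n fz); apply: le_trans (iter_dist k'01 hf n x1 z1) _.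
apply: le_trans kD; rewrite ler_piMr ?exprn_ge0//; first by case/andP: k'01 => /ltW.
by move: x1 z1 => /andP[? ?] /andP[? ?]; rewrite ler_norml; apply/andP; split; lra.
Qed.

(** Besides a part common to all [j], the word of [U j] makes [2 * j * p] turns around [x] and
    [2 * (J - j) * q] turns around [y]. Raising [j] by one removes [2 * q] contractions of logarithm
    [v] and adds [2 * p] of logarithm [u], whence the magnification [tau]. Turns come in pairs so
    that the orientation does not depend on [j]. *)
Lemma loop_shifts a :
  (forall delta, 0 < delta -> exists b x u c y v (p q : nat),
    [/\ expanding_loop b x u, expanding_loop c y v & 0 < q%:R * v - p%:R * u < delta]) ->
  has_shifts (loop_map g a).
Proof.
move=> loops delta delta0.
have [b [x [u [c [y [v [p [q [Lx Ly /andP[pq0 pqd]]]]]]]]]] := loops _ (divr_gt0 delta0 (ltr0n R 2 : 0 < 2)).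
have /andP[e00 _] := e01.
have [mf [kf [f [[mf0 kf01 hf] x1 Lf fx fL]]]] := Lx.
have [mh [kh [h [[mh0 kh01 hh] y1 Lh hy hL]]]] := Ly.
pose tau := 2 * (q%:R * v - p%:R * u).
(* Comparisons take place within [D] of a fixed point and cost [delta / 6] each; six of them are
   made. *)
have [D [D0 Dd DE]] : exists D, [/\ 0 < D, D <= delta & CP * (2 * D) `^ e0 <= delta / 6].
  have [e e_gt0 he] := powR_small (CP / (delta / 6)) e00.
  exists (Num.min delta (e / 4)); rewrite lt_min delta0 divr_gt0// ge_min lexx; split=> //.
  have e2 : 0 < 2 * Num.min delta (e / 4) < e.
    rewrite mulr_gt0 ?lt_min ?delta0 ?divr_gt0//=.
    apply: le_lt_trans (_ : 2 * (e / 4) < _); first by rewrite ler_pM2l// ge_min lexx orbT.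
    by lra.
  by have := he _ e2; rewrite mulrAC ler_pdivrMr ?divr_gt0// mul1r.
have pow_le (k' : R) n n' : 0 < k' < 1 -> k' ^+ n < D -> k' ^+ (n + n') <= D.
  move=> /andP[k'0 k'1] hn; apply: le_trans (ltW hn); rewrite exprD ler_piMr ?exprn_ge0 ?(ltW k'0)//.
  by rewrite exprn_ile1 ?(ltW k'0) ?(ltW k'1).
have [M [Mf Mh]] : exists M, kf ^+ M <= D /\ kh ^+ M <= D.
  have [n1 h1] : exists n, kf ^+ n < D.
    by apply: expr_small => //; case/andP: kf01 => /ltW ->.
  have [n2 h2] : exists n, kh ^+ n < D.
    by apply: expr_small => //; case/andP: kh01 => /ltW ->.
  by exists (n1 + n2)%N; split; [|rewrite addnC]; apply: pow_le.
exists tau; first by rewrite /tau; apply/andP; split; lra.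
move=> J.
have [c1 hc1] := path_map_exists a b; have [c2 hc2] := path_map_exists b c.
have [c3 hc3] := path_map_exists c a.
(* The [M] additional turns bring every point within [D] of [y], respectively of [x], before the
   counted turns begin. *)
pose beta := iter M f \o c2; pose gamma := iter M h \o c3.
have pbeta : path_map b c beta by exact: path_map_comp (path_map_iter M Lf) hc2.
have pgamma : path_map c a gamma by exact: path_map_comp (path_map_iter M Lh) hc3.
pose nf j := (j * p).*2; pose nh j := ((J - j) * q).*2.
pose U j := c1 \o (iter (nf j) f \o (beta \o (iter (nh j) h \o gamma))).
have [mb mb0 hbeta] := path_map_branch pbeta; have [mg mg0 hgamma] := path_map_branch pgamma.
have [m3 _ hc3b] := path_map_branch hc3; have [m2 _ hc2b] := path_map_branch hc2.
have [m1 _ hc1b] := path_map_branch hc1.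
exists U; split.
- move=> j; apply: path_map_comp hc1 _; apply: path_map_comp (path_map_iter _ Lf) _.
  by apply: path_map_comp pbeta _; exact: path_map_comp (path_map_iter _ Lh) pgamma.
- pose s z := iter (nh 0%N) h (gamma z).
  have s1 z : 0 <= z <= 1 -> 0 <= s z <= 1.
    by move=> z1; apply: (iter_unit hh); exact: (branch_unit hgamma).
  have u0 := s1 _ (@unit0 R); have u1 := s1 _ (@unit1 R).
  have v0 := branch_unit hc2b u0; have v1 := branch_unit hc2b u1.
  rewrite /sz /U /= -/(s 0) -/(s 1).
  apply: le_trans (branch_le hc1b (iter_unit hf M v1) (iter_unit hf M v0)) _.
  rewrite mul1r; apply: le_trans (iter_dist kf01 hf M v1 v0) _.
  apply: le_trans Dd; apply: le_trans Mf; rewrite ler_piMr ?exprn_ge0//.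
    by case/andP: kf01 => /ltW.
  by move: v0 v1 => /andP[? ?] /andP[? ?]; rewrite ler_norml; apply/andP; split; lra.
move=> w j hw jJ s t s1 t1; have [->|st] := eqVneq s t.
  by exists 0; rewrite ?normr0 ?(ltW delta0)// !subrr mulr0.
have palpha : path_map a b (w \o c1) by exact: path_map_comp hw hc1.
have [ma ma0 halpha] := path_map_branch palpha.
have ball0 z : 0 <= z <= 1 -> in_ball_unit y D (gamma z).
  by move=> z1; apply: (contract_ball kh01 hh) => //; exact: (branch_unit hc3b).
have ball1 i z : 0 <= z <= 1 -> in_ball_unit y D (iter (nh i) h (gamma z)).
  by move=> z1; apply: (iter_ball _ kh01 hh) => //; exact: ball0.
have ball2 i z : 0 <= z <= 1 -> in_ball_unit x D (beta (iter (nh i) h (gamma z))).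
  move=> z1; apply: (contract_ball kf01 hf) => //; apply: (branch_unit hc2b).
  by have [] := ball1 i z z1.
have ball3 i z : 0 <= z <= 1 -> in_ball_unit x D (iter (nf i) f (beta (iter (nh i) h (gamma z)))).
  by move=> z1; apply: (iter_ball _ kf01 hf) => //; exact: ball2.
have neq0 : gamma s != gamma t by exact: (branch_neq mg0 hgamma).
have neq1 i : iter (nh i) h (gamma s) != iter (nh i) h (gamma t).
  by apply: (iter_neq mh0 hh) => //; [have [] := ball0 s s1|have [] := ball0 t t1].
have neq2 i : beta (iter (nh i) h (gamma s)) != beta (iter (nh i) h (gamma t)).
  by apply: (branch_neq mb0 hbeta) => //; [have [] := ball1 i s s1|have [] := ball1 i t t1].
have neq3 i : iter (nf i) f (beta (iter (nh i) h (gamma s))) !=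
    iter (nf i) f (beta (iter (nh i) h (gamma t))).
  by apply: (iter_neq mf0 hf) => //; [have [] := ball2 i s s1|have [] := ball2 i t t1].
pose X i := w (U i s) - w (U i t).
have X0 i : X i != 0.
  rewrite subr_eq0; apply: (branch_neq ma0 halpha) (neq3 i).
    by have [] := ball3 i s s1.
  by have [] := ball3 i t t1.
have [sa saP] := branch_sg ma0 halpha; have [sb sbP] := branch_sg mb0 hbeta.
have sgX n : Num.sg (X n) = (-1) ^+ sa * ((-1) ^+ sb * Num.sg (gamma s - gamma t)).
  rewrite /X /= (saP _ _ _ _ (neq3 n)); last 2 first.
  - by have [] := ball3 n s s1.
  - by have [] := ball3 n t t1.
  rewrite (iter_sg_even mf0 hf _ _ _ (neq2 n)); last 2 first.
  - by have [] := ball2 n s s1.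
  - by have [] := ball2 n t t1.
  rewrite (sbP _ _ _ _ (neq1 n)); last 2 first.
  - by have [] := ball1 n s s1.
  - by have [] := ball1 n t t1.
  rewrite (iter_sg_even mh0 hh _ _ _ neq0)//.
  - by have [] := ball0 s s1.
  - by have [] := ball0 t t1.
pose la i := log_quotient (w \o c1) (iter (nf i) f (beta (iter (nh i) h (gamma s))))
  (iter (nf i) f (beta (iter (nh i) h (gamma t)))).
pose lf i := log_quotient (iter (nf i) f) (beta (iter (nh i) h (gamma s)))
  (beta (iter (nh i) h (gamma t))).
pose lb i := log_quotient beta (iter (nh i) h (gamma s)) (iter (nh i) h (gamma t)).
pose lh i := log_quotient (iter (nh i) h) (gamma s) (gamma t).
have [mfn [mfn0 hfn]] : exists mm : nat -> R, (forall i, 0 < mm i) /\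
    forall i, contracting_branch (mm i) 1 CP e0 (iter (nf i) f).
  have /choice[mm mmP] n : exists mm, 0 < mm /\ contracting_branch mm 1 CP e0 (iter (nf n) f).
    by have [mm] := path_map_branch (path_map_iter (nf n) Lf); exists mm.
  by exists mm; split=> n; case: (mmP n).
have [mhn [mhn0 hhn]] : exists mm : nat -> R, (forall i, 0 < mm i) /\
    forall i, contracting_branch (mm i) 1 CP e0 (iter (nh i) h).
  have /choice[mm mmP] n : exists mm, 0 < mm /\ contracting_branch mm 1 CP e0 (iter (nh n) h).
    by have [mm] := path_map_branch (path_map_iter (nh n) Lh); exists mm.
  by exists mm; split=> n; case: (mmP n).
have lnX n : ln `|X n| = la n + (lf n + (lb n + (lh n + ln `|gamma s - gamma t|))).
  rewrite /X /= (log_distance ma0 halpha _ _ (neq3 n)); last 2 first.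
  - by have [] := ball3 n s s1.
  - by have [] := ball3 n t t1.
  rewrite (log_distance (mfn0 n) (hfn n) _ _ (neq2 n)); last 2 first.
  - by have [] := ball2 n s s1.
  - by have [] := ball2 n t t1.
  rewrite (log_distance mb0 hbeta _ _ (neq1 n)); last 2 first.
  - by have [] := ball1 n s s1.
  - by have [] := ball1 n t t1.
  rewrite (log_distance (mhn0 n) (hhn n) _ _ neq0)//.
  - by have [] := ball0 s s1.
  - by have [] := ball0 t t1.
(* The outer map [w] is arbitrary, but [w \o c1] is a word, with the distortion constant of all
   words, evaluated only near [x]. *)
have ea : `|la j - la 0%N| <= delta / 6.
  by apply: le_trans DE; apply: (log_quotient_close ma0 halpha (z := x)) => //; exact: ball3.
have eb : `|lb j - lb 0%N| <= delta / 6.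
  by apply: le_trans DE; apply: (log_quotient_close mb0 hbeta (z := y)) => //; exact: ball1.
(* The error does not grow with the number of turns, because the iterate is itself a word. *)
have ef n : `|lf n + (nf n)%:R * u| <= delta / 6.
  have fLi := log_multiplier_iter mf0 kf01 hf (nf n) x1 fx fL.
  have := log_multiplier_close (mfn0 n) (hfn n) x1 fLi D0 (ball2 n s s1) (ball2 n t t1) (neq2 n).
  by rewrite mulrN opprK => e; exact: le_trans e DE.
have eh n : `|lh n + (nh n)%:R * v| <= delta / 6.
  have hLi := log_multiplier_iter mh0 kh01 hh (nh n) y1 hy hL.
  have := log_multiplier_close (mhn0 n) (hhn n) y1 hLi D0 (ball0 s s1) (ball0 t t1) neq0.
  by rewrite mulrN opprK => e; exact: le_trans e DE.
have nfE n : (nf n)%:R = 2 * (n%:R * p%:R) :> R.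
  by rewrite /nf -mul2n !natrM.
have nhE n : (n <= J)%N -> (nh n)%:R = 2 * ((J%:R - n%:R) * q%:R) :> R.
  by move=> nJ; rewrite /nh -mul2n !natrM natrB.
exists (ln `|X j| - ln `|X 0%N| - j%:R * tau).
  rewrite !lnX; move: ea eb (ef j) (ef 0%N) (eh j) (eh 0%N).
  rewrite !nfE !nhE// !ler_norml mul0r !mulr0 mul0r addr0 /tau.
  move: (la _) (la _) (lb _) (lb _) (lf _) (lf _) (lh _) (lh _) (ln _).
  move=> a1 a2 a3 a4 a5 a6 a7 a8 a9 /andP[? ?] /andP[? ?] /andP[? ?] /andP[? ?].
  by move=> /andP[? ?] /andP[? ?]; apply/andP; split; lra.
rewrite -/(X j) -/(X 0%N) addrC subrK expRD expRN !lnK ?posrE ?normr_gt0//.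
rewrite {1}(numEsg (X j)) {2}(numEsg (X 0%N)) !sgX.
rewrite [RHS]mulrCA -[X in _ = _ * X]mulrA mulVf ?normr_eq0// mulr1.
done.
Qed.

End LoopShifts.

(** * Small positive combinations of two logarithms *)

Section Arithmetic.
Context {R : realType}.

(** Dirichlet's argument: two multiples of [u / v] have fractional parts closer than [delta / v],
    and irrationality keeps them distinct. The sign is left open. *)
Lemma irrational_combination (u v delta : R) : 0 < u -> 0 < v -> irrational (u / v) ->
  0 < delta -> exists p q : nat, 0 < `|q%:R * v - p%:R * u| < delta.
Proof.
move=> u0 v0 irr delta0; pose t i := Num.truncn (i%:R * (u / v)).
pose pos i : R := i%:R * (u / v) - (t i)%:R.
have uv0 : 0 <= u / v by rewrite divr_ge0// ltW.
have posP i : 0 <= pos i < 1.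
  have /truncn_itv/andP[h1 h2] : 0 <= i%:R * (u / v) by rewrite mulr_ge0.
  by rewrite /pos subr_ge0 h1 ltrBlDr addrC natr1.
pose N := (Num.truncn (v / delta)).+1.
have sep0 : 0 < delta / v by rewrite divr_gt0.
have [i [j [ij close]]] : exists i j : nat, (i < j)%N /\ `|pos i - pos j| < delta / v.
  apply: contrapT => nex.
  have := @separated_count R nat (iota 0 N.+1) pos 0 1 (delta / v) sep0 (iota_uniq _ _).
  move=> /(_ _ _ ler01) H.
  have : (size (iota 0 N.+1))%:R <= 1 / (delta / v) + 1 :> R.
    apply: H => [n _|n l _ _ nl]; first by have /andP[h1 h2] := posP n; rewrite h1 add0r ltW.
    rewrite leNgt; apply/negP => lt; apply: nex; move: nl; rewrite neq_ltn => /orP[nl|nl].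
      by exists n, l.
    by exists l, n; split=> //; rewrite distrC.
  rewrite size_iota div1r invf_div -natr1 lerD2r leNgt => /negP; apply.
  by rewrite /N; apply: truncnS_gt.
have tij : (t i <= t j)%N.
  by rewrite /t; apply: le_truncn; rewrite ler_wpM2r// ler_nat ltnW.
exists (j - i)%N, (t j - t i)%N.
have E : (t j - t i)%:R * v - (j - i)%:R * u = (pos i - pos j) * v.
  by rewrite /pos !natrB ?(ltnW ij)//; field; rewrite gt_eqF.
apply/andP; split; last first.
  by rewrite E normrM (gtr0_norm v0) -ltr_pdivlMr.
rewrite normr_gt0; apply/negP => /eqP E0; apply: irr.
exists ((t j - t i)%:R / (j - i)%:R) => //.
have n0 : (j - i)%:R != 0 :> R by rewrite pnatr_eq0 subn_eq0 -ltnNge.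
rewrite (fmorph_div (@ratr R)). rewrite !rmorph_nat; apply/eqP; rewrite eqr_div ?(gt_eqF v0)//.
by rewrite -subr_eq0 [u * _]mulrC E0.
Qed.

(** With [u / v = n / D] in lowest terms, Bezout gives [b * D - a * n = 1], so the combination is
    exactly [v / D]. *)
Lemma rational_combination (u v delta : R) (q : rat) : 0 < u -> 0 < v ->
  u / v = ratr q -> v / delta < (denq q)%:~R -> 0 < delta ->
  exists a b : nat, 0 < b%:R * v - a%:R * u < delta.
Proof.
move=> u0 v0 uvE den delta0; pose D := `|denq q|%N; pose n := `|numq q|%N.
have D0 : (0 < D)%N by rewrite absz_gt0 denq_neq0.
have DE : (denq q)%:~R = D%:R :> R by rewrite -[denq q]gez0_abs ?denq_ge0.
have q0 : 0 <= q by rewrite -(ler0q R) -uvE divr_ge0// ltW.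
have nE : (numq q)%:~R = n%:R :> R by rewrite -[numq q]gez0_abs ?numq_ge0.
have E : u * D%:R = n%:R * v.
  apply/eqP; rewrite -eqr_div ?(gt_eqF v0) ?pnatr_eq0 -?lt0n//.
  rewrite uvE -{1}(divq_num_den q) (fmorph_div (@ratr R)) !rmorph_int nE DE.
  by apply/eqP.
have [a _ /dvdnP[b bE]] := Bezoutl n D0.
have cop : gcdn D n = 1%N by apply/eqP; rewrite -/(coprime D n) coprime_sym; exact: coprime_num_den.
rewrite cop in bE.
have Dr : 0 < D%:R :> R by rewrite ltr0n.
exists a, b; have -> : b%:R * v - a%:R * u = v / D%:R.
  have bD : b%:R * D%:R = 1 + a%:R * n%:R :> R by rewrite -!natrM -bE natrD.
  have uE : u = n%:R * v / D%:R by rewrite -E mulfK// gt_eqF.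
  have bE' : b%:R = (1 + a%:R * n%:R) / D%:R :> R by rewrite -bD mulfK// gt_eqF.
  by rewrite uE bE'; field; rewrite gt_eqF.
rewrite divr_gt0//= ltr_pdivrMr// mulrC -ltr_pdivrMr//.
by rewrite -DE.
Qed.

End Arithmetic.

Section PeriodicShifts.
Context {R : realType} {A : finType} (g : expanding_data R A) (r : \bar R).
Variables (e0 m k C : R).
Hypotheses (r1 : (1 < r)%E) (hg : expanding g r) (e01 : 0 < e0 <= 1)
  (m01 : 0 < m < 1) (k01 : 0 < k < 1) (C0 : 0 <= C)
  (hb : forall a b, trans g a b -> contracting_branch m k C e0 (inverse_branch g a b)).

Lemma periodic_expanding n z : periodic_point g n z ->
  expanding_loop g e0 k C z.2 z.1 (ln `|Diter g n z|) /\ 0 < ln `|Diter g n z|.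
Proof.
case: z => x b [Kz n0 per _]; have /andP[m0 m1] := m01; have /andP[k0 k1] := k01.
have [f [Lf fx hf fL]] := periodic_loop hg e01 m01 k01 C0 hb n0 Kz per.
have x1 := slice_unit hg (Kz : slice g b x).
have kn : k ^+ n < 1 by rewrite exprn_ilt1 ?(ltW k0)// -lt0n.
have mn : 0 < m ^+ n by rewrite exprn_gt0.
split; last by rewrite -oppr_lt0; exact: (log_multiplier_lt0 mn hf kn x1 fL).
exists (m ^+ n), (k ^+ n), f; split=> //; split=> //.
by rewrite exprn_gt0.
Qed.

(** When the irrational combination is negative the two orbits exchange roles. In the rational case
    every orbit is compared with the first, whose logarithm is fixed while the denominators grow. *)
Lemma periodic_shifts a :
  (exists (n m : nat) (x y : lines R A),
     [/\ periodic_point g n x, periodic_point g m y &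
         irrational (ln `|Diter g n x| / ln `|Diter g m y|)])
  \/
  (exists (x : nat -> lines R A) (per : nat -> nat) (q : nat -> rat),
     [/\ forall n, periodic_point g (per n) (x n),
         forall n, ln `|Diter g (per n) (x n)| / ln `|Diter g (per 0%N) (x 0%N)|
                   = ratr (q n) &
         forall M : int, \forall n \near \oo, M <= denq (q n)]) ->
  has_shifts (loop_map g a).
Proof.
move=> hper; apply: (loop_shifts hg e01 m01 k01 C0 hb) => delta delta0.
case: hper => [[n [l [x [y [px py irr]]]]]|[x [per [q [px qE den]]]]].
  have [Lx u0] := periodic_expanding px; have [Ly v0] := periodic_expanding py.
  have [p [q /andP[pq0 pqd]]] := irrational_combination u0 v0 irr delta0.
  have [pos|neg] := ltP 0 (q%:R * ln `|Diter g l y| - p%:R * ln `|Diter g n x|).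
    exists x.2, x.1, (ln `|Diter g n x|), y.2, y.1, (ln `|Diter g l y|), p, q; split; [exact: Lx|exact: Ly|].
    by move: pqd; rewrite (gtr0_norm pos) => ->; rewrite pos.
  exists y.2, y.1, (ln `|Diter g l y|), x.2, x.1, (ln `|Diter g n x|), q, p; split; [exact: Ly|exact: Lx|].
  by move: pq0 pqd; rewrite ler0_norm// opprB => -> ->.
have [L0 v0] := periodic_expanding (px 0%N).
pose M : int := (Num.truncn (ln `|Diter g (per 0%N) (x 0%N)| / delta)).+1.
have [n _ hn] := den M; have [Ln u0] := periodic_expanding (px n).
have [|p [l pl]] := rational_combination u0 v0 (qE n) _ delta0.
  by apply: lt_le_trans (truncnS_gt _) _; have := hn n (leqnn n); rewrite -(ler_int R).
exists (x n).2, (x n).1, (ln `|Diter g (per n) (x n)|).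
by exists (x 0%N).2, (x 0%N).1, (ln `|Diter g (per 0%N) (x 0%N)|), p, l.
Qed.

End PeriodicShifts.

(** * The image of a product of Cantor sets *)

Section StrictDerivative.
Context {R : realType} {A A' : finType} (h : lines R A * lines R A' -> R).
Implicit Types (p : lines R A * lines R A') (U : set (lines R A * lines R A')).

Lemma lines_near U p : nbhs p U -> exists2 delta, 0 < delta & forall x y,
  `|x - p.1.1| < delta -> `|y - p.2.1| < delta -> U ((x, p.1.2), (y, p.2.2)).
Proof.
case: p => [[u a] [u' a']] /nbhs_ballP[e /= e0 he]; exists e => // x y xo yo; apply: he.
by split; split => /=; rewrite -?ball_normE /= 1?distrC//; exact: ballxx.
Qed.

Lemma derivable_MVT (f : R -> R) (x y : R) :
  (forall t, Num.min x y <= t <= Num.max x y -> derivable f t 1) ->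
  exists2 c, Num.min x y <= c <= Num.max x y & f x - f y = derive1 f c * (x - y).
Proof.
wlog xy : x y / y <= x => [hw|].
  have [xy|] := boolP (y <= x); first exact: hw.
  rewrite -ltNge => /ltW yx.
  move=> df; have [|c hc E] := hw y x yx; first by move=> t; rewrite minC maxC; exact: df.
  exists c; first by rewrite minC maxC.
  by rewrite -[LHS]opprB E; ring.
rewrite min_r// max_l// => df.
have [||c] := @MVT_segment R f (derive1 f) y x xy.
- move=> t /subset_itv_oo_cc; rewrite in_itv /= => /df dt.
  by rewrite derive1E; apply: derivableP.
- by apply: derivable_within_continuous => t; rewrite in_itv /= => /df.
by rewrite in_itv /= => hc E; exists c.
Qed.

Lemma between_near (o d x y c : R) : `|x - o| < d -> `|y - o| < d ->
  Num.min x y <= c <= Num.max x y -> `|c - o| < d.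
Proof.
rewrite !ltr_norml => /andP[? ?] /andP[? ?].
by case: (leP x y) => _ /andP[? ?]; apply/andP; split; lra.
Qed.

(** One variable moves at a time, and the mean value theorem on the slices evaluates the partial
    derivatives at points close to [p]. *)
Lemma strict_derivative U p (eta : R) : open U -> C1_on h U -> U p -> 0 < eta ->
  exists2 delta, 0 < delta & forall x1 x2 y1 y2,
    `|x1 - p.1.1| < delta -> `|x2 - p.1.1| < delta ->
    `|y1 - p.2.1| < delta -> `|y2 - p.2.1| < delta ->
    `|h ((x1, p.1.2), (y1, p.2.2)) - h ((x2, p.1.2), (y2, p.2.2))
      - (partial1 h p * (x1 - x2) + partial2 h p * (y1 - y2))|
    <= eta * (`|x1 - x2| + `|y1 - y2|).
Proof.
move=> oU hC Up eta0; have [_ _ c1 c2] := hC _ Up.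
have /lines_near[d1 d10 h1] : nbhs p U by apply: open_nbhs_nbhs.
have /lines_near[d2 d20 h2] : nbhs p [set q | `|partial1 h p - partial1 h q| < eta].
  by have /cvgrPdist_lt /(_ _ eta0) := c1.
have /lines_near[d3 d30 h3] : nbhs p [set q | `|partial2 h p - partial2 h q| < eta].
  by have /cvgrPdist_lt /(_ _ eta0) := c2.
case: p Up c1 c2 h1 h2 h3 => [[u a] [u' a']] /= Up _ _ h1 h2 h3.
exists (Num.min d1 (Num.min d2 d3)); first by rewrite !lt_min d10 d20.
move=> x1 x2 y1 y2 hx1 hx2 hy1 hy2.
have small (z w : R) : `|z - w| < Num.min d1 (Num.min d2 d3) ->
  [/\ `|z - w| < d1, `|z - w| < d2 & `|z - w| < d3] by rewrite !lt_min => /and3P[].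
have [t ht|c hc Ec] := @derivable_MVT (slice1 h ((x1, a), (y1, a'))) x1 x2.
  have [tl1 _ _] := small _ _ (between_near hx1 hx2 ht).
  have [yl1 _ _] := small _ _ hy1.
  by have [+ _ _ _] := hC _ (h1 t y1 tl1 yl1).
have [hcl1 hcl2 _] := small _ _ (between_near hx1 hx2 hc).
have [yl1 yl2 _] := small _ _ hy1.
have [t ht|c' hc' Ec'] := @derivable_MVT (slice2 h ((x2, a), (y1, a'))) y1 y2.
  have [tl1 _ _] := small _ _ (between_near hy1 hy2 ht).
  have [xl1 _ _] := small _ _ hx2.
  by have [_ + _ _] := hC _ (h1 x2 t xl1 tl1).
have [_ _ hcl3] := small _ _ (between_near hy1 hy2 hc').
have [_ _ xl3] := small _ _ hx2.
have e1 := h2 c y1 hcl2 yl2; have e2 := h3 x2 c' xl3 hcl3.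
rewrite /slice1 /= in Ec; rewrite /slice2 /= in Ec'.
set p1 := partial1 h ((u, a), _) in e1 *; set p2 := partial2 h ((u, a), _) in e2 *.
have -> : h ((x1, a), (y1, a')) - h ((x2, a), (y2, a')) - (p1 * (x1 - x2) + p2 * (y1 - y2)) =
    (partial1 h ((c, a), (y1, a')) - p1) * (x1 - x2) +
    (partial2 h ((x2, a), (c', a')) - p2) * (y1 - y2).
  have -> : h ((x1, a), (y1, a')) - h ((x2, a), (y2, a')) =
    partial1 h ((c, a), (y1, a')) * (x1 - x2) + partial2 h ((x2, a), (c', a')) * (y1 - y2).
    by rewrite -[LHS](subrKA (h ((x2, a), (y1, a')))) Ec Ec'.
  by ring.
apply: le_trans (ler_normD _ _) _; rewrite [leRHS]mulrDr.
by apply: lerD; rewrite normrM ler_wpM2r// distrC ltW.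
Qed.

End StrictDerivative.

Section StartBoxes.
Context {R : realType} {A : finType} (g : expanding_data R A) (r : \bar R).
Variables (e0 m k C : R).
Hypotheses (r1 : (1 < r)%E) (hg : expanding g r) (e01 : 0 < e0 <= 1)
  (m01 : 0 < m < 1) (k01 : 0 < k < 1) (C0 : 0 <= C)
  (hb : forall a b, trans g a b -> contracting_branch m k C e0 (inverse_branch g a b)).

(** The loop follows [n] letters of the itinerary of [o], then returns to [a]; the return acts
    inside an interval of length at most [k ^ n]. *)
Lemma loop_near a o (delta : R) : slice g a o -> 0 < delta ->
  exists2 w, loop_map g a w & forall x, 0 <= x <= 1 -> `|w x - o| < delta.
Proof.
move=> Ko delta0; have /andP[k0 k1] := k01.
have [n kn] : exists n, k ^+ n < delta by apply: expr_small => //; rewrite (ltW k0).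
have [s [y [sn ps Ky oE]]] := itinerary hg n Ko.
have [t [pt lt]] := connected_letters hg (last a s) a.
exists (inverse_path g a (s ++ t)).
  by exists (s ++ t); rewrite cat_path ps pt last_cat.
move=> x x1; rewrite inverse_path_cat /= oE; apply: le_lt_trans kn.
have y1 := slice_unit hg Ky.
have z1 := branch_unit (path_branch e01 m01 k01 C0 hb pt) x1.
have hs := path_branch e01 m01 k01 C0 hb ps.
rewrite -sn; apply: le_trans (branch_le hs z1 y1) _.
rewrite ler_piMr ?exprn_ge0 ?(ltW k0)//.
by move: y1 z1 => /andP[? ?] /andP[? ?]; rewrite ler_norml; apply/andP; split; lra.
Qed.

End StartBoxes.

(** * Upper bounds by box counting *)

Section ListCovers.
Context {R : realType} {T : pseudoMetricType R}.

Lemma HD_le_list (I : eqType) (E : set T) (s M C : R) (F : R -> I -> set T) :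
  0 <= s -> 0 <= M -> 0 < C ->
  (forall e i, 0 < e <= 1 -> small_in (C * e) (F e i)) ->
  (forall e, 0 < e <= 1 -> exists2 L : seq I, (size L)%:R <= M * e `^ (- s) &
    forall x, E x -> exists2 i, i \in L & F e i x) ->
  (HD E <= s%:E)%E.
Proof.
move=> s0 M0 C0 small cov; apply: (HD_le_count s0 M0 C0) => e e1.
have [L sL EL] := cov e e1; exists (size L), (fun i => nth set0 [seq F e i | i <- L] i).
split=> // [x /EL[i iL Fx]|i].
  exists (index i L); first by rewrite /= index_mem.
  by rewrite (nth_map i) ?index_mem// nth_index.
have [iL|iL] := ltnP i (size L); last by rewrite nth_default ?size_map// => x y [].
case: L sL EL iL => // j L _ _ iL; rewrite (nth_map j)//; exact: small.
Qed.

End ListCovers.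

Section HDBounds.
Context {R : realType}.

Lemma HD_bounded (E : set R) (B : R) : (forall z, E z -> `|z| <= B) -> (HD E <= 1%:E)%E.
Proof.
move=> EB; have [B0|Bneg] := leP 0 B; last first.
  apply: (@HD_le_list _ _ unit E 1 0 1 (fun _ _ => set0)) => // e _.
    by move=> _ x y [].
  exists [::]; first by rewrite mul0r.
  by move=> x /EB; rewrite leNgt (lt_le_trans Bneg).
apply: (@HD_le_list _ _ nat E 1 (2 * B + 1) 1
  (fun e i => [set z | i%:R * e <= z + B < i%:R * e + e])) => //.
- by rewrite addr_ge0 ?mulr_ge0.
- move=> e i _ x y /= /andP[? ?] /andP[? ?]; rewrite -ball_normE /= mul1r ltr_norml.
  by apply/andP; split; lra.
move=> e /andP[e0 e1]; exists (iota 0 (Num.truncn (2 * B / e)).+1).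
  rewrite size_iota powRN powRr1 ?(ltW e0)// -(natr1 (Num.truncn _)).
  rewrite [leRHS]mulrDl mul1r lerD//.
    by rewrite truncn_le divr_ge0 ?mulr_ge0// ltW.
  by rewrite invf_ge1.
move=> z /EB; rewrite ler_norml => /andP[z1 z2].
have zB : 0 <= (z + B) / e by rewrite divr_ge0 ?(ltW e0)//; lra.
exists (Num.truncn ((z + B) / e)).
  rewrite mem_iota add0n ltnS; apply: le_truncn; rewrite ler_pM2r ?invr_gt0//; lra.
have /andP[t1 t2] := truncn_itv zB.
by move: t1 t2; rewrite ler_pdivlMr// ltr_pdivrMr// -(natr1 (Num.truncn _)) [ltRHS]mulrDl mul1r /= => -> ->.
Qed.

End HDBounds.

Section CantorCovers.
Context {R : realType} {A : finType} (g : expanding_data R A) (r : \bar R).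
Hypotheses (r1 : (1 < r)%E) (hg : expanding g r).

Lemma HD_cantor_le1 : (HD (cantor_set g) <= 1%:E)%E.
Proof.
apply: (@HD_le_list R (lines R A) (A * R)%type (cantor_set g) 1 (#|A|%:R * 2) 3
  (fun e ac => [set z : lines R A | z.2 = ac.1 /\ `|z.1 - ac.2| <= e])) => //.
- by move=> e [a c] /andP[e0 _] [x b] [y b'] /= [-> xc] [-> yc]; split => /=;
     [rewrite -ball_normE /=; move: xc yc; rewrite !ler_norml ltr_norml => /andP[? ?] /andP[? ?];
        apply/andP; split; lra|exact/ballxx/mulr_gt0].
move=> e e1; have e0 : 0 <= e by case/andP: e1 => /ltW.
have [l sl [_ lP]] := @covering_grid _ [set x : R | 0 <= x <= 1] _ e1 (fun _ => id).
exists [seq (a, c) | a <- enum A, c <- l].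
  by rewrite size_allpairs natrM -cardE -mulrA ler_wpM2l// powRN powRr1.
move=> [x a] Kx; have [c cl xc] := lP x (slice_unit hg Kx).
by exists (a, c) => //; apply: allpairs_f; rewrite ?mem_enum.
Qed.

Variables (e0 m k C : R).
Hypotheses (e01 : 0 < e0 <= 1)
  (m01 : 0 < m < 1) (k01 : 0 < k < 1) (C0 : 0 <= C)
  (hb : forall a b, trans g a b -> contracting_branch m k C e0 (inverse_branch g a b)).

Lemma cantor_cover (s : R) : (HD (cantor_set g) < s%:E)%E ->
  exists2 M : R, 0 <= M & forall e, 0 < e <= 1 ->
    exists2 l : seq (A * R), (size l)%:R <= M * e `^ (- s) &
      forall z, cantor_set g z -> exists2 c, (z.2, c) \in l & `|z.1 - c| <= e.
Proof.
move=> HDs; have [M M0 HM] := covering_number_le hg e01 m01 k01 C0 hb HDs.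
exists (#|A|%:R * M); first exact: mulr_ge0.
move=> e e1; have /choice[l lP] a : exists l, (size l)%:R <= M * e `^ (- s) /\ covering (slice g a) e l.
  by have [l] := HM a e e1; exists l.
exists [seq (a, c) | a <- enum A, c <- l a].
  rewrite size_allpairs_dep sumnE big_map -mulrA big_enum /= natr_sum.
  rewrite -sumr_const mulr_suml; apply: ler_sum => a _; rewrite mul1r.
  by have [] := lP a.
move=> [x a] Kx; have [_ [_ lc]] := lP a; have [c cl xc] := lc x Kx.
by exists c => //; apply/allpairsPdep; exists a, c; rewrite mem_enum.
Qed.

End CantorCovers.

Section CompactLipschitz.
Context {R : realType}.
Implicit Types (H : R -> R -> R) (S : set R).

(** One integer bounds the value, the Lipschitz constant and the inverse of the radius; the property
    is then monotone in [N], and compactness yields a common [N]. *)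
Definition lipschitz_at H (N : nat) (x y : R) : Prop := `|H x y| <= N%:R /\
  forall x1 y1, `|x1 - x| <= N.+1%:R^-1 -> `|y1 - y| <= N.+1%:R^-1 ->
    `|H x1 y1 - H x y| <= N%:R * (`|x1 - x| + `|y1 - y|).

Lemma lipschitz_at_le H N N' x y : (N <= N')%N -> lipschitz_at H N x y -> lipschitz_at H N' x y.
Proof.
move=> NN [h1 h2]; split; first by apply: le_trans h1 _; rewrite ler_nat.
have inv : N'.+1%:R^-1 <= N.+1%:R^-1 :> R by rewrite lef_pV2 ?posrE ?ltr0n// ler_nat.
move=> x1 y1 hx hy; apply: le_trans (h2 x1 y1 (le_trans hx inv) (le_trans hy inv)) _.
by rewrite ler_wpM2r ?addr_ge0// ler_nat.
Qed.

Lemma lipschitz_at_compact H S S' : compact S -> compact S' ->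
  (forall x y, S x -> S' y -> exists delta L : R, 0 < delta /\ forall x1 x2 y1 y2,
    `|x1 - x| < delta -> `|x2 - x| < delta -> `|y1 - y| < delta -> `|y2 - y| < delta ->
    `|H x1 y1 - H x2 y2| <= L * (`|x1 - x2| + `|y1 - y2|)) ->
  exists N, forall x y, S x -> S' y -> lipschitz_at H N x y.
Proof.
move=> cS cS' loc.
have := iffLR (compact_near_coveringP _) (compact_setX cS cS').
move=> /(_ nat \oo (fun n z => lipschitz_at H n z.1 z.2) _)[].
  move=> [x y] [/= Sx Sy]; have [delta [L [d0 lip]]] := loc _ _ Sx Sy.
  pose N := (Num.truncn (Num.max (2 / delta) (Num.max L (`|H x y| + `|L| * (delta + delta))))).+1.
  have NP : Num.max (2 / delta) (Num.max L (`|H x y| + `|L| * (delta + delta))) < N%:R by exact: truncnS_gt.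
  move: NP; rewrite !gt_max => /and3P[N1 N2 N3].
  exists ([set z | ball x (delta / 2) z.1 /\ ball y (delta / 2) z.2], [set n | (N <= n)%N]) => /=.
    split; last by exists N.
    exists (ball x (delta / 2), ball y (delta / 2)) => //=.
    by split; apply: nbhsx_ballx; rewrite divr_gt0.
  move=> [[x' y'] n] /= [[+ +] Nn]; rewrite -!ball_normE /= (distrC x) (distrC y) => xx yy.
  have dd : delta / 2 < delta by rewrite ltr_pdivrMr// ltr_pMr// ltr1n.
  have xx' := lt_trans xx dd; have yy' := lt_trans yy dd.
  apply: lipschitz_at_le Nn _; split.
    apply/ltW/(le_lt_trans _ N3); rewrite -lerBlDl.
    apply: le_trans (lerB_dist _ _) _.
    apply: le_trans (lip _ _ _ _ xx' _ yy' _) _; rewrite ?subrr ?normr0//.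
    apply: le_trans (_ : `|L| * (`|x' - x| + `|y' - y|) <= _).
      by rewrite ler_wpM2r ?addr_ge0// ler_norm.
    by rewrite ler_wpM2l// lerD// ltW.
  have hN : N.+1%:R^-1 < delta / 2.
    rewrite -[ltRHS]invrK ltf_pV2 ?posrE ?invr_gt0 ?divr_gt0//.
    by rewrite invf_div; apply: lt_trans N1 _; rewrite ltr_nat.
  have near_lt (u v w : R) : `|u - v| <= N.+1%:R^-1 -> `|v - w| < delta / 2 -> `|u - w| < delta.
    move=> uv vw; rewrite -(subrKA v) (le_lt_trans (ler_normD _ _))//.
    by rewrite [ltRHS](splitr delta) ltrD// (le_lt_trans uv).
  move=> x1 y1 hx hy; apply: le_trans (lip _ _ _ _ _ _ _ _) _ => //.
  - exact: near_lt hx xx.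
  - exact: near_lt hy yy.
  by rewrite ler_wpM2r ?addr_ge0// ltW.
move=> N _ h; exists N => x y Sx Sy; exact: (h N (leqnn N) (x, y)).
Qed.

End CompactLipschitz.

Section Weakening.
Context {R : realType}.
Implicit Types (F : (R -> R) -> Prop).

Lemma quasi_affine_monoid_le (K K' : R) F : 0 < K -> K <= K' ->
  quasi_affine_monoid K F -> quasi_affine_monoid K' F.
Proof.
move=> K0 KK [F1 FM FQ]; split=> // f /FQ[f0 f01 h]; split=> // x y hx hy.
have [h1 h2 h3] := h x y hx hy; split=> //.
  apply: le_trans h1; rewrite !ler_wpM2r ?(ltW f0)// lef_pV2 ?posrE//.
  exact: lt_le_trans KK.
by apply: le_trans h2 _; rewrite !ler_wpM2r ?(ltW f0).
Qed.

Lemma has_families_le F (o d c1 c1' : R) : c1' <= c1 ->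
  has_families F o d c1 -> has_families F o d c1'.
Proof.
move=> cc h eta /h[eps0 eps00 he]; exists eps0 => // eps epsP.
have [N [e [N0 eP he']]] := he eps epsP; exists N, e; split=> // i.
have [Fe /andP[e1 e2]] := eP i; split=> //; rewrite e2 andbT; apply: le_trans e1.
by rewrite ler_wpM2r//; case/andP: epsP => /ltW.
Qed.

End Weakening.

Section Images.
Context {R : realType} {A A' : finType}.
Variables (g : expanding_data R A) (g' : expanding_data R A') (r r' : \bar R).
Variables (e0 m k C e0' m' k' C' : R).
Hypotheses (r1 : (1 < r)%E) (hg : expanding g r) (e01 : 0 < e0 <= 1)
  (m01 : 0 < m < 1) (k01 : 0 < k < 1) (C0 : 0 <= C)
  (hb : forall a b, trans g a b -> contracting_branch m k C e0 (inverse_branch g a b)).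
Hypotheses (r1' : (1 < r')%E) (hg' : expanding g' r') (e01' : 0 < e0' <= 1)
  (m01' : 0 < m' < 1) (k01' : 0 < k' < 1) (C0' : 0 <= C')
  (hb' : forall a b, trans g' a b ->
    contracting_branch m' k' C' e0' (inverse_branch g' a b)).
Variables (h : lines R A * lines R A' -> R) (U : set (lines R A * lines R A')).
Hypotheses (oU : open U) (KU : cantor_set g `*` cantor_set g' `<=` U) (hC : C1_on h U).

Lemma lipschitz_uniform : exists N, forall z z', cantor_set g z -> cantor_set g' z' ->
  lipschitz_at (fun x y => h ((x, z.2), (y, z'.2))) N z.1 z'.1.
Proof.
have /choice[N NP] (aa : A * A') : exists N, forall x y, slice g aa.1 x -> slice g' aa.2 y ->
    lipschitz_at (fun x y => h ((x, aa.1), (y, aa.2))) N x y.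
  case: aa => a a' /=; apply: lipschitz_at_compact.
  - exact: (slice_compact hg e01 m01 k01 C0 hb).
  - exact: (slice_compact hg' e01' m01' k01' C0' hb').
  move=> x y Kx Ky; have Up : U ((x, a), (y, a')) by apply: KU.
  have [delta d0 sd] := strict_derivative oU hC Up ltr01.
  set g1 := partial1 h _ in sd; set g2 := partial2 h _ in sd.
  exists delta, (`|g1| + `|g2| + 1); split=> // x1 x2 y1 y2 hx1 hx2 hy1 hy2.
  have := sd _ _ _ _ hx1 hx2 hy1 hy2 => /=.
  rewrite mul1r => s; rewrite -[X in `|X|](subrK (g1 * (x1 - x2) + g2 * (y1 - y2))).
  apply: le_trans (ler_normD _ _) _; rewrite mulrDl mul1r addrC lerD//.
  apply: le_trans (ler_normD _ _) _; rewrite !normrM.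
  have := mulr_ge0 (normr_ge0 g1) (normr_ge0 (y1 - y2)).
  have := mulr_ge0 (normr_ge0 g2) (normr_ge0 (x1 - x2)).
  by lra.
exists (\sum_aa N aa)%N => -[x a] [y a'] Kx Ky /=.
apply: lipschitz_at_le (NP (a, a') x y Kx Ky).
by rewrite (bigD1 (a, a'))//= leq_addr.
Qed.

Lemma HD_image_le1 : (HD (h @` (cantor_set g `*` cantor_set g')) <= 1%:E)%E.
Proof.
have [N NP] := lipschitz_uniform; apply: (@HD_bounded _ _ N%:R).
move=> _ [[[x a] [y a']] [/= Kx Ky] <-].
by have [] := NP _ _ Kx Ky.
Qed.

Lemma HD_image_le_sum (d d' : R) : HD (cantor_set g) = d%:E -> HD (cantor_set g') = d'%:E ->
  (HD (h @` (cantor_set g `*` cantor_set g')) <= (d + d')%:E)%E.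
Proof.
move=> HDd HDd'; apply/lee_addgt0Pr => eta eta0; rewrite -EFinD.
have d0 : 0 <= d by rewrite -lee_fin -HDd HD_ge0.
have d0' : 0 <= d' by rewrite -lee_fin -HDd' HD_ge0.
pose s := d + eta / 2; pose s' := d' + eta / 2.
have s0 : 0 <= s by rewrite addr_ge0// divr_ge0// ltW.
have s0' : 0 <= s' by rewrite addr_ge0// divr_ge0// ltW.
have -> : d + d' + eta = s + s' by rewrite /s /s'; field.
have [|M M0 cM] := cantor_cover hg e01 m01 k01 C0 hb (s := s).
  by rewrite HDd lte_fin ltrDl divr_gt0.
have [|M' M0' cM'] := cantor_cover hg' e01' m01' k01' C0' hb' (s := s').
  by rewrite HDd' lte_fin ltrDl divr_gt0.
have [N NP] := lipschitz_uniform.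
(* Two points of one cell are then within the radius [1 / N.+1] of [lipschitz_at]. *)
pose q : R := N.+1%:R^-1 / 2.
have n0 : 0 < N.+1%:R^-1 :> R by rewrite invr_gt0 ltr0n.
have n1 : N.+1%:R^-1 <= 1 :> R by rewrite invf_le1 ?ltr0n// ler1n.
have q0 : 0 < q by rewrite divr_gt0.
have q1 : q <= 1 by rewrite /q ler_pdivrMr// mul1r (le_trans n1)// ler1n.
apply: (@HD_le_list R R ((A * R) * (A' * R))%type _ (s + s')
  (M * M' * q `^ (- (s + s'))) (2 * N%:R + 1)
  (fun e cc => [set w | exists z z', [/\ cantor_set g z, cantor_set g' z',
     z.2 = cc.1.1 /\ z'.2 = cc.2.1, `|z.1 - cc.1.2| <= q * e /\ `|z'.1 - cc.2.2| <= q * e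
     & w = h (z, z')]])) => //.
- exact: addr_ge0.
- by rewrite mulr_ge0 ?powR_ge0// mulr_ge0.
- move=> e [[a c] [a' c']] /andP[ep e1] p1 p2 /= [z [z' [Kz Kz' [za za'] [zc zc'] ->]]].
  move=> [w [w' [Kw Kw' [wa wa'] [wc wc'] ->]]]; rewrite -ball_normE /=.
  have [_ lip] := NP _ _ Kz Kz'.
  have two (u v c0 : R) : `|u - c0| <= q * e -> `|v - c0| <= q * e -> `|v - u| <= N.+1%:R^-1 * e.
    move=> uc vc; rewrite -(subrKA c0) (le_trans (ler_normD _ _))// (distrC c0).
    rewrite (_ : N.+1%:R^-1 = q + q); last by rewrite /q; field.
    by rewrite mulrDl lerD.
  have ne : N.+1%:R^-1 * e <= N.+1%:R^-1 :> R by rewrite ler_piMr// ltW.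
  have d1 := two _ _ _ zc wc; have d2 := two _ _ _ zc' wc'.
  have := lip w.1 w'.1 (le_trans d1 ne) (le_trans d2 ne).
  rewrite za za' -{1}wa -{1}wa' -{1}za -{1}za' -!surjective_pairing distrC => H.
  apply: le_lt_trans H _; apply: le_lt_trans (_ : N%:R * (e + e) < _).
    rewrite ler_wpM2l// lerD//; [apply: le_trans d1 _|apply: le_trans d2 _];
      by rewrite ler_piMl// ltW.
  by rewrite -subr_gt0 (_ : _ - _ = e)//; ring.
move=> e /andP[ep e1].
have qe1 : 0 < q * e <= 1 by rewrite mulr_gt0//= mulr_ile1// ltW.
have [l sl lP] := cM _ qe1; have [l' sl' lP'] := cM' _ qe1.
exists [seq (u, v) | u <- l, v <- l'].
  rewrite size_allpairs natrM; apply: le_trans (ler_pM _ _ sl sl') _ => //.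
  have nE (b : R) : 0 < b -> b `^ (- (s + s')) = b `^ (- s) * b `^ (- s').
    by move=> b0; rewrite opprD powRD//; apply/implyP => _; rewrite gt_eqF.
  apply: le_of_eq; rewrite !(powRM _ (ltW q0) (ltW ep)) (nE q)// (nE e)//.
  by move: (q `^ _) (q `^ _) (e `^ _) (e `^ _) => *; ring.
move=> _ [[[x a] [y a']] [/= Kx Ky] <-].
have [c cl xc] := lP _ Kx; have [c' cl' yc'] := lP' _ Ky.
exists ((a, c), (a', c')); first exact: allpairs_f.
by exists (x, a), (y, a').
Qed.

End Images.

Theorem corollary2 (R : realType) (A A' : finType)
    (g : expanding_data R A) (g' : expanding_data R A') (c0 alpha : R)
    (hg : regular_map g) (hg' : regular_map g')
    (hc0 : 1 < c0) (halpha : 0 < alpha <= 1) (hH : property_H g c0 alpha)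
    (hper :
      (exists (n m : nat) (x y : lines R A),
         [/\ periodic_point g n x, periodic_point g m y &
             irrational (ln `|Diter g n x| / ln `|Diter g m y|)])
      \/
      (* the sequence is indexed from 0 *)
      (exists (x : nat -> lines R A) (per : nat -> nat) (q : nat -> rat),
         [/\ forall n, periodic_point g (per n) (x n),
             forall n, ln `|Diter g (per n) (x n)| / ln `|Diter g (per 0%N) (x 0%N)|
                       = ratr (q n) &
             forall M : int, \forall n \near \oo, M <= denq (q n)]))
    (h : lines R A * lines R A' -> R) (U : set (lines R A * lines R A'))
    (hU : open U) (hKU : cantor_set g `*` cantor_set g' `<=` U)
    (hC1 : C1_on h U)
    (hgrad : exists p, [/\ (cantor_set g `*` cantor_set g') p,
                           partial1 h p != 0 & partial2 h p != 0]) :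
  HD (h @` (cantor_set g `*` cantor_set g'))
    = Order.min 1%E (HD (cantor_set g) + HD (cantor_set g'))%E.
Proof.
have [r r1 {}hg] := hg; have [r' r1' {}hg'] := hg'.
have [e0 [m [k [C [e01 m01 k01 C0 hb]]]]] := branches_contracting r1 hg.
have [e0' [m' [k' [C' [e01' m01' k01' C0' hb']]]]] := branches_contracting r1' hg'.
have fin (B : finType) (f : expanding_data R B) s : expanding f s ->
    exists d : R, HD (cantor_set f) = d%:E.
  move=> hf; exists (fine (HD (cantor_set f))); rewrite fineK// ge0_fin_numE ?HD_ge0//.
  exact: le_lt_trans (HD_cantor_le1 hf) (ltry 1).
have [d HDd] := fin _ _ _ hg; have [d' HDd'] := fin _ _ _ hg'.
have ub := HD_image_le_sum hg e01 m01 k01 C0 hb hg' e01' m01' k01' C0' hb' hU hKU hC1 HDd HDd'.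
have ub1 := HD_image_le1 hg e01 m01 k01 C0 hb hg' e01' m01' k01' C0' hb' hU hKU hC1.
rewrite HDd HDd' -EFinD -EFin_min; apply/eqP; rewrite eq_le; apply/andP; split.
  by rewrite EFin_min le_min ub1.
(* It suffices to reach [t], the minimum less [eta]; a negative [t] is immediate. *)
apply/lee_addgt0Pr => eta eta0; rewrite -leeBlDr//.
pose t := Num.min 1 (d + d') - eta.
rewrite -[X in (X <= _)%E]/(t%:E); have [t0|tneg] := leP 0 t; last first.
  by apply: le_trans (HD_ge0 _); rewrite lee_fin ltW.
have [t1 td] : t < 1 /\ t < d + d'.
  by split; rewrite /t ltrBlDr gt_min ltrDl eta0 ?orbT.
(* The loops are based at the letters of the point where both partial derivatives are nonzero, and
   its coordinates serve as [o] and [o']. *)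
have [[[u a] [u' a']] [[/= Ko Ko'] g10 g20]] := hgrad.
have [c c01 fam] := loop_families hg e01 m01 k01 C0 hb Ko HDd.
have [c' c01' fam'] := loop_families hg' e01' m01' k01' C0' hb' Ko' HDd'.
have K0 := expR_gt0 (path_const e0 k C).
have K1 : 1 <= expR (path_const e0 k C) := Cq_ge1 e01 k01 C0.
have K0' := expR_gt0 (path_const e0' k' C').
pose K := Num.max (expR (path_const e0 k C)) (expR (path_const e0' k' C')).
have FM : quasi_affine_monoid K (loop_map g a).
  by apply: (quasi_affine_monoid_le K0) (loop_monoid e01 m01 k01 C0 hb a); rewrite le_max lexx.
have FM' : quasi_affine_monoid K (loop_map g' a').
  apply: (quasi_affine_monoid_le K0') (loop_monoid e01' m01' k01' C0' hb' a').
  by rewrite le_max lexx orbT.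
have shifts := periodic_shifts hg e01 m01 k01 C0 hb a hper.
apply: (@HD_ge_macro R K (Num.min c c') d d' u u' (partial1 h ((u, a), (u', a')))
  (partial2 h ((u, a), (u', a'))) t (loop_map g a) (loop_map g' a')
  (fun x y => h ((x, a), (y, a'))) (slice g a) (slice g' a')) => //.
- by rewrite le_max K1.
- by move: c01 c01' => /andP[? ?] /andP[? ?]; rewrite lt_min ge_min; apply/andP; split;
    [apply/andP|apply/orP; left].
- by apply: has_families_le fam; rewrite ge_min lexx.
- by apply: has_families_le fam'; rewrite ge_min lexx orbT.
- exact: (slice_compact hg e01 m01 k01 C0 hb).
- exact: (slice_compact hg' e01' m01' k01' C0' hb').
- by move=> x; exact: (slice_unit hg).
- by move=> x; exact: (slice_unit hg').
- by move=> f x [s [ps ls ->]] Kx; apply: (path_slice hg ps); rewrite ls.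
- by move=> f x [s [ps ls ->]] Kx; apply: (path_slice hg' ps); rewrite ls.
- move=> e e_gt0; have Up := hKU _ (conj Ko Ko' : (cantor_set g `*` cantor_set g') ((u, a), (u', a'))).
  have [delta delta0 sd] := strict_derivative hU hC1 Up e_gt0.
  have [w Lw wo] := loop_near hg e01 m01 k01 C0 hb Ko delta0.
  have [w' Lw' wo'] := loop_near hg' e01' m01' k01' C0' hb' Ko' delta0.
  exists w, w'; split=> // x1 x2 y1 y2 hx1 hx2 hy1 hy2.
  by apply: sd => /=; rewrite ?wo ?wo'.
by move=> x y Kx Ky; exists ((x, a), (y, a')).
Qed.
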